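(* Let $\psi$ be an admissible obstacle and let $\gamma_0=(\gamma_{0,1},\gamma_{0,2})\in P_\psi$. Let $B_{\gamma_0}$ be the set of $\cap$-shaped pseudographs lying above $\gamma_0$. Then there is $\gamma\in B_{\gamma_0}$ such that the graph reparametrization $u$ of $\gamma$ is concave, $\mathcal{E}(\gamma)\le\mathcal{E}(\gamma_0)$ and $\mathcal{L}(\gamma)\le\mathcal{L}(\gamma_0)$. In particular, for each $\epsilon\ge 0$, $\mathcal{E}_\epsilon(\gamma)\le\mathcal{E}_\epsilon(\gamma_0)$.
   Context: Admissible obstacle: $\psi\in C^0([0,1])$ with $\psi(0)<0$, $\psi(1)<0$, $\max_{[0,1]}\psi>0$, such that at every $x\in(0,1)$ the one-sided derivatives $\partial_+\psi(x),\partial_-\psi(x)$ exist and are bounded in absolute value by a constant independent of $x$. Curves $\gamma=(\gamma_1,\gamma_2)$ in $W^{1,1}((0,1);\mathbb{R}^2)$ are identified with their continuous representatives on $[0,1]$. $\gamma$ is immersed if there is $\epsilon>0$ with $|\gamma'|>\epsilon$ on $(0,1)$. A curve $\gamma\in W^{1,1}((0,1);\mathbb{R}^2)\cap W^{2,1}_{loc}((0,1);\mathbb{R}^2)$ is a pseudograph if it is immersed, $\gamma_1'(t)\ge0$ for each $t\in(0,1)$, and whenever $\gamma_1'>0$ on some interval $(a,b)$, then $\gamma_2\circ\gamma_1^{-1}\in W^{2,2}_{loc}(\gamma_1(a),\gamma_1(b))$. $P_\psi:=\{\gamma \text{ pseudograph}:\gamma(0)=(0,0)^T,\ \gamma(1)=(1,0)^T,\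 \gamma_2\ge\psi\circ\gamma_1\}$. Energies (values in $[0,\infty]$): $\mathcal{E}(\gamma)=\int_0^1\frac{\langle\gamma'',N_\gamma\rangle^2}{|\gamma'|^3}dt$ with $N_\gamma=\frac{1}{|\gamma'|}(-\gamma_2',\gamma_1')^T$; $\mathcal{L}(\gamma)=\int_0^1|\gamma'|dt$; $\mathcal{E}_\epsilon=\mathcal{E}+\epsilon\mathcal{L}$. $B_{\gamma_0}$ is the set of all $\gamma\in P_\psi$ for which there are $0\le\beta_1<\beta_2\le1$ with $\gamma_1=0$ on $[0,\beta_1]$, $\gamma_1=1$ on $[\beta_2,1]$, $\gamma_1'(t)>0$ for all $t\in(\beta_1,\beta_2)$, and such that the graph reparametrization $u:=\gamma_2\circ(\gamma_1|_{(\beta_1,\beta_2)})^{-1}:(0,1)\to\mathbb{R}$, extended continuously to $[0,1]$ by $u(0)=\gamma_2(\beta_1)$, $u(1)=\gamma_2(\beta_2)$, satisfies $u(\gamma_{0,1}(t))\ge\gamma_{0,2}(t)$ for all $t\in[0,1]$. *)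

(* Defs.v *)
From HB Require Import structures.
From mathcomp Require Import all_boot all_order all_algebra.
From mathcomp Require Import all_classical all_reals all_analysis.

Set Implicit Arguments.
Unset Strict Implicit.
Unset Printing Implicit Defensive.

Import Order.TTheory GRing.Theory Num.Theory.
Import numFieldNormedType.Exports.

Local Open Scope classical_set_scope.
Local Open Scope ring_scope.

(* Functions on an interval are total functions R -> R of which only the values
   on the interval matter. *)

Section sobolev.
Context {R : realType}.
Local Notation mu := (@lebesgue_measure R).

Definition Lp (p : \bar R) (D : set R) (f : R -> R) : Prop :=
  measurable_fun D f /\ finite_norm mu p (f \_ D).

Definition Lp_loc (p : \bar R) (a b : R) (f : R -> R) : Prop :=
  forall c d : R, a < c -> d < b -> Lp p `[c, d] f.

(* Sobolev spaces on an interval are defined as in Brezis, Functional Analysis,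
   Sobolev Spaces and Partial Differential Equations, Section 8.2: the test
   functions are those of class C^1 with compact support. *)
Definition test_function (a b : R) (phi : R -> R) : Prop :=
  [/\ forall x, derivable phi x 1, continuous (derive1 phi) &
      exists c d : R, [/\ a < c, d < b &
        forall x, x \notin `[c, d] -> phi x = 0]].

Definition weak_derivative (a b : R) (f g : R -> R) : Prop :=
  forall phi : R -> R, test_function a b phi ->
    \int[mu]_(x in `]a, b[) (f x * derive1 phi x) =
    - \int[mu]_(x in `]a, b[) (g x * phi x).

(* f and its weak derivatives up to order k belong to the function class X *)
Fixpoint sobolev (X : (R -> R) -> Prop) (a b : R) (k : nat) (f : R -> R) : Prop :=
  X f /\ (if k is k'.+1
          then exists2 g, weak_derivative a b f g & sobolev X a b k' g
          else True).

Definition Wkp (k : nat) (p : \bar R) (a b : R) : (R -> R) -> Prop :=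
  sobolev (Lp p `]a, b[) a b k.

Definition Wkp_loc (k : nat) (p : \bar R) (a b : R) : (R -> R) -> Prop :=
  sobolev (Lp_loc p a b) a b k.

(* a weak derivative of f on (a, b), unique up to a null set if there is one *)
Definition wderiv (a b : R) (f : R -> R) : R -> R :=
  xget (fun=> 0) [set g | Lp_loc 1%E a b g /\ weak_derivative a b f g].

End sobolev.

Section obstacle.
Context {R : realType}.

Definition admissible_obstacle (psi : R -> R) : Prop :=
  [/\ {within `[0, 1], continuous psi},
      psi 0 < 0 /\ psi 1 < 0,
      exists x, [/\ x \in `[0, 1], forall y, y \in `[0, 1] -> psi y <= psi x &
                    0 < psi x] &
      exists M : R, forall x, x \in `]0, 1[ ->
        exists dr dl : R,
          [/\ (psi (x + h) - psi x) / h @[h --> 0^'+] --> dr,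
              (psi (x + h) - psi x) / h @[h --> 0^'-] --> dl,
              `|dr| <= M & `|dl| <= M]].

End obstacle.

Section curves.
Context {R : realType}.
Local Notation mu := (@lebesgue_measure R).
Implicit Types (gamma : R -> R * R) (psi : R -> R).

Definition coord1 gamma : R -> R := fun t => (gamma t).1.
Definition coord2 gamma : R -> R := fun t => (gamma t).2.

(* For a curve in W^{2,1}_loc the continuous representative of the first
   derivative is the classical derivative. *)
Definition d1 gamma : R -> R := derive1 (coord1 gamma).
Definition d2 gamma : R -> R := derive1 (coord2 gamma).

Definition speed gamma (t : R) : R := Num.sqrt (d1 gamma t ^+ 2 + d2 gamma t ^+ 2).

Definition dd1 gamma : R -> R := wderiv 0 1 (d1 gamma).
Definition dd2 gamma : R -> R := wderiv 0 1 (d2 gamma).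

Definition normal gamma (t : R) : R * R :=
  (- d2 gamma t / speed gamma t, d1 gamma t / speed gamma t).

Definition immersed gamma : Prop :=
  exists2 e : R, 0 < e & forall t, t \in `]0, 1[ -> e < speed gamma t.

Definition inv_on (a b : R) (f : R -> R) : R -> R := 'pinv_(fun=> 0) `]a, b[ f.

Definition graph_on (a b : R) gamma : R -> R :=
  coord2 gamma \o inv_on a b (coord1 gamma).

Record pseudograph gamma : Prop := Pseudograph {
  pg_continuous : {within `[0, 1], continuous gamma} ;
  pg_W11 : Wkp 1 1%E 0 1 (coord1 gamma) /\ Wkp 1 1%E 0 1 (coord2 gamma) ;
  pg_W21 : Wkp_loc 2 1%E 0 1 (coord1 gamma) /\ Wkp_loc 2 1%E 0 1 (coord2 gamma) ;
  pg_immersed : immersed gamma ;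
  pg_monotone : forall t, t \in `]0, 1[ -> 0 <= d1 gamma t ;
  pg_graph : forall a b : R, 0 <= a -> a < b -> b <= 1 ->
    (forall t, t \in `]a, b[ -> 0 < d1 gamma t) ->
    Wkp_loc 2 2%:E (coord1 gamma a) (coord1 gamma b) (graph_on a b gamma) }.

Definition Ppsi psi : set (R -> R * R) :=
  [set gamma | [/\ pseudograph gamma, gamma 0 = (0, 0), gamma 1 = (1, 0) &
    forall t, t \in `[0, 1] -> psi (coord1 gamma t) <= coord2 gamma t]].

Definition elastic gamma : \bar R :=
  \int[mu]_(t in `]0, 1[)
    (((dd1 gamma t * (normal gamma t).1 + dd2 gamma t * (normal gamma t).2) ^+ 2
      / speed gamma t ^+ 3)%:E).

Definition curve_length gamma : \bar R :=
  \int[mu]_(t in `]0, 1[) ((speed gamma t)%:E).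

Definition penalized (eps : R) gamma : \bar R :=
  (elastic gamma + eps%:E * curve_length gamma)%E.

(* b1 and b2 are uniquely determined by gamma *)
Definition cap_shaped (b1 b2 : R) gamma : Prop :=
  [/\ 0 <= b1, b1 < b2 & b2 <= 1] /\
  [/\ forall t, t \in `[0, b1] -> coord1 gamma t = 0,
      forall t, t \in `[b2, 1] -> coord1 gamma t = 1 &
      forall t, t \in `]b1, b2[ -> 0 < d1 gamma t].

Definition graph_reparam (b1 b2 : R) gamma : R -> R :=
  fun x => if x == 0 then coord2 gamma b1
           else if x == 1 then coord2 gamma b2
           else graph_on b1 b2 gamma x.

Definition lies_above (u : R -> R) gamma0 : Prop :=
  forall t, t \in `[0, 1] -> coord2 gamma0 t <= u (coord1 gamma0 t).

Definition Bset psi gamma0 : set (R -> R * R) :=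
  [set gamma | Ppsi psi gamma /\ exists b1 b2 : R,
    cap_shaped b1 b2 gamma /\ lies_above (graph_reparam b1 b2 gamma) gamma0].

Definition concave_on (D : set R) (u : R -> R) : Prop :=
  @convex_function R R^o D (fun x => - u x).

End curves.

(* Main.v *)
(* The new curve has the length of gamma0, constant speed, and as tangent angle
   the decreasing rearrangement of the tangent angle theta of gamma0 with respect
   to arc length.  The end point is given by the integrals of cos theta and
   sin theta, which depend only on the distribution N of theta, so it does not
   move; and a curve with decreasing angle in [-pi/2, pi/2] is a concave cap.  It
   lies above gamma0 because the height of a point of gamma0 over the line of
   angle phi through the origin is an integral of sin(theta - phi) along an
   initial arc, hence at most the integral of max(0, sin(theta - phi)), which is
   the height of the new curve where its angle is phi.

   For the energy, let r be the density with respect to N of Lebesgue measure on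
   the range of theta: the new energy is the integral of r^2 with respect to N.
   By the intermediate value theorem Lebesgue measure on the range is at most the
   image under theta of |theta'| ds, and Cauchy-Schwarz bounds the integral of
   r^2 by that of |theta'|^2.  The same argument on an arc of gamma0 which is a
   W^{2,2} graph gives the local W^{2,2} regularity of the new graph, even when
   the energy of gamma0 is infinite. *)

Require Import Defs.
From HB Require Import structures.
From mathcomp Require Import all_boot all_order all_algebra.
From mathcomp Require Import all_classical all_reals all_analysis.
From mathcomp Require Import measurable_realfun ring lra.

Set Implicit Arguments.
Unset Strict Implicit.
Unset Printing Implicit Defensive.

Import Order.TTheory GRing.Theory Num.Theory.
Import numFieldNormedType.Exports.

Local Open Scope classical_set_scope.
Local Open Scope ring_scope.

(** * Function spaces and primitives *)

(** The delicate point is that the rearranged angle [vt] is absolutely continuous, although only its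
    distribution N is prescribed. This holds because N dominates Lebesgue measure on the range: an
    N-null set of angles has a null set of times as preimage, since the speed is positive, and
    |theta'| has integral zero there. The Radon-Nikodym density r then gives vt' = - r(vt) L almost
    everywhere, and r(z) is the absolute curvature of the new curve where its angle is z. As r dN =
    dz on the range, one factor r can be traded for Lebesgue measure, so the integral of r^2 dN is
    at most that of r(theta) |theta'|. Cauchy-Schwarz bounds the latter by the geometric mean of the
    old energy and of the integral of r^2 dN itself, which is then absorbed. Sobolev hypotheses are
    turned into integral formulas ([primitive]), and changes of variable into comparisons of image
    measures, checked on intervals. This avoids differentiating the angle or its rearrangement
    pointwise: neither needs to be C^1. *)

Lemma itvcc_oo {R : realType} (a b s t x : R) : a < s -> t < b ->
  x \in `[s, t] -> x \in `]a, b[.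
Proof.
by rewrite !in_itv/= => as_ tb /andP[sx xt]; rewrite (lt_le_trans as_) ?(le_lt_trans xt).
Qed.

Lemma itvoo_widen {R : realType} (a b s t x : R) : a <= s -> t <= b ->
  x \in `]s, t[ -> x \in `]a, b[.
Proof.
by rewrite !in_itv/= => as_ tb /andP[sx xt]; rewrite (le_lt_trans as_) ?(lt_le_trans xt).
Qed.

Section primitives.
Context {R : realType}.
Local Notation mu := (@lebesgue_measure R).
Implicit Types (f g : R -> R) (a b c d s t : R).

Lemma Lp1P (D : set R) f : measurable D ->
  Lp 1%E D f <-> mu.-integrable D (EFin \o f).
Proof.
move=> mD; rewrite /Lp /finite_norm Lnorm1.
have E : (\int[mu]_x `|(EFin \o (f \_ D)) x| = \int[mu]_(x in D) `|(f x)%:E|)%E.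
  rewrite [RHS]integral_mkcond; apply: eq_integral => x _ /=.
  by rewrite !patchE; case: ifPn => //; rewrite normr0.
rewrite E; split=> [[mf fi]|/integrableP[/measurable_EFinP mf fi]] //.
by apply/integrableP; split=> //; exact/measurable_EFinP.
Qed.

Lemma Lp2P (D : set R) f : measurable D ->
  Lp 2%:E D f <->
  measurable_fun D f /\ (\int[mu]_(x in D) (f x ^+ 2)%:E < +oo)%E.
Proof.
move=> mD; rewrite /Lp /finite_norm.
have E : ('N[mu]_2%:E [EFin \o (f \_ D)] `^ 2 = \int[mu]_(x in D) (f x ^+ 2)%:E)%E.
  rewrite poweR_Lnorm// [RHS]integral_mkcond; apply: eq_integral => x _ /=.
  rewrite !patchE; case: ifPn => _ /=; rewrite powR_mulrn// real_normK ?num_real//.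
  by rewrite expr0n.
rewrite -E; split=> -[mf fi]; split=> //.
  by rewrite poweR_lty.
move: fi; case: ('N[mu]_2%:E[EFin \o (f \_ D)])%E (Lnorm_ge0 mu 2%:E (EFin \o (f \_ D))) => // [r _ _|_].
  exact: ltry.
by rewrite poweRyr.
Qed.

Definition locally_int a b g : Prop :=
  forall c d, a < c -> d < b -> mu.-integrable `[c, d] (EFin \o g).

(** Local absolute continuity in integral form. Weak derivatives are converted to this form and
    back, because it passes through products and changes of variable without test functions. *)
Definition primitive a b f g : Prop :=
  locally_int a b g /\
  forall s t, a < s -> s <= t -> t < b -> f t - f s = \int[mu]_(x in `[s, t]) g x.

Lemma Lp_loc1P a b g : Lp_loc 1%E a b g <-> locally_int a b g.
Proof.
by split=> H c d ac db; [apply/Lp1P => //|apply/Lp1P => //]; exact: H.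
Qed.

Lemma locally_int_measurable a b (h : R -> R) : locally_int a b h -> measurable_fun `]a, b[ h.
Proof.
move=> ih; pose e n : R := n.+1%:R^-1.
have e0 n : 0 < e n by rewrite invr_gt0.
have -> : (`]a, b[%classic : set R) = \bigcup_n [set` `[a + e n, b - e n]%R].
  apply/seteqP; split=> x /=; rewrite in_itv/=; last first.
    by move=> [n _] /=; rewrite in_itv/= => /andP[]; have := e0 n => ? ? ?; apply/andP; lra.
  move=> /andP[ax xb]; pose m := Num.min (x - a) (b - x).
  have m0 : 0 < m by rewrite lt_min !subr_gt0 ax.
  have em : e (Num.truncn m^-1) < m.
    rewrite /e -[ltRHS]invrK ltf_pV2 ?posrE ?invr_gt0//.
    exact: truncnS_gt.
  exists (Num.truncn m^-1) => //=; rewrite in_itv/=.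
  by move: em; rewrite /m lt_min => /andP[h1 h2]; apply/andP; lra.
apply/measurable_fun_bigcup => [//|n].
have /integrableP[/measurable_EFinP] : mu.-integrable `[a + e n, b - e n] (EFin \o h) => //.
by apply: ih; have := e0 n; lra.
Qed.

Lemma Rintegral_itv_split a b c g : a <= b -> b <= c ->
  mu.-integrable `[a, c] (EFin \o g) ->
  \int[mu]_(x in `[a, c]) g x =
  \int[mu]_(x in `[a, b]) g x + \int[mu]_(x in `[b, c]) g x.
Proof.
move=> ab bc ig.
rewrite -(Rintegral_itv_obnd_cbnd (r := b)).
  by rewrite -(Rintegral_itvB ig) ?bnd_simp//; lra.
by apply: integrableS ig => //; apply: subset_itvr; rewrite bnd_simp.
Qed.

End primitives.

(** * Comparison of measures on half-open intervals *)

Section itv_comparison.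
Context {R : realType}.
Variables (rho1 : {measure set (measurableTypeR R) -> \bar R})
          (rho2 : {finite_measure set (measurableTypeR R) -> \bar R}).
Hypothesis le12 : forall a b : R, a < b -> (rho1 `]a, b]%classic <= rho2 `]a, b]%classic)%E.

(** The type [ocitv_type] carries the semiring of half-open intervals. Viewed there, [rho2] is
    recovered as its own outer-measure extension, hence as an infimum over coverings. *)
Definition itv_content (A : set (ocitv_type R)) : \bar R :=
  rho2 (A : set (measurableTypeR R)).

Let itv_content0 : itv_content set0 = 0%E. Proof. exact: measure0. Qed.

Let itv_content_ge0 A : (0 <= itv_content A)%E. Proof. exact: measure_ge0. Qed.

Let itv_content_sigma_additive : semi_sigma_additive itv_content.
Proof.
move=> F mF tF mUF.
apply: (@measure_semi_sigma_additive _ _ _ rho2 F) => //.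
- by move=> i; exact: sub_sigma_algebra.
- exact: sub_sigma_algebra.
Qed.

HB.instance Definition _ := isMeasure.Build _ _ _ itv_content
  itv_content0 itv_content_ge0 itv_content_sigma_additive.

(** By uniqueness of the extension, [rho2 B] is the infimum of the sums of [rho2] over coverings of
    [B] by half-open intervals; each such sum dominates the one for [rho1], which is at least
    [rho1 B]. *)
Lemma le_measure_of_itv (B : set (measurableTypeR R)) :
  measurable B -> (rho1 B <= rho2 B)%E.
Proof.
move=> mB.
have sf : sigma_finite [set: ocitv_type R] itv_content.
  exists (fun k : nat => `] (- k%:R), k%:R]%classic).
    by rewrite (bigcup_itvT (R := R) false false).
  move=> k; split; first exact: is_ocitv.
  by rewrite /itv_content ltey_eq fin_num_measure.
have := @measure_extension_unique _ _ _ itv_content sf rho2 (fun X _ => erefl) B mB.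
move=> <-.
rewrite /measure_extension /mu_ext; apply: le_ereal_inf_tmp => _ [F [mF BF]] <-.
apply: (@le_trans _ _ (\sum_(k <oo) rho1 (F k))%E).
  have mF' k : measurable (F k : set (measurableTypeR R)).
    by apply: sub_sigma_algebra; exact: mF.
  by apply: measure_sigma_subadditive.
apply: lee_nneseries => // k _.
have /ocitvP[->|[[a b] /= ab ->]] := mF k; first by rewrite measure0.
exact: le12.
Qed.

End itv_comparison.

(** * Distribution of a map with respect to a weight *)

(** The measures compared below are images of weighted Lebesgue measures: the distributions of the
    angle and of its rearrangement, Lebesgue measure on an interval or on the range, and the
    variation of the angle. The record makes them instances of one finite measure,
    [image_measure]. *)
Record weighted_map (R : realType) := WeightedMap {
  wm_dom : set R ;
  wm_map : R -> R ;
  wm_weight : R -> R ;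
  measurable_wm_dom : measurable wm_dom ;
  measurable_wm_map : measurable_fun wm_dom wm_map ;
  integrable_wm_weight :
    (@lebesgue_measure R).-integrable wm_dom (EFin \o wm_weight) ;
  wm_weight_ge0 : forall x, wm_dom x -> 0 <= wm_weight x }.

Section image_measure.
Context {R : realType}.
Local Notation mu := (@lebesgue_measure R).
Variable w : weighted_map R.
Let D := wm_dom w.
Let th := wm_map w.
Let q := wm_weight w.

Definition image_measure (A : set (measurableTypeR R)) : \bar R :=
  (\int[mu]_(x in D `&` th @^-1` A) (q x)%:E)%E.

Let mpre (A : set (measurableTypeR R)) : measurable A ->
  measurable (D `&` th @^-1` A).
Proof. by move=> mA; apply: measurable_wm_map => //; exact: measurable_wm_dom. Qed.

Let mq : measurable_fun D (EFin \o q).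
Proof. by have /integrableP[] := integrable_wm_weight w. Qed.

Let image_measure0 : image_measure set0 = 0%E.
Proof. by rewrite /image_measure preimage_set0 setI0 integral_set0. Qed.

Let image_measure_ge0 A : (0 <= image_measure A)%E.
Proof.
by apply: integral_ge0 => x [Dx _]; rewrite lee_fin; exact: wm_weight_ge0.
Qed.

Let image_measure_sigma_additive : semi_sigma_additive image_measure.
Proof.
move=> F mF tF mUF; rewrite /image_measure.
rewrite preimage_bigcup setI_bigcupr ge0_integral_bigcup//=.
- apply: is_cvg_ereal_nneg_natsum_cond => n _ _; exact: image_measure_ge0.
- by move=> k; exact: mpre.
- apply: measurable_funS mq; first exact: measurable_wm_dom.
  by rewrite -setI_bigcupr; exact: subIsetl.
- by move=> x [n _ [Dx _]]; rewrite lee_fin; exact: wm_weight_ge0.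
- apply: trivIset_setIl; move=> i j _ _ [x [/= Fi Fj]].
  by apply: tF => //; exists (th x).
Qed.

HB.instance Definition _ := isMeasure.Build _ _ _ image_measure
  image_measure0 image_measure_ge0 image_measure_sigma_additive.

Let image_measure_fin : fin_num_fun image_measure.
Proof.
move=> A mA; apply: integrable_fin_num; first exact: mpre.
apply: integrableS (integrable_wm_weight w).
- exact: measurable_wm_dom.
- exact: mpre.
- exact: subIsetl.
Qed.

HB.instance Definition _ :=
  Measure_isFinite.Build _ _ _ image_measure image_measure_fin.

Import HBNNSimple.

(** Monotone convergence reduces the formula to simple functions, and these to their level sets,
    where it is the definition of [image_measure]. *)
Lemma integral_image_measure (phi : R -> R) (A : set R) : measurable A ->
  measurable_fun [set: R] phi -> (forall z, 0 <= phi z) ->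
  (\int[image_measure]_(z in A) (phi z)%:E =
   \int[mu]_(x in D `&` th @^-1` A) (phi (th x) * q x)%:E)%E.
Proof.
move=> mA mphi phi0.
have mD := measurable_wm_dom w; have mth := @measurable_wm_map _ w.
have mDA := mpre mA.
have mEphi : measurable_fun A (EFin \o phi).
  by apply/measurable_EFinP; exact: measurable_funTS.
have mth' : measurable_fun (D `&` th @^-1` A) (th : R -> measurableTypeR R).
  exact: (@measurable_funS _ _ _ _ D).
have mq' : measurable_fun (D `&` th @^-1` A) q.
  by apply/measurable_EFinP; apply: measurable_funS mq => //; exact: subIsetl.
pose h := @nnsfun_approx _ (measurableTypeR R) R A mA (EFin \o phi) mEphi.
have hnd (z : measurableTypeR R) m n : (m <= n)%N -> h m z <= h n z.
  by move=> mn; exact/lefP/nd_nnsfun_approx.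
have mcomp (g : measurableTypeR R -> R) : measurable_fun setT g ->
    measurable_fun (D `&` th @^-1` A) (fun x => g (th x) * q x).
  by move=> mg; apply: measurable_funM => //; exact: measurableT_comp.
have q0 x : (D `&` th @^-1` A) x -> 0 <= q x.
  by move=> [Dx _]; exact: wm_weight_ge0.
transitivity (limn (fun n => \int[image_measure]_(z in A) (h n z)%:E))%E.
  rewrite -monotone_convergence//.
  - apply: eq_integral => z /[!inE] Az; apply/esym/cvg_lim => //.
    by apply: cvg_nnsfun_approx => // *; rewrite lee_fin.
  - by move=> n; apply/measurable_EFinP; exact: measurable_funTS.
  - by move=> n z _; rewrite lee_fin.
  - by move=> z _ m n mn; rewrite lee_fin hnd.
transitivity (limn (fun n => \int[mu]_(x in D `&` th @^-1` A)
    (h n (th x) * q x)%:E))%E; last first.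
  rewrite -monotone_convergence//.
  - apply: eq_integral => x /[!inE] DAx; apply/cvg_lim => //.
    under eq_fun do rewrite EFinM; rewrite EFinM.
    apply: cvgeZr => //.
    by apply: (@cvg_nnsfun_approx _ (measurableTypeR R) R A mA _ mEphi _ _ DAx.2) => // *; rewrite lee_fin.
  - by move=> n; apply/measurable_EFinP; exact: (mcomp (h n)).
  - by move=> n x /q0 qx; rewrite lee_fin mulr_ge0.
  - move=> x /q0 qx m n mn; rewrite lee_fin ler_wpM2r//.
    exact: hnd.
congr (lim (_ @ \oo)); apply/funext => n.
have hE z : (h n z)%:E = (\sum_(y \in range (h n))
    (y * \1_(h n @^-1` [set y]) z)%:E)%E by rewrite fsumEFin// -fimfunE.
under eq_integral do rewrite hE.
rewrite ge0_integral_fsum//; last 2 first.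
- move=> y; apply/measurable_EFinP/measurable_funM => //.
- by move=> y z _; rewrite nnfun_muleindic_ge0.
under [RHS]eq_integral => x xDA.
  rewrite EFinM hE ge0_mule_fsuml => [|y]; last exact: nnfun_muleindic_ge0.
  over.
rewrite [RHS]ge0_integral_fsum//; last 2 first.
- move=> y; under eq_fun do rewrite -EFinM.
  apply/measurable_EFinP.
  by apply: (mcomp (fun z => y * \1_(h n @^-1` [set y]) z)); exact: measurable_funM.
- by move=> y x /q0 qx; rewrite mule_ge0// nnfun_muleindic_ge0.
apply: eq_fsbigr => r /[!inE] -[z0 _ hr].
have r0 : 0 <= r by rewrite -hr.
rewrite integralZl_indic_nnsfun// integral_indic//=.
transitivity (r%:E * \int[mu]_(x in D `&` th @^-1` A)
   ((\1_(h n @^-1` [set r]) (th x))%:E * (q x)%:E))%E; last first.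
  rewrite -ge0_integralZl//.
  - by apply: eq_integral => x _; rewrite EFinM muleA.
  - under eq_fun do rewrite -EFinM.
    apply/measurable_EFinP.
    apply: (mcomp (\1_(h n @^-1` [set r]))); exact: measurable_indic.
  - by move=> x /q0 qx; rewrite mule_ge0// lee_fin.
congr (_ * _)%E.
rewrite /image_measure.
have -> : D `&` th @^-1` (h n @^-1` [set r] `&` A) =
    (D `&` th @^-1` A) `&` th @^-1` (h n @^-1` [set r]).
  by apply/seteqP; split => x /=; tauto.
rewrite integral_mkcondr.
apply: eq_integral => x _.
rewrite patchE indicE; case: ifPn => xh.
  by rewrite (_ : th x \in _ = true) ?mul1e//; move: xh; rewrite !inE.
rewrite (_ : th x \in _ = false) ?mul0e//.
by apply: contraNF xh; rewrite !inE.
Qed.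

End image_measure.

(** * Crossing an interval of levels *)

Section crossing.
Context {R : realType}.
Local Notation mu := (@lebesgue_measure R).
Implicit Types (th k : R -> R) (a b p q s t x y z : R).

Lemma last_below th p q z : p <= q -> {in `[p, q], continuous th} -> th p <= z ->
  exists2 s, s \in `[p, q] & th s <= z /\ forall x, s < x -> x <= q -> z < th x.
Proof.
move=> pq cth thp.
pose A := [set x | p <= x <= q /\ th x <= z].
have Ap : A p by split=> //; rewrite lexx.
have ubA : ubound A q by move=> x [/andP[]].
have hsA : has_sup A by split; [exists p|exists q].
have ps : p <= sup A by exact: ub_le_sup hsA.2 _ Ap.
have sq : sup A <= q by apply: ge_sup => //; exists p.
exists (sup A); first by rewrite in_itv/= ps sq.
split; last first.
  move=> x sx xq; rewrite ltNge; apply/negP => thx.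
  have Ax : A x by split=> //; rewrite xq (le_trans ps (ltW sx)).
  by have := ub_le_sup hsA.2 Ax; rewrite leNgt sx.
rewrite leNgt; apply/negP => zth.
have sI : sup A \in `[p, q] by rewrite in_itv/= ps sq.
have nb : nbhs (sup A) [set x | z < th x] by exact: (cvgr_gt (th (sup A)) (cth _ sI)).
have [x [Ax /=]] := closure_sup hsA.1 hsA.2 nb.
by rewrite ltNge Ax.2.
Qed.

(** This is [last_below] applied to the reflected function [fun x => - th (- x)]. *)
Lemma first_above th p q z : p <= q -> {in `[p, q], continuous th} -> z <= th q ->
  exists2 t, t \in `[p, q] & z <= th t /\ forall x, p <= x -> x < t -> th x < z.
Proof.
move=> pq cth thq.
have cN : {in `[- q, - p], continuous (fun x => - th (- x))}.
  move=> x /[!in_itv]/= /andP[qx xp]; apply: cvgN.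
  apply: (@continuous_comp _ _ _ (fun x => - x) th); first exact: opp_continuous.
  by apply: cth; rewrite in_itv/=; lra.
have [||s + [thz Hs]] := @last_below _ (- q) (- p) (- z) _ cN.
- by rewrite lerN2.
- by rewrite opprK lerN2.
rewrite in_itv/= => /andP[qs sp].
exists (- s); first by rewrite in_itv/=; lra.
split; first by rewrite -lerN2.
move=> x px xs; rewrite -ltrN2 -[x in th x]opprK; apply: Hs; lra.
Qed.

(** Take for [t] the first time at which [th] reaches [z1], and for [s] the last time before [t] at
    which [th] is at most [z2]. *)
Lemma crossing_interval th p q z2 z1 : p <= q -> {in `[p, q], continuous th} ->
  z2 < z1 -> th p <= z2 -> z1 <= th q ->
  exists s t, [/\ p <= s, s < t, t <= q, z1 - z2 <= th t - th s &
    forall x, x \in `]s, t[ -> z2 < th x < z1].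
Proof.
move=> pq cth z21 thp thq.
have [t tpq [tz tx]] := first_above pq cth thq.
move: (tpq); rewrite in_itv/= => /andP[pt tq].
have cth' : {in `[p, t], continuous th}.
  move=> x; rewrite in_itv/= => /andP[px xt]; apply: cth.
  by rewrite in_itv/= px (le_trans xt tq).
have [s spt [sz sx]] := last_below pt cth' thp.
move: (spt); rewrite in_itv/= => /andP[ps st].
exists s, t; split => //.
- rewrite lt_neqAle st andbT; apply/eqP => E; move: sz tz; rewrite E => A B.
  by have := lt_le_trans z21 (le_trans B A); rewrite ltxx.
- lra.
- move=> x; rewrite in_itv/= => /andP[sx' xt].
  by rewrite sx ?(ltW xt)//= tx// (le_trans ps (ltW sx')).
Qed.

(** The crossing interval lies inside the preimage of []z2, z1[], and the increment of [th] over it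
    alone has size at least [z1 - z2]. When [q] comes before [p], the crossing is that of [- th]. *)
Lemma le_crossing_integral th k a b z2 z1 (p q : R) :
  {in `[a, b], continuous th} ->
  mu.-integrable `[a, b] (EFin \o k) -> (forall x, x \in `[a, b] -> 0 <= k x) ->
  (forall x y, a <= x -> x <= y -> y <= b ->
    `|th y - th x| <= \int[mu]_(t in `[x, y]) k t) ->
  p \in `[a, b] -> q \in `[a, b] -> z2 < z1 -> th p <= z2 -> z1 <= th q ->
  ((z1 - z2)%:E <= \int[mu]_(t in `[a, b] `&` th @^-1` `]z2, z1[%classic) (k t)%:E)%E.
Proof.
move=> cth ik k0 Hk /[!in_itv]/= /andP[ap pb] /andP[aq qb] z21 thp thq.
have [s [t [as_ st tb zz sub]]] : exists s t, [/\ a <= s, s < t, t <= b,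
    z1 - z2 <= `|th t - th s| & forall x, x \in `]s, t[ -> z2 < th x < z1].
  case: (leP p q) => [pq|/ltW qp].
    have cpq : {in `[p, q], continuous th}.
      move=> x /[!in_itv]/= /andP[px xq]; apply: cth.
      by rewrite in_itv/= (le_trans ap px) (le_trans xq qb).
    have [s [t [ps st tq zz sub]]] := crossing_interval pq cpq z21 thp thq.
    exists s, t; split => //; rewrite ?(le_trans ap ps) ?(le_trans tq qb)//.
    exact: le_trans zz (ler_norm _).
  have cqp : {in `[q, p], continuous (fun x => - th x)}.
    move=> x /[!in_itv]/= /andP[px xq]; apply: cvgN; apply: cth.
    by rewrite in_itv/= (le_trans aq px) (le_trans xq pb).
  have [||||s [t [qs st tp zz sub]]] := @crossing_interval _ q p (- z1) (- z2) _ cqp.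
  - by [].
  - by rewrite ltrN2.
  - by rewrite lerN2.
  - by rewrite lerN2.
  exists s, t; split => //; rewrite ?(le_trans aq qs) ?(le_trans tp pb)//.
    by rewrite distrC; apply: (le_trans _ (ler_norm _)); lra.
  by move=> x /sub; rewrite !ltrN2 => /andP[-> ->].
have mth : measurable_fun `[a, b] th.
  apply: subspace_continuous_measurable_fun => //.
  by apply: continuous_in_subspaceT => x /[!inE]/= /cth.
have mD : measurable (`[a, b] `&` th @^-1` `]z2, z1[%classic).
  exact: mth.
have ist : mu.-integrable `[s, t] (EFin \o k).
  by apply: integrableS ik => //; apply: subset_itv; rewrite bnd_simp.
apply: (@le_trans _ _ (\int[mu]_(x in `[s, t]) (k x)%:E)%E).
  rewrite -(@fineK _ (\int[mu]_(x in `[s, t]) (k x)%:E)%E) ?lee_fin.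
    exact: le_trans zz (Hk _ _ as_ (ltW st) tb).
  exact: integrable_fin_num.
have -> : (\int[mu]_(x in `[s, t]) (k x)%:E = \int[mu]_(x in `]s, t[) (k x)%:E)%E.
  rewrite [RHS]integral_itv_obnd_cbnd; last first.
    by apply: (measurable_int mu); apply: integrableS ist => //; apply: subset_itv; rewrite bnd_simp.
  rewrite [RHS]integral_itv_bndo_bndc//.
  by apply: (measurable_int mu); apply: integrableS ist => //; apply: subset_itv; rewrite bnd_simp.
apply: ge0_subset_integral => //=.
- by apply: (measurable_int mu); apply: integrableS ik => //; exact: subIsetl.
- by move=> x [/k0]; rewrite lee_fin.
- move=> x xst; split; last by rewrite /= in_itv/=; exact: sub.
  move: xst; rewrite /= !in_itv/= => /andP[sx xt].
  by rewrite (le_trans as_ (ltW sx)) (le_trans (ltW xt) tb).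
Qed.

End crossing.

Section lebesgue_itv.
Context {R : realType}.
Local Notation mu := (@lebesgue_measure R).
Implicit Types a b : R.

Lemma lebesgue_oo_lty a b : (mu `]a, b[ < +oo)%E.
Proof. by rewrite lebesgue_measure_itv/=; case: ifP => _ //; rewrite ltry. Qed.

Definition itv_map a b : weighted_map R.
Proof.
refine (@WeightedMap R `]a, b[%classic id (cst 1) _ _ _ _) => //.
apply: measurable_bounded_integrable => //; first exact: lebesgue_oo_lty.
by exists 1; split => // M M1 x _ /=; rewrite normr1 ltW.
Defined.

Lemma image_measure_itv a b (B : set R) : measurable B ->
  image_measure (itv_map a b) B = mu (`]a, b[ `&` B).
Proof.
move=> mB; rewrite /image_measure/= integral_cst ?mul1e//.
exact: measurableI.
Qed.

Lemma integral_image_itv a b (phi : R -> R) (B : set R) : measurable B ->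
  measurable_fun setT phi -> (forall z, 0 <= phi z) ->
  (\int[image_measure (itv_map a b)]_(z in B) (phi z)%:E =
   \int[mu]_(z in `]a, b[ `&` B) (phi z)%:E)%E.
Proof.
move=> mB mphi phi0; rewrite integral_image_measure//=.
by apply: eq_integral => x _; rewrite mulr1.
Qed.

(** The inequality on the complement of [B] leaves no room for a strict one on [B], as the total
    masses are finite. *)
Lemma eq_measure_of_le (rho1 rho2 : {finite_measure set (measurableTypeR R) -> \bar R}) :
  (forall B : set (measurableTypeR R), measurable B -> (rho1 B <= rho2 B)%E) ->
  (rho2 setT <= rho1 setT)%E ->
  forall B : set (measurableTypeR R), measurable B -> rho1 B = rho2 B.
Proof.
move=> le12 leT B mB; apply/eqP; rewrite eq_le le12//=.
have mBC : measurable (~` B) by exact: measurableC.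
have E (rho : {finite_measure set (measurableTypeR R) -> \bar R}) :
    rho setT = (rho B + rho (~` B))%E.
  by rewrite -measureU// ?setUv// setICr.
move: leT; rewrite !E => h.
have {}h := le_trans h (leeD2l _ (le12 _ mBC)).
by move: h; rewrite leeD2rE// fin_num_measure.
Qed.

Section crossing_measure.
Variables (a b : R) (w : weighted_map R).
Hypotheses (wD : wm_dom w = `[a, b]%classic)
  (cth : {in `[a, b], continuous (wm_map w)})
  (Hk : forall x y, a <= x -> x <= y -> y <= b ->
    `|wm_map w y - wm_map w x| <= \int[mu]_(t in `[x, y]) wm_weight w t).

Lemma le_image_measure_crossing (p q z2 z1 : R) (B : set R) :
  p \in `[a, b] -> q \in `[a, b] ->
  wm_map w p <= z2 -> z1 <= wm_map w q -> measurable B ->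
  (mu (`]z2, z1[ `&` B) <= image_measure w B)%E.
Proof.
move=> pab qab thp thq mB; rewrite -image_measure_itv//.
apply: (@le_measure_of_itv _ (image_measure (itv_map z2 z1)) (image_measure w)) => // a' b' ab'.
rewrite [leLHS](@image_measure_itv z2 z1 `]a', b'])//.
have ik : mu.-integrable `[a, b] (EFin \o wm_weight w).
  by rewrite -wD; exact: integrable_wm_weight.
have k0 x : x \in `[a, b] -> 0 <= wm_weight w x.
  by move=> xab; apply: wm_weight_ge0; rewrite wD.
(* Clipping []a', b']] to the levels [z2] and [z1] keeps it between the values at [p] and [q], so
   that [le_crossing_integral] applies to it. *)
pose x2 := Num.max a' z2; pose x1 := Num.min b' z1.
have sub : `]z2, z1[ `&` `]a', b'] `<=` `]x2, x1].
  move=> x /=; rewrite !in_itv/= => -[/andP[h1 h2] /andP[h3 h4]].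
  by rewrite gt_max h1 h3/= le_min h4 ltW.
apply: (@le_trans _ _ (mu `]x2, x1])).
  by apply: le_measure => //; rewrite inE//; exact: measurableI.
rewrite lebesgue_measure_itv/= lte_fin; case: ifPn => // x21.
rewrite -EFinB.
have thp' : wm_map w p <= x2 by rewrite le_max thp orbT.
have thq' : x1 <= wm_map w q by rewrite ge_min thq orbT.
apply: le_trans (le_crossing_integral cth ik k0 Hk pab qab x21 thp' thq') _.
have mth : measurable_fun `[a, b] (wm_map w).
  by rewrite -wD; exact: (@measurable_wm_map _ w).
rewrite /image_measure wD; apply: ge0_subset_integral => //.
- exact: mth.
- exact: mth.
- apply: (measurable_int mu); apply: integrableS ik; [by []|exact: mth|exact: subIsetl].
- by move=> x [/k0]; rewrite lee_fin.
- move=> x [xab]; rewrite /= !in_itv/= gt_max lt_min => /andP[/andP[h1 _] /andP[h2 _]].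
  by split => //=; rewrite ?in_itv/= h1 ltW.
Qed.

End crossing_measure.

Section substitution.
Variables (c d : R) (F f : R -> R).
Hypotheses (cd : c <= d) (cF : {in `[c, d], continuous F})
  (f0 : forall x, x \in `[c, d] -> 0 <= f x)
  (intf : mu.-integrable `[c, d] (EFin \o f))
  (Ff : forall s t, c <= s -> s <= t -> t <= d ->
     F t - F s = \int[mu]_(x in `[s, t]) f x).

Let mF : measurable_fun `[c, d] F.
Proof.
apply: subspace_continuous_measurable_fun => //.
by apply: continuous_in_subspaceT => x /[!inE]/= /cF.
Qed.

Definition subst_map : weighted_map R :=
  @WeightedMap R `[c, d]%classic F f (measurable_itv _) mF intf f0.

(** Crossings give one inequality; both measures have total mass [F d - F c], which makes it an
    equality. The change of variables thus holds for a merely absolutely continuous nondecreasing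
    [F]. *)
Lemma image_measure_subst (B : set R) : measurable B ->
  image_measure subst_map B = mu (`]F c, F d[ `&` B).
Proof.
move=> mB; rewrite -image_measure_itv//; apply/esym.
apply: eq_measure_of_le => // [A mA|].
  rewrite [leLHS](@image_measure_itv (F c) (F d) A)//.
  apply: (@le_image_measure_crossing c d subst_map) => //=.
  - move=> x y cx xy yd; rewrite Ff// ger0_norm//.
    apply: Rintegral_ge0 => t /=; rewrite in_itv/= => /andP[xt ty]; apply: f0.
    by rewrite in_itv/= (le_trans cx xt) (le_trans ty yd).
  - by rewrite in_itv/= lexx cd.
  - by rewrite in_itv/= lexx cd.
rewrite [leRHS](@image_measure_itv (F c) (F d) setT)// setIT.
rewrite [leLHS](_ : _ = \int[mu]_(x in `[c, d]) (f x)%:E)%E; last first.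
  rewrite /image_measure; congr (integral mu _ _).
  by apply/seteqP; split => x //=; case.
rewrite -(@fineK _ (\int[mu]_(x in `[c, d]) (f x)%:E)%E); last first.
  exact: integrable_fin_num.
have -> : fine (\int[mu]_(x in `[c, d]) (f x)%:E)%E = F d - F c by rewrite Ff.
rewrite lebesgue_measure_itv/= lte_fin; case: ltP => //.
by rewrite lee_fin; lra.
Qed.

Lemma integral_subst (phi : R -> R) :
  measurable_fun setT phi -> (forall z, 0 <= phi z) ->
  (\int[mu]_(x in `]F c, F d[) (phi x)%:E =
   \int[mu]_(x in `[c, d]) (phi (F x) * f x)%:E)%E.
Proof.
move=> mphi phi0.
have := @integral_image_measure _ subst_map phi setT measurableT mphi phi0.
rewrite /= preimage_setT setIT => <-.
transitivity (\int[image_measure (itv_map (F c) (F d))]_x (phi x)%:E)%E.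
  by rewrite integral_image_itv// setIT.
apply: eq_measure_integral.
by move=> A mA _; rewrite [LHS](@image_measure_itv _ _ A)// [RHS](@image_measure_subst A).
Qed.

End substitution.

End lebesgue_itv.

(** * Decreasing rearrangement *)

Section rearrangement.
Context {R : realType}.
Local Notation mu := (@lebesgue_measure R).
Variables (w : weighted_map R) (c : R).
Hypotheses (wD : wm_dom w = `]0, 1[%classic) (c0 : 0 <= c)
  (thc : forall t, t \in `]0, 1[ -> - c <= wm_map w t <= c)
  (wpos : 0 < fine (image_measure w setT)).
Local Notation th := (wm_map w).
Local Notation N := (image_measure w).

Definition total_weight : R := fine (N setT).
Local Notation L := total_weight.

Definition tail (z : R) : R := fine (N `]z, +oo[%classic).

Let NE (A : set (measurableTypeR R)) : measurable A -> N A = (fine (N A))%:E.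
Proof. by move=> mA; rewrite fineK// fin_num_measure. Qed.

Let tailE z : N `]z, +oo[%classic = (tail z)%:E.
Proof. by apply: NE; exact: measurable_itv. Qed.

Let NT : N setT = L%:E. Proof. exact: NE. Qed.

Lemma tail_le : {homo tail : x y /~ x <= y}.
Proof.
move=> x y xy; rewrite -lee_fin -!tailE; apply: le_measure; rewrite ?inE//.
by apply: subset_itvr; rewrite bnd_simp.
Qed.

Lemma tail_ge0 z : 0 <= tail z.
Proof. by rewrite -lee_fin -tailE. Qed.

Lemma tail_leT z : tail z <= L.
Proof. by rewrite -lee_fin -tailE -NT; apply: le_measure; rewrite ?inE. Qed.

Lemma image_measure_eq0 (A : set R) :
  (forall t, t \in `]0, 1[ -> ~ A (th t)) -> N A = 0%E.
Proof.
move=> H; rewrite /image_measure (_ : _ `&` _ = set0) ?integral_set0//.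
by apply/seteqP; split => // x []; rewrite wD => x01; exact: H.
Qed.

Lemma image_measureT (A : set R) : measurable A ->
  (forall t, t \in `]0, 1[ -> A (th t)) -> N A = N setT.
Proof.
move=> mA H.
have : N (~` A) = 0%E by apply: image_measure_eq0 => t /H At; apply.
have -> : N setT = (N A + N (~` A))%E.
  rewrite -(@setUv _ (A : set (measurableTypeR R))) measureU ?setICr//.
  exact: measurableC.
by move=> ->; rewrite adde0.
Qed.

Lemma tail_gt z : c < z -> tail z = 0.
Proof.
move=> cz; rewrite /tail image_measure_eq0// => t /thc /andP[_ h] /=.
by rewrite in_itv/= andbT; lra.
Qed.

Lemma tail_lt z : z < - c -> tail z = L.
Proof.
move=> cz; rewrite /tail image_measureT// => t /thc /andP[h _] /=.
by rewrite in_itv/= andbT (lt_le_trans cz h).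
Qed.

(** Continuity from below of the measure along the half-lines starting at z + 1/(n+1). This right
    continuity, due to the half-line in [tail] being open, is what makes [rearr_gtP] an
    equivalence. *)
Lemma tail_right z x : x < tail z -> exists2 z', z < z' & x < tail z'.
Proof.
move=> xz; pose F n := `]z + n.+1%:R^-1, +oo[%classic : set (measurableTypeR R).
have FE : \bigcup_n F n = `]z, +oo[%classic.
  apply/seteqP; split => y.
    move=> [n _]; rewrite /F/= !in_itv/= !andbT; apply: lt_trans.
    by rewrite ltrDl invr_gt0.
  rewrite /= in_itv/= andbT => zy.
  exists (Num.truncn (y - z)^-1) => //=; rewrite /F/= ?in_itv/= ?andbT.
  rewrite -ltrBrDl -[ltRHS]invrK ltf_pV2 ?posrE ?invr_gt0 ?subr_gt0//.
  exact: truncnS_gt.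
have : N (F n) @[n --> \oo] --> (tail z)%:E.
  rewrite -tailE -FE; apply: nondecreasing_cvg_mu => //.
  - by move=> i; exact: measurable_itv.
  - by rewrite FE; exact: measurable_itv.
  - move=> m n mn; apply/subsetPset; apply: subset_itvr; rewrite bnd_simp.
    by rewrite lerD2l lef_pV2 ?posrE// ler_nat ltnS.
move=> /fine_cvgP[_] /(cvgr_gt _)/(_ _ xz) [n _ /(_ n (leqnn _)) /= h].
exists (z + n.+1%:R^-1) => //.
by rewrite ltrDl invr_gt0.
Qed.

(* The clause [z < - c] keeps the set nonempty. *)
Definition rearr (s : R) : R :=
  sup [set z | z < - c \/ (z <= c /\ L * s < tail z)].

Let rset s := [set z | z < - c \/ (z <= c /\ L * s < tail z)].

Let cc : - c <= c. Proof. by rewrite (le_trans _ c0)// oppr_le0. Qed.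

Let rset_sup s : has_sup (rset s).
Proof.
split; first by exists (- c - 1); left; lra.
by exists c => z [zc|[]//]; exact: le_trans (ltW zc) cc.
Qed.

Lemma rearr_bnd s : - c <= rearr s <= c.
Proof.
apply/andP; split; last first.
  apply: ge_sup; first by case: (rset_sup s).
  by move=> z [zc|[]//]; exact: le_trans (ltW zc) cc.
rewrite leNgt; apply/negP => h.
have : rset s ((rearr s - c) / 2) by left; lra.
by move=> /(ub_le_sup (rset_sup s).2); rewrite -/(rearr s); lra.
Qed.

Lemma rearr_noninc : {homo rearr : x y /~ x <= y}.
Proof.
move=> x y xy; apply: ge_sup; first by case: (rset_sup x).
move=> z rz; apply: (ub_le_sup (rset_sup y).2).
case: rz => [zc|[zc Lz]]; [by left|right; split => //].
by apply: le_lt_trans Lz; rewrite ler_pM2l.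
Qed.

(** The relation that characterises a generalised inverse of [tail]. The bound s < 1 settles the
    levels below [- c], where [tail] equals [L]; the bound s > 0 excludes the levels above [c],
    where it vanishes. *)
Lemma rearr_gtP s z : s \in `]0, 1[ -> (z < rearr s) = (L * s < tail z).
Proof.
rewrite in_itv/= => /andP[s0 s1]; apply/idP/idP => [zr|Lz].
  have [z' [h|[_ h]] zz'] := sup_gt (rset_sup s).1 zr.
    by rewrite (@tail_lt z) ?(lt_trans zz')// gtr_pMr.
  by apply: (lt_le_trans h); apply: tail_le; exact: ltW.
have [z' zz' Lz'] := tail_right Lz.
apply: (lt_le_trans zz'); apply: (ub_le_sup (rset_sup s).2).
right; split => //; rewrite leNgt; apply/negP => /tail_gt z0.
by move: Lz'; rewrite z0 ltNge mulr_ge0// ltW.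
Qed.

Lemma rearr_measurable (D : set R) : measurable D -> measurable_fun D rearr.
Proof. by move=> mD; apply: nonincreasing_measurable => // x y xy; exact: rearr_noninc. Qed.

Let int_cst r : mu.-integrable `]0, 1[ (EFin \o (cst r : R -> R)).
Proof.
apply: measurable_bounded_integrable => //; first exact: lebesgue_oo_lty.
by exists `|r|; split; [exact: num_real|move=> M rM x _ /=; exact: ltW].
Qed.

Let L0 : 0 <= L. Proof. exact: ltW. Qed.

Definition rearr_map : weighted_map R :=
  @WeightedMap R `]0, 1[%classic rearr (cst L) (measurable_itv _)
    (@rearr_measurable _ (measurable_itv _)) (int_cst L) (fun _ _ => L0).

(** By [rearr_gtP] the set of times where [rearr] exceeds [z] is []0, tail z / L[], and the weight
    is the constant [L]. *)
Let tail_rearr z : image_measure rearr_map `]z, +oo[%classic = N `]z, +oo[%classic.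
Proof.
rewrite tailE /image_measure/=.
have -> : `]0, 1[ `&` rearr @^-1` `]z, +oo[%classic = `]0, tail z / L[%classic.
  apply/seteqP; split => s /=; rewrite !in_itv/= andbT.
    move=> [s01]; rewrite rearr_gtP ?in_itv//= => h; case/andP: s01 => -> _ /=.
    by rewrite ltr_pdivlMr// mulrC.
  move=> /andP[s0]; rewrite ltr_pdivlMr// mulrC => h.
  have s01 : 0 < s < 1.
    by rewrite s0/= -(ltr_pM2l wpos) mulr1 (lt_le_trans h)// tail_leT.
  by split; rewrite // rearr_gtP// in_itv.
rewrite integral_cst//= lebesgue_measure_itv/= lte_fin.
case: ifPn => [h|]; first by rewrite sube0 -EFinM mulrCA divff ?mulr1 ?gt_eqF.
rewrite -leNgt mule0 => h; congr EFin; apply/eqP; rewrite eq_le tail_ge0/=.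
by move: h; rewrite ler_pdivrMr// mul0r.
Qed.

Let diff_tail (rho : {finite_measure set (measurableTypeR R) -> \bar R}) a b : a < b ->
  rho `]a, b]%classic = (rho `]a, +oo[%classic - rho `]b, +oo[%classic)%E.
Proof.
move=> ab.
have -> : `]a, b]%classic = `]a, +oo[%classic `\` `]b, +oo[%classic :> set R.
  apply/seteqP; split => x /=; rewrite !in_itv/= !andbT; first by move=> /andP[-> /le_gtF ->].
  by move=> [-> /negP]; rewrite -leNgt.
rewrite measureD//; try exact: measurable_itv; last first.
  by rewrite ltey_eq fin_num_measure//; exact: measurable_itv.
congr (_ - rho _)%E; apply/seteqP; split => x /=; rewrite !in_itv/= !andbT; first by case.
by move=> bx; rewrite bx (lt_trans ab).
Qed.

(** Equal tails give equal masses of half-open intervals, and [le_measure_of_itv] applies in both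
    directions. *)
Lemma image_measure_rearr (B : set R) : measurable B ->
  image_measure rearr_map B = N B.
Proof.
move=> mB.
have E a b : a < b ->
    image_measure rearr_map `]a, b]%classic = N `]a, b]%classic.
  move=> ab; rewrite [LHS](diff_tail (image_measure rearr_map) ab).
  rewrite [RHS](diff_tail N ab).
  by rewrite [X in (X - _)%E](tail_rearr a) [X in (_ - X)%E](tail_rearr b).
apply/eqP; rewrite eq_le; apply/andP; split.
  apply: (@le_measure_of_itv _ (image_measure rearr_map) N) => // a b ab.
  by rewrite [leLHS](E _ _ ab).
apply: (@le_measure_of_itv _ N (image_measure rearr_map)) => // a b ab.
by rewrite [leRHS](E _ _ ab).
Qed.

End rearrangement.

Section restriction.
Context {R : realType}.
Local Notation mu := (@lebesgue_measure R).

Lemma integrable_itv_restrict (th k : R -> R) (a b : R) :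
  {in `[a, b], continuous th} ->
  mu.-integrable `[a, b] (EFin \o k) -> (forall x, x \in `[a, b] -> 0 <= k x) ->
  exists w : weighted_map R,
    [/\ wm_dom w = `[a, b]%classic, wm_map w = th & wm_weight w = k].
Proof.
move=> cth ik k0.
have mth : measurable_fun `[a, b] th.
  apply: subspace_continuous_measurable_fun => //.
  by apply: continuous_in_subspaceT => x /[!inE]/= /cth.
by exists (@WeightedMap R `[a, b]%classic th k (measurable_itv _) mth ik k0).
Qed.

Lemma lebesgue_subset0 (A B : set R) : measurable A -> measurable B ->
  A `<=` B -> mu B = 0%E -> mu A = 0%E.
Proof.
move=> mA mB AB B0; apply/eqP; rewrite eq_le measure_ge0 andbT -B0.
by apply: le_measure; rewrite ?inE.
Qed.

Lemma negligible_of_integral0 (D : set R) (q : R -> R) : measurable D ->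
  measurable_fun D q -> (forall x, D x -> 0 < q x) ->
  (\int[mu]_(x in D) (q x)%:E)%E = 0%E -> mu D = 0%E.
Proof.
move=> mD mq q0 iq.
have : (\int[mu]_(x in D) `|(q x)%:E|)%E = 0%E.
  rewrite -iq; apply: eq_integral => x /[!inE] /q0 qx /=.
  by rewrite ger0_norm// ltW.
move/(ae_eq_integral_abs mu mD _).1 => /(_ _)[|A [mA A0 sub]].
  exact/measurable_EFinP.
apply: (@lebesgue_subset0 _ A) => //.
move=> x Dx; apply: sub => /= /(_ Dx) [qx].
by have := q0 _ Dx; rewrite qx ltxx.
Qed.

End restriction.

(** * Density of Lebesgue measure on the range of the angle *)

Section rearrangement_density.
Context {R : realType}.
Local Notation mu := (@lebesgue_measure R).
Variables (w : weighted_map R) (c : R) (k : R -> R).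
Hypotheses (wD : wm_dom w = `]0, 1[%classic) (c0 : 0 <= c)
  (thc : forall t, t \in `]0, 1[ -> - c <= wm_map w t <= c)
  (wpos : 0 < fine (image_measure w setT))
  (cth : {in `]0, 1[, continuous (wm_map w)})
  (w0 : forall t, t \in `]0, 1[ -> 0 < wm_weight w t)
  (ik : locally_int 0 1 k) (k0 : forall t, t \in `]0, 1[ -> 0 <= k t)
  (Hk : forall x y, 0 < x -> x <= y -> y < 1 ->
    `|wm_map w y - wm_map w x| <= \int[mu]_(t in `[x, y]) k t).
Local Notation th := (wm_map w).
Local Notation N := (image_measure w).
Local Notation L := (total_weight w).
Local Notation vt := (rearr w c).

(** The open interval between the infimum and the supremum of the angle: every level in it is
    strictly crossed, whether or not the extreme values are attained. *)
Definition wm_range : set R :=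
  [set z | exists t1 t2, [/\ t1 \in `]0, 1[, t2 \in `]0, 1[ & th t1 < z < th t2]].

Lemma measurable_wm_range : measurable wm_range.
Proof.
apply: is_interval_measurable => x y [t1 [t2 [h1 h2 /andP[h3 h4]]]].
move=> [t3 [t4 [h5 h6 /andP[h7 h8]]]] z /andP[xz zy].
by exists t1, t4; split => //; rewrite (lt_le_trans h3 xz) (le_lt_trans zy h8).
Qed.

Lemma wm_range_bnd : wm_range `<=` `[- c, c]%classic.
Proof.
move=> z [t1 [t2 [/thc /andP[h1 _] /thc /andP[_ h2] /andP[h3 h4]]]].
by rewrite /= in_itv/= (le_trans h1 (ltW h3)) (le_trans (ltW h4) h2).
Qed.

Lemma range_integrable : mu.-integrable wm_range (EFin \o (cst 1 : R -> R)).
Proof.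
apply: (@integrableS _ _ _ mu `[- c, c]) => //.
- exact: measurable_wm_range.
- exact: wm_range_bnd.
- apply: measurable_bounded_integrable => //.
    by rewrite [ltLHS](@lebesgue_measure_itv R `[- c, c])/=; case: ifP => _ //; rewrite ltry.
  by exists 1; split => // M M1 x _ /=; rewrite normr1 ltW.
Qed.

Definition range_map : weighted_map R :=
  @WeightedMap R wm_range id (cst 1) measurable_wm_range
    (@measurable_id _ _ _) range_integrable (fun _ _ => ler01).

Lemma image_measure_range (B : set R) : measurable B ->
  image_measure range_map B = mu (wm_range `&` B).
Proof.
move=> mB; rewrite /image_measure/= integral_cst ?mul1e//.
by apply: measurableI => //; exact: measurable_wm_range.
Qed.

(* On each compact subinterval of ]0, 1[ the angle covers the interval between its
   extreme values. *)
Lemma range_le_integral (B : set R) : measurable B ->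
  (mu (wm_range `&` B) <= \int[mu]_(x in `]0%R, 1%R[ `&` th @^-1` B) (k x)%:E)%E.
Proof.
move=> mB.
have mD : measurable (`]0, 1[ `&` th @^-1` B).
  by have := @measurable_wm_map _ w; rewrite wD; apply.
(* Starting at [n.+2] ensures [a n <= 1 / 2], so that no interval from [a n] to [1 - a n] is
   empty. *)
pose a n : R := n.+2%:R^-1.
have a0 n : 0 < a n by rewrite invr_gt0.
have a1 n : a n <= 2^-1 by rewrite lef_pV2 ?posrE// ler_nat.
have sub01 n x : x \in `[a n, 1 - a n] -> x \in `]0, 1[.
  rewrite !in_itv/= => /andP[ax xa]; rewrite (lt_le_trans (a0 n) ax)/=.
  by apply: (le_lt_trans xa); have := a0 n; lra.
pose E n := [set z | exists t1 t2, [/\ t1 \in `[a n, 1 - a n],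
  t2 \in `[a n, 1 - a n] & th t1 < z < th t2]].
have mE n : measurable (E n).
  apply: is_interval_measurable => x y [t1 [t2 [h1 h2 /andP[h3 h4]]]].
  move=> [t3 [t4 [h5 h6 /andP[h7 h8]]]] z /andP[xz zy].
  by exists t1, t4; split => //; rewrite (lt_le_trans h3 xz) (le_lt_trans zy h8).
have inE' t : t \in `]0, 1[ -> exists n0, forall n, (n0 <= n)%N -> t \in `[a n, 1 - a n].
  rewrite in_itv/= => /andP[t0 t1].
  pose m := Num.min t (1 - t).
  have m0 : 0 < m by rewrite lt_min t0 subr_gt0.
  exists (Num.truncn m^-1) => n nn.
  have am : a n <= m.
    rewrite /a -[leRHS]invrK lef_pV2 ?posrE ?invr_gt0//.
    apply: (le_trans (ltW (truncnS_gt m^-1))).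
    by rewrite ler_nat ltnS (leq_trans nn).
  by move: am; rewrite /m le_min => /andP[]; rewrite in_itv/= => h1 h2; lra.
have rE : wm_range `<=` \bigcup_n E n.
  move=> z [t1 [t2 [h1 h2 h3]]].
  have [n1 H1] := inE' _ h1; have [n2 H2] := inE' _ h2.
  exists (maxn n1 n2) => //; exists t1, t2; split => //.
  - by apply: H1; rewrite leq_maxl.
  - by apply: H2; rewrite leq_maxr.
have Emono m n : (m <= n)%N -> E m `<=` E n.
  have aa : (m <= n)%N -> a n <= a m by move=> mn; rewrite lef_pV2 ?posrE// ler_nat !ltnS.
  move=> /aa anm z [t1 [t2 [h1 h2 h3]]]; exists t1, t2; split => //.
  - by move: h1; rewrite !in_itv/= => /andP[? ?]; apply/andP; split; lra.
  - by move: h2; rewrite !in_itv/= => /andP[? ?]; apply/andP; split; lra.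
have En n : (mu (E n `&` B) <= \int[mu]_(x in `]0%R, 1%R[ `&` th @^-1` B) (k x)%:E)%E.
  have an : a n <= 1 - a n by have := a1 n; lra.
  have cn : {in `[a n, 1 - a n], continuous th} by move=> x /sub01 /cth.
  have wn : {within `[a n, 1 - a n], continuous th}.
    by apply: continuous_in_subspaceT => x /[!inE]/= /cn.
  have [p pI pmin] := EVT_min an wn; have [q qI qmax] := EVT_max an wn.
  have ikn : mu.-integrable `[a n, 1 - a n] (EFin \o k).
    by apply: ik => //; have := a0 n; lra.
  have [v [vD vm vw]] := integrable_itv_restrict cn ikn (fun x xI => k0 (sub01 _ _ xI)).
  have := @le_image_measure_crossing _ (a n) (1 - a n) v vD _ _ p q (th p) (th q) B.
  rewrite vm vw => /(_ cn) H.
  have {}H : (mu (`]th p, th q[ `&` B) <= image_measure v B)%E.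
    apply: H => // x y ax xy ya; apply: Hk => //; first exact: lt_le_trans ax.
    by apply: (le_lt_trans ya); have := a0 n; lra.
  apply: (@le_trans _ _ (mu (`]th p, th q[ `&` B))).
    apply: le_measure; [by apply/mem_set; exact: (measurableI _ _ (mE n) mB)|by apply/mem_set; exact: measurableI|].
    move=> z [[t1 [t2 [h1 h2 /andP[h3 h4]]]] Bz]; split => //=.
    by rewrite in_itv/= (le_lt_trans (pmin _ h1) h3) (lt_le_trans h4 (qmax _ h2)).
  apply: (le_trans H).
  rewrite /image_measure vD vm vw.
  have mn : measurable (`[a n, 1 - a n] `&` th @^-1` B).
    by have := @measurable_wm_map _ v; rewrite vD vm; apply.
  apply: ge0_subset_integral => //.
  - apply/measurable_EFinP; apply: measurable_funS (locally_int_measurable ik) => //.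
  - by move=> x [x01 _]; rewrite lee_fin k0.
  - by move=> x [/sub01 x01 Bx]; split.
apply: (@le_trans _ _ (mu (\bigcup_n (E n `&` B)))).
  apply: le_measure.
  - by apply/mem_set; apply: measurableI => //; exact: measurable_wm_range.
  - by apply/mem_set; apply: bigcup_measurable => n _; exact: (measurableI _ _ (mE n) mB).
  - by rewrite -setI_bigcupl; exact: setSI.
have cv := @nondecreasing_cvg_mu _ _ _ mu (fun n => E n `&` B).
have {}cv := cv (fun n => measurableI _ _ (mE n) mB) (bigcup_measurable (fun n _ => measurableI _ _ (mE n) mB)).
have {}cv : mu (E n `&` B) @[n --> \oo] --> mu (\bigcup_n (E n `&` B)).
  by apply: cv => m n mn; apply/subsetPset; apply: setSI; exact: Emono.
by apply: (cvge_le _ cv); exists 0%N => // n _; exact: En.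
Qed.

(** Because the weight is positive, an N-null set of angles is taken only on a null set of times,
    over which [k] integrates to zero; [range_le_integral] concludes. *)
Lemma image_measure_range_dominated (B : set R) : measurable B ->
  N B = 0%E -> mu (wm_range `&` B) = 0%E.
Proof.
move=> mB NB0.
have mD : measurable (`]0, 1[ `&` th @^-1` B).
  by have := @measurable_wm_map _ w; rewrite wD; apply.
have iw : mu.-integrable `]0, 1[ (EFin \o wm_weight w).
  by rewrite -wD; exact: integrable_wm_weight.
have DB0 : mu (`]0, 1[ `&` th @^-1` B) = 0%E.
  apply: (@negligible_of_integral0 _ _ (wm_weight w)) => //.
  - apply/measurable_EFinP; apply: (measurable_int mu).
    by apply: integrableS iw => //; exact: subIsetl.
  - by move=> x [x01 _]; exact: w0.
  - by move: NB0; rewrite /image_measure wD.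
apply/eqP; rewrite eq_le measure_ge0 andbT (le_trans (range_le_integral mB))//.
rewrite null_set_integral//; apply/measurable_EFinP.
by apply: measurable_funS (locally_int_measurable ik) => //; exact: subIsetl.
Qed.

(** Radon-Nikodym. For a strictly monotone angle weighted by the speed, [r z] is |theta'| divided by
    the speed at the time of angle [z], that is, the absolute curvature. *)
Lemma rearr_density_exists : exists r : R -> R,
  [/\ measurable_fun setT r, forall z, 0 <= r z &
    forall A : set R, measurable A ->
      mu (wm_range `&` A) = (\int[N]_(z in A) (r z)%:E)%E].
Proof.
have dom : image_measure range_map `<< N.
  apply/null_content_dominatesP => A mA NA.
  by rewrite [LHS](@image_measure_range A)//; exact: image_measure_range_dominated.
have [f [f0 ffin fint fE]] := radon_nikodym_sigma_finite dom.
exists (fine \o f); split.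
- have mf := measurable_int _ fint.
  exact: (measurableT_comp (@fine_measurable _ setT measurableT) mf).
- by move=> z /=; rewrite fine_ge0.
- move=> A mA; rewrite -image_measure_range// [LHS]fE//.
  by apply: eq_integral => z _ /=; rewrite fineK.
Qed.

End rearrangement_density.

(** * The derivative of the rearrangement *)

Section rearrangement_chain_rule.
Context {R : realType}.
Local Notation mu := (@lebesgue_measure R).
Variables (w : weighted_map R) (c : R) (r : R -> R).
Hypotheses (wD : wm_dom w = `]0, 1[%classic) (c0 : 0 <= c)
  (thc : forall t, t \in `]0, 1[ -> - c <= wm_map w t <= c)
  (wpos : 0 < fine (image_measure w setT))
  (mr : measurable_fun setT r) (r0 : forall z, 0 <= r z)
  (rE : forall A : set R, measurable A ->
      mu (wm_range w `&` A) = (\int[image_measure w]_(z in A) (r z)%:E)%E).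
Local Notation th := (wm_map w).
Local Notation N := (image_measure w).
Local Notation L := (total_weight w).
Local Notation vt := (rearr w c).
Local Notation I01 := (`]0%R, 1%R[%classic : set R).
Local Notation rmap := (rearr_map c0 wpos).

(** Minus the derivative of [vt]: the turning per unit of arc length, times the constant speed
    [L]. *)
Definition rearr_deriv (s : R) : R := r (vt s) * L.
Local Notation g := rearr_deriv.

Let L0 : 0 <= L. Proof. exact: ltW. Qed.

Let mvt D : measurable D -> measurable_fun D vt.
Proof. exact: rearr_measurable. Qed.

Lemma rearr_deriv_ge0 s : 0 <= g s.
Proof. by rewrite mulr_ge0. Qed.

Lemma measurable_rearr_deriv (D : set R) : measurable D -> measurable_fun D g.
Proof.
move=> mD; apply: measurable_funM => //.
by apply: measurableT_comp => //; exact: mvt.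
Qed.

Lemma integral_rearr (phi : R -> R) (A : set R) : measurable A ->
  measurable_fun setT phi -> (forall z, 0 <= phi z) ->
  (\int[N]_(z in A) (phi z)%:E =
   \int[mu]_(s in I01 `&` vt @^-1` A) (phi (vt s) * L)%:E)%E.
Proof.
move=> mA mphi phi0.
rewrite -[RHS](@integral_image_measure _ rmap phi A)//.
apply: eq_measure_integral => B mB _.
by rewrite [RHS](@image_measure_rearr _ w c wD c0 thc wpos B).
Qed.

Let measure_range (A : set R) : measurable A ->
  mu (wm_range w `&` A) = (\int[mu]_(s in I01 `&` vt @^-1` A) (g s)%:E)%E.
Proof. by move=> mA; rewrite rE// integral_rearr. Qed.

Lemma integrable_rearr_deriv : mu.-integrable `]0, 1[ (EFin \o g).
Proof.
apply/integrableP; split.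
  by apply/measurable_EFinP; exact: measurable_rearr_deriv.
under eq_integral do rewrite gee0_abs ?lee_fin ?rearr_deriv_ge0//.
have := measure_range measurableT; rewrite preimage_setT !setIT => <-.
have := @image_measure_range _ w c thc setT measurableT.
rewrite setIT => <-.
by rewrite ltey_eq fin_num_measure.
Qed.

Definition density_map : weighted_map R :=
  @WeightedMap R `]0, 1[%classic vt g (measurable_itv _)
    (mvt (measurable_itv _)) integrable_rearr_deriv (fun s _ => rearr_deriv_ge0 s).

(** Lebesgue measure on the range is r dN, and N is the image under [vt] of [L] ds; hence it is the
    image of [g] ds. *)
Lemma integral_rearr_deriv (phi : R -> R) (A : set R) : measurable A ->
  measurable_fun setT phi -> (forall z, 0 <= phi z) ->
  (\int[mu]_(z in wm_range w `&` A) (phi z)%:E =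
   \int[mu]_(s in I01 `&` vt @^-1` A) (phi (vt s) * g s)%:E)%E.
Proof.
move=> mA mphi phi0.
transitivity (\int[image_measure (range_map thc)]_(z in A) (phi z)%:E)%E.
  rewrite (@integral_image_measure _ (range_map thc) phi A)//=.
  by apply: eq_integral => x _; rewrite mulr1.
rewrite -[RHS](@integral_image_measure _ density_map phi A)//.
apply: eq_measure_integral => B mB _.
rewrite [LHS](@image_measure_range _ w c thc B)//.
by rewrite /image_measure measure_range.
Qed.

(** By [rearr_gtP], the angle exceeds [z] with positive weight and stays at or below a smaller level
    with positive weight, so it takes values on both sides of [z]. *)
Lemma rearr_range s2 s1 : s1 \in `]0, 1[ -> s2 \in `]0, 1[ ->
  `]vt s2, vt s1[ `<=` wm_range w.
Proof.
move=> s1I s2I z /=; rewrite in_itv/= => /andP[z2 z1].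
(* Positive weight gives only [th t1 <= z']; the midpoint [z'] makes this strictly less than [z]. *)
have zz : vt s2 < (vt s2 + z) / 2 < z by apply/andP; split; lra.
case/andP: zz; set z' := _ / 2 => z2' z'z.
have T1 : L * s1 < tail w z by rewrite -(rearr_gtP wD c0 thc wpos).
have T2 : tail w z' <= L * s2 by rewrite leNgt -(rearr_gtP wD c0 thc wpos)// -leNgt ltW.
have [t2 t2I ht2] : exists2 t2, t2 \in `]0, 1[ & z < th t2.
  apply/not_exists2P => H; move: T1; rewrite /tail image_measure_eq0//=.
    by rewrite ltNge mulr_ge0//; move: s1I; rewrite in_itv/= => /andP[/ltW].
  by move=> t tI; have [] := H t => // h; rewrite in_itv/= andbT.
have [t1 t1I ht1] : exists2 t1, t1 \in `]0, 1[ & th t1 <= z'.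
  apply/not_exists2P => H; move: T2; rewrite /tail image_measureT//=.
    rewrite -/(total_weight w) leNgt gtr_pMr//.
    by move: s2I; rewrite in_itv/= => /andP[_ ->].
  by move=> t tI; have [] := H t => // h; rewrite in_itv/= andbT ltNge; apply/negP.
by exists t1, t2; split => //; rewrite ht2 (le_lt_trans ht1).
Qed.

(** As [vt] may be flat, [[s1, s2]] is not itself a preimage; it lies between the preimages of the
    open and of the closed interval from [vt s2] to [vt s1], over which Lebesgue integrals agree. *)
Lemma chain_rule_rearr (phi : R -> R) s1 s2 : 0 < s1 -> s1 <= s2 -> s2 < 1 ->
  measurable_fun setT phi -> (forall z, 0 <= phi z) ->
  (\int[mu]_(s in `[s1, s2]) (phi (vt s) * g s)%:E =
   \int[mu]_(z in `]vt s2, vt s1[) (phi z)%:E)%E.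
Proof.
move=> s10 s12 s21 mphi phi0.
have s1I : s1 \in `]0, 1[ by rewrite in_itv/= s10 (le_lt_trans s12).
have s2I : s2 \in `]0, 1[ by rewrite in_itv/= s21 (lt_le_trans s10).
have mD : measurable (wm_range w) by exact: measurable_wm_range.
have mf D : measurable D -> measurable_fun D (fun s => (phi (vt s) * g s)%:E).
  move=> mD'; apply/measurable_EFinP/measurable_funM.
    by apply: measurableT_comp => //; exact: mvt.
  exact: measurable_rearr_deriv.
have f0 s : (0 <= (phi (vt s) * g s)%:E)%E.
  by rewrite lee_fin mulr_ge0// rearr_deriv_ge0.
have mpre A : measurable A -> measurable (`]0, 1[ `&` vt @^-1` A).
  by move=> mA; apply: mvt.
have EFphi D : measurable D -> measurable_fun D (EFin \o phi).
  by move=> mD'; apply/measurable_EFinP; exact: measurable_funTS.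
apply/eqP; rewrite eq_le; apply/andP; split.
  apply: (@le_trans _ _ (\int[mu]_(z in wm_range w `&` `[vt s2, vt s1]) (phi z)%:E)%E).
    rewrite integral_rearr_deriv//; apply: ge0_subset_integral => //.
    - exact: mpre.
    - by apply: mf; exact: mpre.
    - move=> s /=; rewrite !in_itv/= => /andP[s1s ss2].
      rewrite (lt_le_trans s10 s1s) (le_lt_trans ss2 s21).
      by split => //; rewrite !(rearr_noninc c0 wpos).
  have -> : (\int[mu]_(z in `]vt s2, vt s1[) (phi z)%:E =
      \int[mu]_(z in `[vt s2, vt s1]) (phi z)%:E)%E.
    by rewrite integral_itv_obnd_cbnd ?integral_itv_bndo_bndc//; exact: EFphi.
  apply: ge0_subset_integral => //.
  - exact: measurableI.
  - exact: EFphi.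
  - by move=> *; rewrite lee_fin.
rewrite -(setIidr (rearr_range s1I s2I)) integral_rearr_deriv//.
apply: ge0_subset_integral => //.
- exact: mpre.
- exact: mf.
- move=> s /=; rewrite !in_itv/= => -[_ /andP[h2 h1]]; apply/andP; split.
    rewrite leNgt; apply/negP => ss.
    by have := rearr_noninc c0 wpos (ltW ss); rewrite leNgt h1.
  rewrite leNgt; apply/negP => ss.
  by have := rearr_noninc c0 wpos (ltW ss); rewrite leNgt h2.
Qed.

(** * Energy estimate over a set [D'] of angles, for an arc in any parametrisation *)

Section energy.
Variables (J : set R) (Th k q e : R -> R) (D' : set R).
Hypotheses (mJ : measurable J) (mTh : measurable_fun J Th)
  (ik : mu.-integrable J (EFin \o k)) (iq : mu.-integrable J (EFin \o q))
  (k0 : forall x, J x -> 0 <= k x) (q0 : forall x, J x -> 0 <= q x)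
  (me : measurable_fun J e) (e0 : forall x, J x -> 0 <= e x)
  (keq : forall x, J x -> k x ^+ 2 <= e x * q x)
  (mD' : measurable D') (D'sub : D' `<=` wm_range w)
  (Hk : forall B : set R, measurable B ->
     (mu (D' `&` B) <= \int[mu]_(x in J `&` Th @^-1` B) (k x)%:E)%E)
  (Hq : forall B : set R, measurable B ->
     (\int[mu]_(x in J `&` Th @^-1` B) (q x)%:E <= N B)%E).

Let kmap := @WeightedMap R J Th k mJ mTh ik k0.
Let qmap := @WeightedMap R J Th q mJ mTh iq q0.

(* [r] is truncated so that the integral of its square can be absorbed when it
   appears on both sides of the Cauchy-Schwarz estimate. *)
Let trunc (n : nat) (z : R) : R := r z * \1_(D' `&` [set z | r z <= n%:R]) z.

Let mtr n : measurable (D' `&` [set z | r z <= n%:R]).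
Proof.
apply: measurableI => //.
have := mr measurableT (measurable_itv `]-oo, n%:R]); rewrite setTI.
by congr measurable; apply/seteqP; split => z /=; rewrite in_itv.
Qed.

Let mtrunc n : measurable_fun setT (trunc n).
Proof. by apply: measurable_funM => //; exact: measurable_indic. Qed.

Let trunc0 n z : 0 <= trunc n z.
Proof. by rewrite mulr_ge0// indicE. Qed.

Let trunc_sqr n z : trunc n z ^+ 2 = trunc n z * r z.
Proof.
rewrite /trunc indicE expr2; case: (_ \in _) => /=; rewrite ?mulr1 ?mulr0 ?mul0r//.
Qed.

Let trunc_le n z : trunc n z <= n%:R.
Proof.
rewrite /trunc indicE; have [|_] := boolP (_ \in _); last by rewrite mulr0.
by rewrite inE mulr1 => -[].
Qed.

Let mtrunc2 n : measurable_fun setT (fun z => trunc n z ^+ 2).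
Proof. exact: measurable_funX. Qed.

Let I n := (\int[mu]_(s in I01) (trunc n (vt s) ^+ 2 * L)%:E)%E.

(** One of the two factors [r], together with [L], is the density [g], which turns ds into Lebesgue
    measure on the range. *)
Let I_range n : I n = (\int[mu]_(z in wm_range w) (trunc n z)%:E)%E.
Proof.
have := @integral_rearr_deriv (trunc n) setT measurableT (mtrunc n) (trunc0 n).
rewrite preimage_setT !setIT => ->.
by apply: eq_integral => s _; rewrite trunc_sqr mulrA.
Qed.

Let I_fin n : I n \is a fin_num.
Proof.
rewrite I_range ge0_fin_numE; last first.
  by apply: integral_ge0 => z _; rewrite lee_fin.
have mR : measurable (wm_range w) by exact: measurable_wm_range.
apply: (@le_lt_trans _ _ (\int[mu]_(z in wm_range w) (n%:R)%:E)%E).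
  apply: ge0_le_integral => //; try by move=> *; rewrite lee_fin.
  apply/measurable_EFinP; apply: measurable_funTS; exact: mtrunc.
rewrite integral_cst//.
have Rfin : (mu (wm_range w) < +oo)%E.
  apply: (@le_lt_trans _ _ (mu `[- c, c])).
    by apply: le_measure; rewrite ?inE//; exact: wm_range_bnd.
  by rewrite [ltLHS](@lebesgue_measure_itv R `[- c, c])/=; case: ifP => _ //; rewrite ltry.
by rewrite lte_mul_pinfty// lee_fin.
Qed.

Let dmap : weighted_map R.
Proof.
refine (@WeightedMap R D' id (cst 1) mD' (@measurable_id _ _ _) _ (fun _ _ => ler01)).
apply: integrableS (range_integrable thc) => //; exact: measurable_wm_range.
Defined.

Let I_le_k n : (I n <= \int[mu]_(x in J) (trunc n (Th x) * k x)%:E)%E.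
Proof.
have -> : I n = (\int[image_measure dmap]_z (trunc n z)%:E)%E.
  rewrite (@integral_image_measure _ dmap)//= preimage_setT setIT I_range.
  rewrite -[in RHS](setIidr D'sub) integral_mkcondr; apply: eq_integral => z _.
  rewrite patchE mulr1 /trunc indicE; case: ifPn => // zD.
  rewrite (_ : z \in _ = false) ?mulr0//; apply/negbTE; apply: contra zD.
  by rewrite !inE => -[].
apply: (@le_trans _ _ (\int[image_measure kmap]_z (trunc n z)%:E)%E).
  apply: ge0_le_measure_integral => //.
  - move=> B mB; apply: le_trans (Hk mB).
    rewrite [leLHS](_ : _ = image_measure dmap B)//.
    rewrite /image_measure/= integral_cst ?mul1e//.
    exact: measurableI.
  - by move=> z; rewrite lee_fin.
  - by apply/measurable_EFinP; exact: mtrunc.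
by rewrite (@integral_image_measure _ kmap)//= preimage_setT setIT.
Qed.

Let q_le_I n : (\int[mu]_(x in J) (trunc n (Th x) ^+ 2 * q x)%:E <= I n)%E.
Proof.
have -> : I n = (\int[N]_z (trunc n z ^+ 2)%:E)%E.
  rewrite (@integral_rearr (fun z => trunc n z ^+ 2))//.
    by rewrite preimage_setT setIT.
  by move=> z; exact: sqr_ge0.
have := @integral_image_measure _ qmap _ setT measurableT (mtrunc2 n) (fun z => sqr_ge0 _).
rewrite /= preimage_setT setIT => <-.
apply: ge0_le_measure_integral => //.
- by move=> z; rewrite lee_fin sqr_ge0.
- by apply/measurable_EFinP; exact: mtrunc2.
Qed.

Let mcomp (psi : R -> R) : measurable_fun setT psi ->
  measurable_fun J (fun x => psi (Th x)).
Proof. by move=> mpsi; exact: measurableT_comp. Qed.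

Let mk : measurable_fun J k.
Proof. by apply/measurable_EFinP; exact: (measurable_int mu). Qed.

Let mq : measurable_fun J q.
Proof. by apply/measurable_EFinP; exact: (measurable_int mu). Qed.

Let I_le n : (I n <= \int[mu]_(x in J) (e x)%:E)%E.
Proof.
have Eint : (0 <= \int[mu]_(x in J) (e x)%:E)%E.
  by apply: integral_ge0 => x Jx; rewrite lee_fin e0.
have tk0 x : J x -> (0 <= (trunc n (Th x) * k x)%:E)%E.
  by move=> Jx; rewrite lee_fin mulr_ge0// k0.
have tq0 x : J x -> (0 <= (trunc n (Th x) ^+ 2 * q x)%:E)%E.
  by move=> Jx; rewrite lee_fin mulr_ge0// ?sqr_ge0// q0.
have mtq : measurable_fun J (fun x => trunc n (Th x) ^+ 2 * q x).
  by apply: measurable_funM => //; exact: (mcomp (mtrunc2 n)).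
(* [2 p k <= p ^ 2 q + e], since [k ^ 2 <= e q] *)
have H : (2%:E * \int[mu]_(x in J) (trunc n (Th x) * k x)%:E <=
    I n + \int[mu]_(x in J) (e x)%:E)%E.
  rewrite -ge0_integralZl//; last first.
    apply/measurable_EFinP; apply: measurable_funM => //.
    exact: (mcomp (mtrunc n)).
  apply: (@le_trans _ _ (\int[mu]_(x in J)
      ((trunc n (Th x) ^+ 2 * q x)%:E + (e x)%:E))%E).
    apply: ge0_le_integral => //.
    - by move=> x Jx; rewrite mule_ge0// tk0.
    - under eq_fun do rewrite -EFinM.
      apply/measurable_EFinP; apply: measurable_funM => //.
      by apply: measurable_funM => //; exact: (mcomp (mtrunc n)).
    - under eq_fun do rewrite -EFinD.
      by apply/measurable_EFinP; exact: measurable_funD.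
    - move=> x Jx; rewrite -EFinM -EFinD lee_fin.
      set p := trunc n (Th x); have p0 : 0 <= p by exact: trunc0.
      have := keq Jx; have := k0 Jx; have := q0 Jx; have := e0 Jx.
      move=> ex qx kx kq.
      rewrite -(@ler_pXn2r _ 2)// ?nnegrE ?mulr_ge0// ?addr_ge0// ?mulr_ge0// ?sqr_ge0//.
      apply: (@le_trans _ _ (4 * p ^+ 2 * (e x * q x))); last first.
        by have := sqr_ge0 (p ^+ 2 * q x - e x); nra.
      rewrite (_ : (2 * (p * k x)) ^+ 2 = 4 * p ^+ 2 * k x ^+ 2); last by ring.
      by rewrite ler_wpM2l// mulr_ge0// sqr_ge0.
  rewrite ge0_integralD//;
    do ?[exact/measurable_EFinP | by move=> x Jx; rewrite lee_fin e0].
  by apply: leeD2r; exact: q_le_I.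
have H2 : (2%:E * I n <= I n + \int[mu]_(x in J) (e x)%:E)%E.
  by apply: le_trans H; rewrite lee_pmul2l//; exact: I_le_k.
(* [I n] is finite, so one copy of it can be cancelled. *)
move: H2; rewrite -(fineK (I_fin n)) -EFinM; case: (integral _ _ _) Eint => [E _|_ _|//].
  by rewrite -EFinD !lee_fin; lra.
exact: leey.
Qed.

(** Monotone convergence in the truncated bound [I_le]. It serves twice: for the whole curve with
    [q] the speed, and for an arc parametrised by its abscissa with [q] constant equal to 1. Only
    two facts on the arc enter: its variation covers [D'], and its weight is part of N. *)
Lemma rearr_energy_le :
  (\int[mu]_(s in I01 `&` vt @^-1` D') (r (vt s) ^+ 2 * L)%:E <=
   \int[mu]_(x in J) (e x)%:E)%E.
Proof.
have mvt' := mvt (measurable_itv `]0%R, 1%R[).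
rewrite integral_mkcondr.
pose f n s := (trunc n (vt s) ^+ 2 * L)%:E.
have fE s : I01 s -> ((fun s => (r (vt s) ^+ 2 * L)%:E) \_ (vt @^-1` D')) s =
    limn (f ^~ s).
  move=> s01; apply/esym/cvg_lim => //; apply: cvg_near_cst.
  have [n rn] : exists n : nat, r (vt s) <= n%:R.
    exists (Num.truncn (r (vt s))).+1; exact/ltW/truncnS_gt.
  exists n => // m nm /=; rewrite /f /trunc patchE indicE.
  have [sD|sD] := boolP (s \in _).
    rewrite (_ : vt s \in _ = true) ?mulr1//.
    apply/mem_set; split; first by move: sD; rewrite inE.
    by rewrite /= (le_trans rn)// ler_nat.
  rewrite (_ : vt s \in _ = false) ?mulr0 ?expr0n ?mul0r//.
  by apply: contraNF sD; rewrite !inE => -[].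
rewrite [leLHS](_ : _ = \int[mu]_(s in I01) limn (f ^~ s))%E; last first.
  by apply: eq_integral => s /[!inE] /fE.
rewrite monotone_convergence//.
- apply: lime_le.
    apply: ereal_nondecreasing_is_cvgn => m n mn; apply: ge0_le_integral => //.
    + by move=> s _; rewrite lee_fin mulr_ge0// sqr_ge0.
    + apply/measurable_EFinP; apply: measurable_funM => //.
      exact: (measurableT_comp (mtrunc2 m) mvt').
    + apply/measurable_EFinP; apply: measurable_funM => //.
      exact: (measurableT_comp (mtrunc2 n) mvt').
    + move=> s _; rewrite lee_fin ler_wpM2r// ler_sqr ?nnegrE//.
      rewrite /trunc ler_wpM2l// !indicE ler_nat; case: (boolP (_ \in _)) => // h.
      rewrite (_ : vt s \in _ = true)//; apply/mem_set; move: h; rewrite inE => -[h1 h2].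
      by split => //=; rewrite (le_trans h2)// ler_nat.
  by apply: nearW => n; exact: I_le.
- move=> n; apply/measurable_EFinP; apply: measurable_funM => //.
  exact: (measurableT_comp (mtrunc2 n) mvt').
- by move=> n s _; rewrite lee_fin mulr_ge0// sqr_ge0.
- move=> s _ m n mn; rewrite lee_fin ler_wpM2r// ler_sqr ?nnegrE//.
  rewrite /trunc ler_wpM2l// !indicE ler_nat; case: (boolP (_ \in _)) => // h.
  rewrite (_ : vt s \in _ = true)//; apply/mem_set; move: h; rewrite inE => -[h1 h2].
  by split => //=; rewrite (le_trans h2)// ler_nat.
Qed.

End energy.

End rearrangement_chain_rule.

(** * Real-valued integrals *)

Section real_integrals.
Context {R : realType}.
Local Notation mu := (@lebesgue_measure R).
Implicit Types (f g h : R -> R) (a b s t x : R) (D : set R).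
Local Notation itg D f := (mu.-integrable D (EFin \o f)).

Lemma in_continuous_within a b f : {in `[a, b], continuous f} ->
  {within `[a, b], continuous f}.
Proof. by move=> cf; apply: continuous_in_subspaceT => x /[!inE]/= /cf. Qed.

Lemma in_continuous_measurable a b f : {in `[a, b], continuous f} ->
  measurable_fun `[a, b] f.
Proof.
move=> cf; apply: subspace_continuous_measurable_fun => //.
exact: in_continuous_within.
Qed.

Lemma in_continuous_bounded a b f : {in `[a, b], continuous f} ->
  exists2 M, 0 < M & forall x, x \in `[a, b] -> `|f x| <= M.
Proof.
move=> cf; have [ab|ba] := leP a b; last first.
  exists 1 => // x; rewrite in_itv/= => /andP[ax xb].
  by have := lt_le_trans ba (le_trans ax xb); rewrite ltxx.
have cN : {within `[a, b], continuous (fun x => `|f x|)}.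
  apply: in_continuous_within => x xab.
  by apply: (@continuous_comp _ _ _ f Num.norm); [exact: cf|exact: norm_continuous].
have [m _ mx] := EVT_max ab cN.
exists (`|f m| + 1); first by rewrite ltr_pwDr.
by move=> x /mx/le_trans; apply; rewrite lerDl.
Qed.

Lemma itgD D f g : measurable D -> itg D f -> itg D g -> itg D (fun x => f x + g x).
Proof.
move=> mD fi gi.
by have := @integrableD _ _ _ mu D mD _ _ fi gi; congr (integrable _ _ _); apply/funext.
Qed.

Lemma itgZ D f (k : R) : measurable D -> itg D f -> itg D (fun x => k * f x).
Proof.
move=> mD fi.
by have := @integrableZl _ _ _ mu D mD k _ fi; congr (integrable _ _ _); apply/funext => x /=; rewrite EFinM.
Qed.

Lemma itgN D f : measurable D -> itg D f -> itg D (fun x => - f x).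
Proof.
move=> mD /(itgZ (-1) mD); congr (integrable _ _ _).
by apply/funext => x /=; rewrite mulN1r.
Qed.

Lemma itgB D f g : measurable D -> itg D f -> itg D g -> itg D (fun x => f x - g x).
Proof. by move=> mD fi gi; apply: itgD => //; exact: itgN. Qed.

Lemma itg_abs D f : measurable D -> itg D f -> itg D (fun x => `|f x|).
Proof. by move=> mD /(@integrable_abse _ _ _ mu). Qed.

Lemma itg_le D f g : measurable D -> measurable_fun D f ->
  (forall x, D x -> `|f x| <= g x) -> itg D g -> itg D f.
Proof.
move=> mD mf fg gi; apply: (@le_integrable _ _ _ mu D mD _ _ _ _ gi) => /=.
  exact/measurable_EFinP.
by move=> x Dx; rewrite lee_fin (le_trans (fg _ Dx))// ler_norm.
Qed.

Lemma itg_measurable D f : itg D f -> measurable_fun D f.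
Proof. by move=> /integrableP[/measurable_EFinP]. Qed.

Lemma itgS D1 D2 f : measurable D1 -> measurable D2 -> D2 `<=` D1 ->
  itg D1 f -> itg D2 f.
Proof. by move=> ? ? ? fi; exact: integrableS fi. Qed.

Lemma itg_itvS a b s t f : a <= s -> t <= b -> itg `[a, b] f -> itg `[s, t] f.
Proof.
by move=> as_ tb; apply: itgS => //; apply: subset_itv; rewrite bnd_simp.
Qed.

Lemma itg_bndM D f g (M : R) : measurable D -> measurable_fun D f ->
  (forall x, D x -> `|f x| <= M) -> itg D g -> itg D (fun x => f x * g x).
Proof.
move=> mD mf fM gi.
apply: (@itg_le _ _ (fun x => M * `|g x|)) => //.
- by apply: measurable_funM => //; exact: itg_measurable.
- by move=> x Dx; rewrite normrM ler_wpM2r// fM.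
- by apply: itgZ => //; exact: itg_abs.
Qed.

Lemma itg_contM a b f g : {in `[a, b], continuous f} -> itg `[a, b] g ->
  itg `[a, b] (fun x => f x * g x).
Proof.
move=> cf gi; have [M _ fM] := in_continuous_bounded cf.
by apply: (@itg_bndM _ _ _ M) => //; exact: in_continuous_measurable.
Qed.

Lemma lebesgue_cc_lty a b : (mu `[a, b] < +oo)%E.
Proof.
by rewrite [ltLHS](@lebesgue_measure_itv R `[a, b])/=; case: ifP => _ //; rewrite ltry.
Qed.

Lemma itg_cst a b (k : R) : itg `[a, b] (cst k).
Proof.
apply: measurable_bounded_integrable => //.
  exact: lebesgue_cc_lty.
by exists `|k|; split; [exact: num_real|move=> M rM x _ /=; exact: ltW].
Qed.

Lemma itg_cont a b f : {in `[a, b], continuous f} -> itg `[a, b] f.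
Proof.
move=> cf; have := itg_contM cf (itg_cst a b 1).
by congr (integrable _ _ _); apply/funext => x /=; rewrite mulr1.
Qed.

Lemma Rintegral_itv_cst a b (k : R) : a <= b -> \int[mu]_(x in `[a, b]) k = k * (b - a).
Proof.
move=> ab; rewrite Rintegral_cst//; congr (_ * _).
rewrite [X in fine X](@lebesgue_measure_itv R `[a, b])/= lte_fin.
case: ltP => //= ba.
have /eqP -> : a == b by rewrite eq_le ab ba.
by rewrite subrr.
Qed.

Lemma le_Rintegral_norm a b f g : itg `[a, b] f -> itg `[a, b] g ->
  (forall x, x \in `[a, b] -> `|f x| <= g x) ->
  `|\int[mu]_(x in `[a, b]) f x| <= \int[mu]_(x in `[a, b]) g x.
Proof.
move=> fi gi fg; apply: (le_trans (le_normr_Rintegral _ fi)) => //.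
by apply: le_Rintegral => //; exact: itg_abs.
Qed.

Lemma Rintegral_itv_diff a s t f : a <= s -> s <= t -> itg `[a, t] f ->
  \int[mu]_(x in `[a, t]) f x - \int[mu]_(x in `[a, s]) f x =
  \int[mu]_(x in `[s, t]) f x.
Proof. by move=> as_ st fi; rewrite (Rintegral_itv_split as_ st fi); lra. Qed.

(* Cousin's covering argument, as a supremum: tagged local estimates add up. *)
Lemma local_increment_le (h Q : R -> R) a b : a <= b ->
  (forall x, a <= x <= b -> exists2 d, 0 < d & forall s t,
     a <= s -> s <= x -> x <= t -> t <= b -> x - d < s -> t < x + d ->
     `|h t - h s| <= Q t - Q s) ->
  `|h b - h a| <= Q b - Q a.
Proof.
move=> ab H.
pose S := [set x | a <= x <= b /\ `|h x - h a| <= Q x - Q a].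
have Sa : S a by split; rewrite ?lexx ?ab// !subrr normr0.
have hS : has_sup S by split; [exists a|exists b => x [/andP[]]].
have aS : a <= sup S by exact: ub_le_sup hS.2 _ Sa.
have Sb : sup S <= b by apply: ge_sup; [exists a|move=> x [/andP[]]].
have [|d d0 Hd] := H (sup S); first by rewrite aS Sb.
have [y [/andP[ay yb] Sy] yS] := sup_adherent d0 hS.
have yS' : y <= sup S by apply: (ub_le_sup hS.2); split; rewrite ?ay ?yb.
have step t : sup S <= t -> t <= b -> t < sup S + d -> S t.
  move=> St tb td; split; first by rewrite (le_trans aS St).
  have := Hd y t ay yS' St tb yS td.
  have := ler_normD (h t - h y) (h y - h a).
  by rewrite addrA subrK; lra.
have [Sb'|Sb'] := ltP (sup S) b; last first.
  have E : sup S = b by apply/eqP; rewrite eq_le Sb Sb'.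
  have [] // : S b by apply: step => //; rewrite E ltrDl.
pose t := Num.min b (sup S + d / 2).
have tS : sup S < t by rewrite lt_min Sb'/= ltrDl; lra.
have : S t.
  apply: step; [exact: ltW|by rewrite ge_min lexx|].
  by rewrite gt_min; apply/orP; right; lra.
by move=> /(ub_le_sup hS.2); rewrite leNgt tS.
Qed.

(** Local errors of at most [eps] times the integral of a fixed [m] add up, by [local_increment_le],
    to at most [eps] times its integral over [[a, b]]; then [eps] tends to zero. *)
Lemma eq_integral_of_local (h e m : R -> R) a b : a <= b ->
  itg `[a, b] e -> itg `[a, b] m ->
  (forall eps, 0 < eps -> forall x, a <= x <= b -> exists2 d, 0 < d & forall s t,
     a <= s -> s <= x -> x <= t -> t <= b -> x - d < s -> t < x + d ->
     `|h t - h s - \int[mu]_(x in `[s, t]) e x| <= eps * \int[mu]_(x in `[s, t]) m x) ->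
  h b - h a = \int[mu]_(x in `[a, b]) e x.
Proof.
move=> ab ei mi H; apply/eqP; rewrite -subr_eq0 -normr_le0.
have K eps : 0 < eps -> `|h b - h a - \int[mu]_(x in `[a, b]) e x| <=
    eps * \int[mu]_(x in `[a, b]) m x.
  move=> e0.
  have := @local_increment_le (fun x => h x - \int[mu]_(y in `[a, x]) e y)
    (fun x => eps * \int[mu]_(y in `[a, x]) m y) a b ab.
  rewrite !set_itv1 !Rintegral_set1 mulr0 !subr0.
  rewrite (_ : h b - _ - h a = h b - h a - \int[mu]_(x in `[a, b]) e x); last by lra.
  apply => x xab; have [d d0 Hd] := H _ e0 x xab; exists d => // s t as_ sx xt tb xs td.
  have st := le_trans sx xt.
  have := Hd s t as_ sx xt tb xs td.
  rewrite -mulrBr (Rintegral_itv_diff as_ st); last by apply: itg_itvS mi.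
  rewrite -(Rintegral_itv_diff as_ st); last by apply: itg_itvS ei.
  by congr (`|_| <= _); lra.
rewrite leNgt; apply/negP => n0.
set n := `|_| in n0 K; set M := \int[mu]_(x in _) m x in K.
(* This [eps] would bound the discrepancy [n] by [n / 2]; the 1 covers the case [M = 0]. *)
have := K (n / (2 * (`|M| + 1))).
have M0 : 0 < `|M| + 1 by rewrite ltr_pwDr.
rewrite divr_gt0 ?mulr_gt0// => /(_ isT).
move=> H1; have M1 : M <= `|M| + 1 by rewrite (le_trans (ler_norm M))// lerDl.
have := ler_wpM2l (ltW (_ : 0 < n / (2 * (`|M| + 1)))) M1.
rewrite divr_gt0 ?mulr_gt0// => /(_ isT).
rewrite (_ : n / (2 * (`|M| + 1)) * (`|M| + 1) = n / 2); last by field; lra.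
by move: H1 n0; lra.
Qed.

End real_integrals.

(** * Primitives and weak derivatives *)

Section primitive_theory.
Context {R : realType}.
Local Notation mu := (@lebesgue_measure R).
Implicit Types (f g h : R -> R) (a b s t x : R) (D : set R).
Local Notation itg D f := (mu.-integrable D (EFin \o f)).

Lemma primitive_continuous a b f g : primitive a b f g -> {in `]a, b[, continuous f}.
Proof.
move=> [gi Hfg] x /[!in_itv]/= /andP[ax xb].
pose c := (a + x) / 2; pose d := (x + b) / 2.
have [ac cx xd db] : [/\ a < c, c < x, x < d & d < b].
  by split; rewrite /c /d; lra.
have cd : c <= d by lra.
have E y : c <= y -> y < b -> f c + parameterized_integral mu c y g = f y.
  by move=> cy yb; rewrite /parameterized_integral -Hfg//; lra.
have cI := parameterized_integral_continuous cd (gi _ _ ac db).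
have xcd : x \in `]c, d[ by rewrite in_itv/= cx xd.
have := within_continuous_continuous (lt_trans cx xd) cI xcd.
move=> /(cvgD (cvg_cst (f c))).
rewrite /= -[X in _ --> X -> _]/(f c + parameterized_integral mu c x g).
rewrite E ?(ltW cx)//; apply: cvg_trans; apply: near_eq_cvg.
near=> y; rewrite /= -[LHS]/(f c + parameterized_integral mu c y g) E//.
- by apply: ltW; near: y; exact: lt_nbhsr.
- by apply: (lt_trans _ db); near: y; exact: lt_nbhsl.
Unshelve. all: by end_near. Qed.

Lemma primitive_is_derive a b f g x : primitive a b f g -> x \in `]a, b[ ->
  {for x, continuous g} -> is_derive x 1 f (g x).
Proof.
move=> [gi Hfg] /[!in_itv]/= /andP[ax xb] cg.
pose c := (a + x) / 2; pose d := (x + b) / 2.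
have [ac cx xd db] : [/\ a < c, c < x, x < d & d < b].
  by split; rewrite /c /d; lra.
have [dF F'] := continuous_FTC1_closed xd (gi _ _ ac db) cx cg.
have E : \forall y \near x, f c + \int[mu]_(t in `[c, y]) g t = f y.
  near=> y.
  have cy : c <= y by apply: ltW; near: y; exact: lt_nbhsr.
  have yb : y < b by apply: (lt_trans _ db); near: y; exact: lt_nbhsl.
  by rewrite -Hfg//; lra.
apply: (@near_eq_is_derive R R^o R^o _ _ x 1 (g x) E).
have dF' : is_derive x 1 (fun y => \int[mu]_(t in `[c, y]) g t) (g x).
  by rewrite -[X in is_derive _ _ _ X]F' derive1E; exact: (DeriveDef dF erefl).
have := @is_deriveD R R^o R^o (cst (f c)) _ x 1 0 (g x) _ dF'.
by rewrite add0r; apply.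
Unshelve. all: by end_near. Qed.

Lemma derive_primitive a b f : (forall x, x \in `]a, b[ -> derivable f x 1) ->
  {in `]a, b[, continuous (derive1 f)} -> primitive a b f (derive1 f).
Proof.
move=> df cf'.
have cf : {in `]a, b[, continuous f}.
  by move=> x xab; apply/differentiable_continuous/derivable1_diffP; exact: df.
split=> [s t as_ tb|s t as_ st tb].
  by apply: itg_cont => x xst; apply: cf'; exact: itvcc_oo xst.
move: st; rewrite le_eqVlt => /predU1P[<-|st].
  by rewrite subrr set_itv1 Rintegral_set1.
have c1 : {in `[s, t], continuous (derive1 f)}.
  by move=> x xst; apply: cf'; exact: itvcc_oo xst.
suff dF : derivable_oo_LRcontinuous f s t.
  have := @continuous_FTC2 R (derive1 f) f s t st (in_continuous_within c1) dF.
  by move=> /(_ (fun _ _ => erefl)) E; rewrite /Rintegral [X in fine X]E.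
split.
- move=> x xst; apply: df; apply: (@itvcc_oo R a b s t) => //; exact: subset_itv_oo_cc.
- apply: cvg_at_right_filter; apply: cf; apply: (@itvcc_oo R a b s t) => //.
  by rewrite in_itv/= lexx ltW.
- apply: cvg_at_left_filter; apply: cf; apply: (@itvcc_oo R a b s t) => //.
  by rewrite in_itv/= lexx ltW.
Qed.

(** The derivatives are only integrable, so the product is not differentiated pointwise. On a short
    interval, freezing the factors [f] and [g] at end points costs at most [eps] times the integral
    of |f'| + |g'|, as [eq_integral_of_local] requires. *)
Lemma primitive_mul a b f f' g g' : primitive a b f f' -> primitive a b g g' ->
  primitive a b (fun x => f x * g x) (fun x => f x * g' x + g x * f' x).
Proof.
move=> pf pg; have cf := primitive_continuous pf; have cg := primitive_continuous pg.
case: pf => fi Hf; case: pg => gi Hg.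
have ei s t : a < s -> t < b -> itg `[s, t] (fun x => f x * g' x + g x * f' x).
  move=> as_ tb; apply: itgD => //; apply: itg_contM.
  - by move=> x xst; apply: cf; exact: itvcc_oo xst.
  - exact: gi.
  - by move=> x xst; apply: cg; exact: itvcc_oo xst.
  - exact: fi.
split=> // s t as_ st tb.
have mi : itg `[s, t] (fun x => `|g' x| + `|f' x|).
  by apply: itgD => //; apply: itg_abs => //; [exact: gi|exact: fi].
apply: (@eq_integral_of_local R (fun x => f x * g x)
  (fun x => f x * g' x + g x * f' x) _ s t st (ei _ _ as_ tb) mi).
move=> eps e0 x /andP[sx xt].
have xab : x \in `]a, b[ by rewrite in_itv/= (lt_le_trans as_ sx) (le_lt_trans xt tb).
have e2 : 0 < eps / 2 by lra.
have /cvgrPdist_lt /(_ _ e2) /nbhs_ballP[d1 /= d10 Hd1] := cf x xab.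
have /cvgrPdist_lt /(_ _ e2) /nbhs_ballP[d2 /= d20 Hd2] := cg x xab.
exists (Num.min d1 d2); first by rewrite lt_min d10.
move=> p q sp px xq qt xp qx.
have pq := le_trans px xq.
have ap := lt_le_trans as_ sp; have qb := le_lt_trans qt tb.
have near1 y : y \in `[p, q] -> `|f x - f y| < eps / 2 /\ `|g x - g y| < eps / 2.
  rewrite in_itv/= => /andP[py yq].
  have : `|x - y| < Num.min d1 d2 by rewrite ltr_distl; apply/andP; split; lra.
  by rewrite lt_min => /andP[h1 h2]; split; [exact: Hd1|exact: Hd2].
have pI : p \in `[p, q] by rewrite in_itv/= lexx.
have qI : q \in `[p, q] by rewrite in_itv/= lexx pq.
have fpq := fi _ _ ap qb; have gpq := gi _ _ ap qb.
have -> : f q * g q - f p * g p =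
    f q * (g q - g p) + g p * (f q - f p) by ring.
have fz : itg `[p, q] (fun y => f q * g' y) by exact: itgZ.
have gz : itg `[p, q] (fun y => g p * f' y) by exact: itgZ.
have -> : f q * (g q - g p) + g p * (f q - f p) =
    \int[mu]_(y in `[p, q]) (f q * g' y + g p * f' y).
  by rewrite RintegralD// !RintegralZl// Hf// Hg.
rewrite -RintegralB//; [|exact: itgD|exact: ei].
rewrite -RintegralZl//; last by apply: itgD => //; exact: itg_abs.
apply: le_Rintegral_norm.
- apply: itgB => //; last exact: ei.
  by apply: itgD => //; exact: itgZ.
- by apply: itgZ => //; apply: itgD => //; exact: itg_abs.
move=> y ypq.
rewrite (_ : _ - _ = (f q - f y) * g' y + (g p - g y) * f' y); last by ring.
rewrite (le_trans (ler_normD _ _))// !normrM mulrDr; apply: lerD.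
  rewrite ler_wpM2r//; have [h1 _] := near1 _ ypq; have [h2 _] := near1 _ qI.
  by have := ler_normD (f q - f x) (f x - f y); rewrite addrA subrK distrC in h2 *; lra.
rewrite ler_wpM2r//; have [_ h1] := near1 _ ypq; have [_ h2] := near1 _ pI.
by have := ler_normD (g p - g x) (g x - g y); rewrite addrA subrK distrC in h2 *; lra.
Qed.

Lemma Rintegral_support (A B : set R) u : measurable A -> measurable B ->
  B `<=` A -> (forall x, A x -> ~ B x -> u x = 0) ->
  \int[mu]_(x in A) u x = \int[mu]_(x in B) u x.
Proof.
move=> mA mB BA u0; rewrite -(setIidr BA) [RHS]Rintegral_mkcondr.
apply: eq_Rintegral => x /[!inE] Ax; rewrite patchE; case: ifPn => //.
by rewrite notin_setE => /(u0 _ Ax).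
Qed.

End primitive_theory.

(** * Weak derivatives and the lemma of du Bois-Reymond *)

Section weak_derivatives.
Context {R : realType}.
Local Notation mu := (@lebesgue_measure R).
Implicit Types (f g h : R -> R) (a b c d s t x : R) (D : set R).
Local Notation itg D f := (mu.-integrable D (EFin \o f)).

(** The indefinite integral of the extension of [h] by zero vanishes identically, and its derivative
    is almost everywhere that extension. *)
Lemma ae_eq0_of_integral0 c d h : itg `[c, d] h ->
  (forall s t, c <= s -> s <= t -> t <= d -> \int[mu]_(x in `[s, t]) h x = 0) ->
  {ae mu, forall x, x \in `[c, d] -> h x = 0}.
Proof.
move=> ih H0; pose h' := h \_ `[c, d].
have ih' : itg setT h'.
  rewrite /h' -restrict_EFin; apply/integrable_restrict => //.
  by rewrite setTI.
have lh : locally_integrable setT h' by exact: integrable_locally_restrict.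
have ihy y : itg `]-oo, y] h' by exact: itgS ih'.
have F0 x : \int[mu]_(t in `]-oo, x]) h' t = 0.
  rewrite /h' -Rintegral_mkcondr.
  have -> : `]-oo, x] `&` `[c, d] = `[c, Num.min x d]%classic :> set R.
    apply/seteqP; split=> y /=; rewrite !in_itv/= le_min.
      by move=> [-> /andP[-> ->]].
    by move=> /andP[-> /andP[-> ->]].
  have [cm|mc] := leP c (Num.min x d); first by apply: H0 => //; rewrite ge_min lexx orbT.
  by rewrite set_itv_ge ?Rintegral_set0// bnd_simp -ltNge.
have := FTC1Ny ihy lh; apply: filterS; first exact: (ae_filter_ringOfSetsType mu).
move=> x [_].
have -> : (fun y => \int[mu]_(t in [set` `]-oo, y]]) h' t) = cst 0.
  by apply/funext => y; exact: F0.
rewrite derive1_cst /h' patchE => E xcd.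
by move: E; rewrite mem_set.
Qed.

Lemma ae_eq0_of_locally_integral0 a b h : locally_int a b h ->
  (forall s t, a < s -> s <= t -> t < b -> \int[mu]_(x in `[s, t]) h x = 0) ->
  {ae mu, forall x, x \in `]a, b[ -> h x = 0}.
Proof.
move=> ih H0; pose e n : R := n.+1%:R^-1.
have e0 n : 0 < e n by rewrite invr_gt0.
have : {ae mu, forall x n, x \in `[a + e n, b - e n] -> h x = 0}.
  apply/ae_foralln => n; apply: ae_eq0_of_integral0.
    by apply: ih; have := e0 n; lra.
  by move=> s t s1 st t1; apply: H0 => //; have := e0 n; lra.
apply: filterS; first exact: (ae_filter_ringOfSetsType mu).
move=> x H; rewrite in_itv/= => /andP[ax xb].
pose m := Num.min (x - a) (b - x).
have m0 : 0 < m by rewrite lt_min !subr_gt0 ax.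
apply: (H (Num.truncn m^-1)).
have em : e (Num.truncn m^-1) < m.
  rewrite /e -[ltRHS]invrK ltf_pV2 ?posrE ?invr_gt0//.
  exact: truncnS_gt.
by move: em; rewrite /m lt_min => /andP[]; rewrite in_itv/= => h1 h2; lra.
Qed.

Lemma primitive_unique a b f g1 g2 : primitive a b f g1 -> primitive a b f g2 ->
  {ae mu, forall x, x \in `]a, b[ -> g1 x = g2 x}.
Proof.
move=> [i1 H1] [i2 H2].
have : {ae mu, forall x, x \in `]a, b[ -> g1 x - g2 x = 0}.
  apply: ae_eq0_of_locally_integral0.
    by move=> c d ac db; apply: itgB => //; [exact: i1|exact: i2].
  move=> s t as_ st tb; rewrite RintegralB//; [|exact: i1|exact: i2].
  by rewrite -H1// -H2// subrr.
apply: filterS; first exact: (ae_filter_ringOfSetsType mu).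
by move=> x H /H /eqP; rewrite subr_eq0 => /eqP.
Qed.

Lemma weak_derivative_of_primitive a b f g :
  primitive a b f g -> weak_derivative a b f g.
Proof.
move=> pf phi [dphi cphi [c [d [ac db phi0]]]].
have [ab|ba] := ltP a b; last first.
  by rewrite set_itv_ge ?Rintegral_set0 ?oppr0// bnd_simp -leNgt.
(* [c'] and [d'] lie strictly beyond [c] and [d], so that [phi] vanishes there and integration by
   parts has no boundary term; the midpoint [m] keeps [c' <= d'] even if [[c, d]] is empty. *)
pose m := (a + b) / 2; pose c' := (a + Num.min c m) / 2.
pose d' := (Num.max d m + b) / 2.
have [am mb] : a < m /\ m < b by rewrite /m; split; lra.
have [ac' c'c c'm] : [/\ a < c', c' < c & c' < m].
  have : a < Num.min c m by rewrite lt_min ac.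
  have : Num.min c m <= c by rewrite ge_min lexx.
  have : Num.min c m <= m by rewrite ge_min lexx orbT.
  by rewrite /c'; split; lra.
have [db' dd' md'] : [/\ d' < b, d < d' & m < d'].
  have : Num.max d m < b by rewrite gt_max db.
  have : d <= Num.max d m by rewrite le_max lexx.
  have : m <= Num.max d m by rewrite le_max lexx orbT.
  by rewrite /d'; split; lra.
have cd' : c' <= d' by lra.
have out x : ~ `[c', d']%classic x -> (x < c) || (d < x).
  move=> /negP; rewrite -[X in ~~ X]/(x \in `[c', d']) in_itv/= negb_and -!ltNge.
  by move=> /orP[xc|dx]; apply/orP; [left|right]; lra.
have phi0' x : (x < c) || (d < x) -> phi x = 0.
  move=> H; apply: phi0; rewrite in_itv/= negb_and -!ltNge.
  by case/orP: H => ->; rewrite ?orbT.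
have dphi0 x : (x < c) || (d < x) -> derive1 phi x = 0.
  move=> H; have E : \forall y \near x, (cst 0 : R -> R) y = phi y.
    case/orP: H => H; near=> y; rewrite phi0'//; apply/orP; [left|right].
      by near: y; exact: lt_nbhsl.
    by near: y; exact: lt_nbhsr.
  by rewrite derive1E -(@near_eq_derive R R^o R^o _ _ x 1 E) derive_cst.
have pphi : primitive a b phi (derive1 phi).
  by apply: derive_primitive => x _; [exact: dphi|exact: cphi].
have sub : `[c', d']%classic `<=` `]a, b[%classic.
  by apply: subset_itv; rewrite bnd_simp.
rewrite (@Rintegral_support _ _ `[c', d'])//; last first.
  by move=> x _ /out /dphi0 ->; rewrite mulr0.
rewrite [in RHS](@Rintegral_support _ _ `[c', d'])//; last first.
  by move=> x _ /out /phi0' ->; rewrite mulr0.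
have [_ /(_ c' d' ac' cd' db')] := primitive_mul pf pphi.
rewrite (phi0' c') ?c'c// (phi0' d') ?dd' ?orbT// !mulr0 subr0.
have cf x : x \in `[c', d'] -> {for x, continuous f}.
  by move=> xI; apply: (primitive_continuous pf); exact: sub.
have cp x : x \in `[c', d'] -> {for x, continuous phi}.
  by move=> xI; apply: (primitive_continuous pphi); exact: sub.
have [ig _] := pf.
rewrite RintegralD//; last 2 first.
- by apply: itg_contM => //; apply: itg_cont => x _; exact: cphi.
- by apply: itg_contM => //; exact: ig.
have -> : \int[mu]_(x in `[c', d']) (phi x * g x) =
    \int[mu]_(x in `[c', d']) (g x * phi x).
  by apply: eq_Rintegral => x _; rewrite mulrC.
by lra.
Unshelve. all: by end_near. Qed.

Lemma exists_primitive a b g : locally_int a b g -> exists G, primitive a b G g.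
Proof.
move=> ig; pose m := (a + b) / 2.
exists (fun x => if m <= x then \int[mu]_(t in `[m, x]) g t
                 else - \int[mu]_(t in `[x, m]) g t).
split=> // s t as_ st tb.
have [am mb] : a < m /\ m < b by rewrite /m; split; lra.
case: ifPn => mt; case: ifPn => ms; rewrite -?ltNge in mt ms.
- by rewrite (@Rintegral_itv_split _ m s t)//; [lra|exact: ig].
- rewrite (@Rintegral_itv_split _ s m t)//; [lra|exact: ltW|exact: ig].
- by have := le_lt_trans (le_trans ms st) mt; rewrite ltxx.
- by rewrite (@Rintegral_itv_split _ s t m)//; [lra|exact: ltW|exact: ig].
Qed.

Lemma exists_test_function a b s t (rho : R -> R) : a < s -> s <= t -> t < b ->
  continuous rho -> (forall x, x \notin `[s, t] -> rho x = 0) ->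
  \int[mu]_(x in `[s, t]) rho x = 0 ->
  exists2 phi, test_function a b phi & forall x, derive1 phi x = rho x.
Proof.
move=> as_ st tb crho rho0 irho.
have irh c d : itg `[c, d] rho by apply: itg_cont => x _; exact: crho.
(* Starting at [s - 1] makes every [x >= s] interior, so that the fundamental theorem of calculus
   applies at [s] as well. *)
pose phi x := \int[mu]_(y in `[s - 1, x]) rho y.
have rout y : ~ `[s, t]%classic y -> rho y = 0 by move=> /negP; exact: rho0.
have phil x : x < s -> phi x = 0.
  move=> xs; rewrite /phi (@Rintegral_support _ _ set0) ?Rintegral_set0//.
  move=> y /=; rewrite in_itv/= => /andP[_ yx] _; apply: rho0.
  by rewrite in_itv/= negb_and -!ltNge (le_lt_trans yx xs).
have phir x : t < x -> phi x = 0.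
  move=> tx; rewrite /phi (@Rintegral_support _ _ `[s, t])//.
  - by apply: subset_itv; rewrite bnd_simp; lra.
  - by move=> y _ /rout.
have dphi x : derivable phi x 1 /\ derive1 phi x = rho x.
  have [xs|sx] := ltP x s; last first.
    apply: (@continuous_FTC1_closed _ _ _ _ (x + 1)) => //; [by rewrite ltrDl|lra|exact: crho].
  have E : \forall y \near x, (cst 0 : R -> R) y = phi y.
    by near=> y; rewrite phil//; near: y; exact: lt_nbhsl.
  split.
    by apply: (@near_eq_derivable R R^o R^o _ _ x 1 E); exact: derivable_cst.
  rewrite derive1E -(@near_eq_derive R R^o R^o _ _ x 1 E) derive_cst rho0//.
  by rewrite in_itv/= negb_and -!ltNge xs.
exists phi; last by move=> x; have [] := dphi x.
split; first by move=> x; have [] := dphi x.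
  have -> : derive1 phi = rho by apply/funext => x; have [] := dphi x.
  exact: crho.
exists s, t; split => // x; rewrite in_itv/= negb_and -!ltNge.
by case/orP => [/phil|/phir].
Unshelve. all: by end_near. Qed.

(** Slope [n] at both ends, cut at height 1: the approximation of the indicator is from inside, so
    the support stays in [[s, t]]. *)
Definition trapezoid s t (n : nat) x : R :=
  Num.min 1 (Num.max 0 (n%:R * Num.min (x - s) (t - x))).

Lemma trapezoid_continuous s t n : continuous (trapezoid s t n).
Proof.
have c1 : continuous (fun x : R => Num.min (x - s) (t - x)).
  move=> x; apply: (@continuous_min _ _ (fun x => x - s) (fun x => t - x)).
    by apply: cvgB; [exact: cvg_id|exact: cvg_cst].
  by apply: cvgB; [exact: cvg_cst|exact: cvg_id].
move=> x; apply: (@continuous_min _ _ (cst 1)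
  (fun x => Num.max 0 (n%:R * Num.min (x - s) (t - x)))); first exact: cvg_cst.
apply: (@continuous_max _ _ (cst 0) (fun x => n%:R * Num.min (x - s) (t - x))).
  exact: cvg_cst.
by apply: cvgM; [exact: cvg_cst|exact: c1].
Qed.

Lemma trapezoid_bnd s t n x : 0 <= trapezoid s t n x <= 1.
Proof. by rewrite /trapezoid le_min ler01/= le_max lexx/= ge_min lexx. Qed.

Lemma trapezoid_out s t n x : x \notin `[s, t] -> trapezoid s t n x = 0.
Proof.
rewrite in_itv/= negb_and -!ltNge => H; rewrite /trapezoid.
rewrite max_l; first by rewrite min_r.
rewrite mulr_ge0_le0// ge_min !subr_le0.
by case/orP: H => /ltW ->; rewrite ?orbT.
Qed.

Lemma trapezoid_cvg s t x : s < x < t -> trapezoid s t n x @[n --> \oo] --> (1 : R).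
Proof.
move=> /andP[sx xt]; apply: cvg_near_cst.
pose m := Num.min (x - s) (t - x).
have m0 : 0 < m by rewrite lt_min !subr_gt0 sx.
exists (Num.truncn m^-1).+1 => // n /= nn; rewrite /trapezoid -/m.
have nm : 1 <= n%:R * m.
  rewrite -ler_pdivrMr// div1r (le_trans (ltW (truncnS_gt m^-1)))//.
  by rewrite ler_nat.
by rewrite max_r ?(le_trans ler01 nm)// min_l.
Qed.

Lemma trapezoid_integral_cvg s t h : itg `[s, t] h ->
  \int[mu]_(x in `[s, t]) (h x * trapezoid s t n x) @[n --> \oo] -->
  \int[mu]_(x in `[s, t]) h x.
Proof.
move=> ih.
have mh := itg_measurable ih.
have mT n : measurable_fun `[s, t] (trapezoid s t n).
  by apply: in_continuous_measurable => x _; exact: trapezoid_continuous.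
have [] := @dominated_convergence _ _ _ mu `[s, t] (measurable_itv _)
  (fun n x => (h x * trapezoid s t n x)%:E) (fun x => (h x)%:E) (fun x => `|h x|%:E).
- by move=> n; apply/measurable_EFinP; apply: measurable_funM; [exact: mh|exact: mT].
- exact/measurable_EFinP.
- exists [set s; t]; split.
  + by apply: measurableU; exact: measurable_set1.
  + apply: countable_lebesgue_measure0; exact: finite_set_countable.
  + move=> x /= /not_implyP[]; rewrite in_itv/= => /andP[sx xt] H.
    apply: contrapT => /not_orP[xs' xt']; apply: H.
    apply/fine_cvgP; split; first exact: nearW.
    rewrite -[X in _ --> X]mulr1; apply: cvgMr; apply: trapezoid_cvg.
    by rewrite !lt_neqAle sx xt !andbT; apply/andP; split; apply/eqP => // E; apply: xs'.
- exact: itg_abs.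
- apply: aeW => x n _; rewrite /= lee_fin normrM.
  have /andP[T0 T1] := trapezoid_bnd s t n x.
  by rewrite (ger0_norm T0) ler_piMr.
move=> _ _.
rewrite -[X in _ --> X -> _]fineK; last exact: integrable_fin_num.
by move=> /fine_cvgP[_].
Qed.

(* du Bois-Reymond: [f - G] is orthogonal to every continuous [rho] of integral 0;
   trapezoids approximate the indicators of intervals. *)
Lemma weak_derivative_primitive a b f g : locally_int a b f -> locally_int a b g ->
  weak_derivative a b f g ->
  exists2 F, primitive a b F g & {ae mu, forall x, x \in `]a, b[ -> f x = F x}.
Proof.
move=> fi gi wf; have [ab|ba] := ltP a b; last first.
  have [G pG] := exists_primitive gi; exists G => //.
  by apply: aeW => x; rewrite in_itv/= => /andP[ax xb]; lra.
have [G pG] := exists_primitive gi.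
have wG := weak_derivative_of_primitive pG.
have cG := primitive_continuous pG.
have Gi : locally_int a b G.
  move=> c d ac db; apply: itg_cont => x; rewrite in_itv/= => /andP[cx xd].
  by apply: cG; rewrite in_itv/= (lt_le_trans ac cx) (le_lt_trans xd db).
pose h x := f x - G x.
have hi : locally_int a b h by move=> c d ac db; apply: itgB; [|exact: fi|exact: Gi].
have K s t (rho : R -> R) : a < s -> s <= t -> t < b -> continuous rho ->
    (forall x, x \notin `[s, t] -> rho x = 0) ->
    \int[mu]_(x in `[s, t]) rho x = 0 ->
    \int[mu]_(x in `[s, t]) (h x * rho x) = 0.
  move=> as_ st tb crho rho0 irho.
  have [phi tphi phiE] := exists_test_function as_ st tb crho rho0 irho.
  have mi u : locally_int a b u -> itg `[s, t] (fun x => u x * rho x).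
    move=> iu; have := @itg_contM _ s t rho u (fun x _ => crho x) (iu _ _ as_ tb).
    by congr (integrable _ _ _); apply/funext => x /=; rewrite mulrC.
  have E u : \int[mu]_(x in `]a, b[) (u x * derive1 phi x) =
      \int[mu]_(x in `[s, t]) (u x * rho x).
    rewrite (@Rintegral_support _ _ `[s, t])//.
    - by apply: eq_Rintegral => x _; rewrite phiE.
    - by apply: subset_itv; rewrite bnd_simp.
    - by move=> x _ /negP xst; rewrite phiE rho0// mulr0.
  have := wf _ tphi; have := wG _ tphi; rewrite !E => <- EF.
  have -> : \int[mu]_(x in `[s, t]) (h x * rho x) =
      \int[mu]_(x in `[s, t]) (f x * rho x - G x * rho x).
    by apply: eq_Rintegral => x _; rewrite mulrBl.
  by rewrite RintegralB//; [rewrite EF subrr|exact: mi..].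
pose m := (a + b) / 2; pose q := (m + b) / 2.
have [am mq qb] : [/\ a < m, m < q & q < b] by rewrite /q /m; split; lra.
pose Tz s t n := trapezoid s t n.
pose I s t n := \int[mu]_(x in `[s, t]) Tz s t n x.
pose Ih s t n := \int[mu]_(x in `[s, t]) (h x * Tz s t n x).
have Icvg s t : s <= t -> I s t n @[n --> \oo] --> t - s.
  move=> st; have := trapezoid_integral_cvg (itg_cst s t 1).
  rewrite Rintegral_itv_cst// mul1r; apply: cvg_trans; apply: near_eq_cvg.
  by apply: nearW => n; apply: eq_Rintegral => x _; rewrite mul1r.
have key s t n k : a < s -> s <= t -> t < b ->
    Ih s t n * I m q k = Ih m q k * I s t n.
  move=> as_ st tb.
  pose s' := Num.min s m; pose t' := Num.max t q.
  have as' : a < s' by rewrite lt_min as_.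
  have tb' : t' < b by rewrite gt_max tb.
  have ss' : s' <= s by rewrite ge_min lexx.
  have sm' : s' <= m by rewrite ge_min lexx orbT.
  have tt' : t <= t' by rewrite le_max lexx.
  have qt' : q <= t' by rewrite le_max lexx orbT.
  have st' : s' <= t' by rewrite (le_trans ss')// (le_trans st).
  (* This combination of two trapezoids has integral zero, hence is admissible in [K]; [[m, q]]
     serves as a fixed reference interval. *)
  pose rho x := I m q k * Tz s t n x - I s t n * Tz m q k x.
  have cT u v l : continuous (Tz u v l) by exact: trapezoid_continuous.
  have crho : continuous rho.
    by move=> x; apply: cvgB; apply: cvgM; [exact: cvg_cst|exact: cT|exact: cvg_cst|exact: cT].
  have out u v l x : s' <= u -> v <= t' -> x \notin `[s', t'] -> Tz u v l x = 0.
    move=> su vt; rewrite in_itv/= negb_and -!ltNge => H; apply: trapezoid_out.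
    by rewrite in_itv/= negb_and -!ltNge; case/orP: H => H; apply/orP; [left|right]; lra.
  have rho0 x : x \notin `[s', t'] -> rho x = 0.
    by move=> H; rewrite /rho !out// !mulr0 subrr.
  have ext u v l w : s' <= u -> v <= t' ->
      \int[mu]_(x in `[s', t']) (w x * Tz u v l x) =
      \int[mu]_(x in `[u, v]) (w x * Tz u v l x).
    move=> su vt; apply: Rintegral_support => //.
      by apply: subset_itv; rewrite bnd_simp.
    by move=> x _ /negP H; rewrite /Tz trapezoid_out// mulr0.
  have iT w u v l : itg `[s', t'] w -> itg `[s', t'] (fun x => w x * Tz u v l x).
    move=> iw; have := @itg_contM _ s' t' (Tz u v l) w (fun x _ => cT u v l x) iw.
    by congr (integrable _ _ _); apply/funext => x /=; rewrite mulrC.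
  have lin w : itg `[s', t'] w ->
      \int[mu]_(x in `[s', t']) (w x * rho x) =
      I m q k * (\int[mu]_(x in `[s, t]) (w x * Tz s t n x)) -
      I s t n * (\int[mu]_(x in `[m, q]) (w x * Tz m q k x)).
    move=> iw; rewrite -(ext s t n w)// -(ext m q k w)//.
    rewrite -!RintegralZl//; [|exact: iT..].
    rewrite -RintegralB//; [|by apply: itgZ => //; exact: iT..].
    by apply: eq_Rintegral => x _; rewrite /rho; ring.
  have I1 u v l : \int[mu]_(x in `[u, v]) (cst 1 x * Tz u v l x) = I u v l.
    by apply: eq_Rintegral => x _; rewrite mul1r.
  have r0 : \int[mu]_(x in `[s', t']) rho x = 0.
    have := lin (cst 1) (itg_cst _ _ 1); rewrite !I1 [I s t n * _]mulrC subrr => <-.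
    by apply: eq_Rintegral => x _; rewrite mul1r.
  have := K s' t' rho as' st' tb' crho rho0 r0.
  rewrite lin; last exact: hi.
  by rewrite -/(Ih s t n) -/(Ih m q k) => /eqP; rewrite subr_eq0 => /eqP; rewrite [I m q k * _]mulrC [I s t n * _]mulrC.
(* The constant by which [f] and [G] differ is read off as the mean of [h] over the reference
   interval. *)
pose C := (\int[mu]_(x in `[m, q]) h x) / (q - m).
have lim s t : a < s -> s <= t -> t < b ->
    \int[mu]_(x in `[s, t]) h x = C * (t - s).
  move=> as_ st tb.
  have ihst := hi _ _ as_ tb; have ihmq := hi _ _ am qb.
  have L1 n : Ih s t n * (q - m) = (\int[mu]_(x in `[m, q]) h x) * I s t n.
    have A1 : Ih s t n * I m q k @[k --> \oo] --> Ih s t n * (q - m).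
      by apply: cvgM; [exact: cvg_cst|apply: Icvg; exact: ltW].
    have A2 : Ih m q k * I s t n @[k --> \oo] --> (\int[mu]_(x in `[m, q]) h x) * I s t n.
      by apply: cvgM; [exact: trapezoid_integral_cvg|exact: cvg_cst].
    apply: (cvg_unique _ A1) => //.
    by apply: cvg_trans A2; apply: near_eq_cvg; apply: nearW => k; rewrite key.
  have A1 : Ih s t n * (q - m) @[n --> \oo] --> (\int[mu]_(x in `[s, t]) h x) * (q - m).
    by apply: cvgM; [exact: trapezoid_integral_cvg|exact: cvg_cst].
  have A2 : (\int[mu]_(x in `[m, q]) h x) * I s t n @[n --> \oo] -->
      (\int[mu]_(x in `[m, q]) h x) * (t - s).
    by apply: cvgM; [exact: cvg_cst|exact: Icvg].
  have E : (\int[mu]_(x in `[s, t]) h x) * (q - m) =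
      (\int[mu]_(x in `[m, q]) h x) * (t - s).
    apply: (cvg_unique _ A1) => //.
    by apply: cvg_trans A2; apply: near_eq_cvg; apply: nearW => n; rewrite L1.
  rewrite /C mulrAC -E mulfK// subr_eq0; apply/eqP => qm; move: mq; rewrite qm ltxx.
  by [].
exists (fun x => G x + C).
  split=> // s t as_ st tb; have [_ HG] := pG.
  by rewrite -HG//; lra.
have : {ae mu, forall x, x \in `]a, b[ -> h x - C = 0}.
  apply: ae_eq0_of_locally_integral0.
    by move=> c d ac db; apply: itgB => //; [exact: hi|exact: itg_cst].
  move=> s t as_ st tb; rewrite RintegralB//; [|exact: hi|exact: itg_cst].
  by rewrite lim// Rintegral_itv_cst// subrr.
apply: filterS; first exact: (ae_filter_ringOfSetsType mu).
by move=> x H /H; rewrite /h; lra.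
Qed.

End weak_derivatives.

(** * Classical regularity from weak derivatives *)

Section sobolev_regularity.
Context {R : realType}.
Local Notation mu := (@lebesgue_measure R).
Implicit Types (f g h u v : R -> R) (a b c d s t x : R) (D : set R).
Local Notation itg D f := (mu.-integrable D (EFin \o f)).

Lemma continuous_ae_eq a b u v : {in `]a, b[, continuous u} ->
  {in `]a, b[, continuous v} -> {ae mu, forall x, x \in `]a, b[ -> u x = v x} ->
  forall x, x \in `]a, b[ -> u x = v x.
Proof.
move=> cu cv [N [mN N0 sub]] x xab; apply: contrapT => uv.
have nuv : 0 < `|u x - v x| by rewrite normr_gt0 subr_eq0; exact/eqP.
have cuv : {for x, continuous (fun y => `|u y - v y|)}.
  apply: (@continuous_comp _ _ _ (fun y => u y - v y) Num.norm).
    by apply: cvgB; [exact: cu|exact: cv].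
  exact: norm_continuous.
have n1 : \forall y \near x, 0 < `|u y - v y| by exact: (cvgr_gt _ cuv).
have n2 : \forall y \near x, y \in `]a, b[ by exact: near_in_itvoo.
have n3 : nbhs x ([set y | 0 < `|u y - v y|] `&` [set y | y \in `]a, b[]).
  exact: filterI n1 n2.
have [e /= e0 He] := (nbhs_ballP _ _).1 n3.
have sub' : `]x - e, x + e[ `<=` N.
  move=> y /= yI; apply: sub => /= H.
  have /He [h1 h2] : ball x e y by rewrite ball_itv.
  by move: h1; rewrite /= (H h2) subrr normr0 ltxx.
have : (mu (`](x - e)%R, (x + e)%R[%classic : set R) <= mu N)%E by apply: le_measure; rewrite ?inE.
rewrite [leRHS]N0 [leLHS](@lebesgue_measure_itv R `]x - e, x + e[)/= lte_fin.
by case: ifPn => [h|/negP[]]; rewrite ?lee_fin; lra.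
Qed.

Lemma Rintegral_ae_eq D u v : measurable D -> measurable_fun D u -> measurable_fun D v ->
  {ae mu, forall x, D x -> u x = v x} ->
  \int[mu]_(x in D) u x = \int[mu]_(x in D) v x.
Proof.
move=> mD mu_ mv uv; congr fine; apply: ae_eq_integral => //.
- exact/measurable_EFinP.
- exact/measurable_EFinP.
apply: filterS uv; first exact: (ae_filter_ringOfSetsType mu).
by move=> x H /H ->.
Qed.

Lemma integrable_ae_eq D u v : measurable D -> itg D u -> measurable_fun D v ->
  {ae mu, forall x, D x -> u x = v x} -> itg D v.
Proof.
move=> mD /integrableP[mu_ iu] mv uv; apply/integrableP; split.
  exact/measurable_EFinP.
rewrite (@ae_eq_integral _ _ _ mu D (fun x => `|(u x)%:E|)%E)//.
- by apply: measurableT_comp => //; exact/measurable_EFinP.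
- exact: measurableT_comp.
apply: filterS uv; first exact: (ae_filter_ringOfSetsType mu).
by move=> x H /H ->.
Qed.

Lemma eq_primitive a b f f' g : (forall x, x \in `]a, b[ -> f x = f' x) ->
  primitive a b f g -> primitive a b f' g.
Proof.
move=> E [gi H]; split=> // s t as_ st tb.
by rewrite -!E ?H// in_itv/= ?as_ ?(le_lt_trans st tb)// tb (lt_le_trans as_ st).
Qed.

Lemma primitive_ae_eq a b f g g' : locally_int a b g' ->
  {ae mu, forall x, x \in `]a, b[ -> g x = g' x} ->
  primitive a b f g -> primitive a b f g'.
Proof.
move=> ig' E [gi H]; split=> // s t as_ st tb; rewrite H//.
apply: Rintegral_ae_eq => //.
- by apply: itg_measurable; exact: gi.
- by apply: itg_measurable; exact: ig'.
apply: filterS E; first exact: (ae_filter_ringOfSetsType mu).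
move=> x H' /=; rewrite in_itv/= => /andP[sx xt]; apply: H'.
by rewrite in_itv/= (lt_le_trans as_ sx) (le_lt_trans xt tb).
Qed.

Lemma continuous_locally_int a b f : {in `]a, b[, continuous f} -> locally_int a b f.
Proof.
move=> cf s t as_ tb; apply: itg_cont => x; rewrite in_itv/= => /andP[sx xt].
by apply: cf; rewrite in_itv/= (lt_le_trans as_ sx) (le_lt_trans xt tb).
Qed.

(** A primitive [G] of [h] agrees almost everywhere with [g] and is continuous, so [f] is a
    primitive of a continuous function, hence C^1 with derivative [G]. *)
Lemma weak_derivative2_regular a b f g h : {in `]a, b[, continuous f} ->
  locally_int a b g -> locally_int a b h ->
  weak_derivative a b f g -> weak_derivative a b g h ->
  [/\ {in `]a, b[, continuous (derive1 f)},
      forall x, x \in `]a, b[ -> derivable f x 1,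
      {ae mu, forall x, x \in `]a, b[ -> g x = derive1 f x} &
      primitive a b (derive1 f) h].
Proof.
move=> cf ig ih wf wg.
have [G pG gG] := weak_derivative_primitive ig ih wg.
have cG := primitive_continuous pG.
have [F pF fF] := weak_derivative_primitive (continuous_locally_int cf) ig wf.
have cF := primitive_continuous pF.
have fFE := continuous_ae_eq cf cF fF.
have pf : primitive a b f g by apply: eq_primitive pF => x xab; rewrite fFE.
have pf' : primitive a b f G.
  exact: primitive_ae_eq (continuous_locally_int cG) gG pf.
have df x : x \in `]a, b[ -> is_derive x 1 f (G x).
  by move=> xab; apply: (primitive_is_derive pf' xab); exact: cG.
have dE x : x \in `]a, b[ -> derive1 f x = G x.
  by move=> /df [_ <-]; rewrite derive1E.
split.
- move=> x xab; rewrite /prop_for /continuous_at dE//.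
  have E : \forall y \near x, G y = derive1 f y.
    by have := near_in_itvoo xab; apply: filterS => y /dE.
  by apply: cvg_trans (cG _ xab); apply: near_eq_cvg; apply: filterS E => y ->.
- by move=> x /df [].
- apply: filterS gG; first exact: (ae_filter_ringOfSetsType mu).
  by move=> x H xab; rewrite H// dE.
- by apply: eq_primitive pG => x /dE.
Qed.

Lemma wderivP a b f h : locally_int a b h -> weak_derivative a b f h ->
  locally_int a b (wderiv a b f) /\ weak_derivative a b f (wderiv a b f).
Proof.
move=> ih wh; rewrite /wderiv; case: xgetP => [y -> [/Lp_loc1P]//|H].
by case: (H h); split => //; exact/Lp_loc1P.
Qed.

Lemma constant_extension u (K : R) a b : a < b -> {within `[a, b], continuous u} ->
  (forall x, x \in `]a, b[ -> u x = K) -> u a = K /\ u b = K.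
Proof.
move=> ab /(continuous_within_itvP _ ab)[_ ua ub] uK; split.
- apply: (cvg_unique _ ua) => //; apply: cvg_near_cst; near=> y.
  by rewrite uK// in_itv/=; apply/andP; split; near: y;
    [exact: nbhs_right_gt|exact: nbhs_right_lt].
- apply: (cvg_unique _ ub) => //; apply: cvg_near_cst; near=> y.
  by rewrite uK// in_itv/=; apply/andP; split; near: y;
    [exact: nbhs_left_gt|exact: nbhs_left_lt].
Unshelve. all: by end_near. Qed.

(** [f] minus the indefinite integral of [f'] is constant inside and continuous up to the ends. Weak
    derivatives see only the open interval, whereas the curve is prescribed at its end points. *)
Lemma primitive_closed f f' a b : a < b -> {within `[a, b], continuous f} ->
  itg `]a, b[ f' -> primitive a b f f' ->
  forall s t, a <= s -> s <= t -> t <= b -> f t - f s = \int[mu]_(x in `]s, t[) f' x.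
Proof.
move=> ab cf if' [_ H].
pose g := f' \_ `]a, b[.
have ig : itg `[a, b] g.
  rewrite /g -restrict_EFin; apply/integrable_restrict => //.
  apply: itgS if' => //; first exact: measurableI.
have cF := parameterized_integral_continuous (ltW ab) ig.
pose F x := parameterized_integral mu a x g.
have oc s t : a <= s -> t <= b -> \int[mu]_(x in `[s, t]) g x = \int[mu]_(x in `]s, t[) f' x.
  move=> as_ tb.
  have i1 : itg `[s, t] g by exact: itg_itvS ig.
  rewrite -Rintegral_itv_obnd_cbnd; last by apply: itgS i1 => //; apply: subset_itvr; rewrite bnd_simp.
  rewrite -Rintegral_itv_bndo_bndc; last by apply: itgS i1 => //; apply: subset_itv; rewrite bnd_simp.
  apply: eq_Rintegral => x; rewrite inE/= in_itv/= => /andP[sx xt].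
  by rewrite /g patchE mem_set//= in_itv/= (le_lt_trans as_ sx) (lt_le_trans xt tb).
have FD s t : a <= s -> s <= t -> t <= b -> F t - F s = \int[mu]_(x in `]s, t[) f' x.
  move=> as_ st tb; rewrite -oc// /F /parameterized_integral.
  by apply: Rintegral_itv_diff => //; exact: itg_itvS ig.
have cu : {within `[a, b], continuous (fun x => f x - F x)}.
  by move=> x; apply: cvgB; [exact: cf|exact: cF].
pose m := (a + b) / 2.
have [am mb] : a < m /\ m < b by rewrite /m; split; lra.
have cc x : x \in `]a, b[ -> f x - F x = f m - F m.
  rewrite in_itv/= => /andP[ax xb].
  have E s t : a < s -> s <= t -> t < b -> f t - f s = F t - F s.
    move=> as_ st tb; rewrite H// FD ?(ltW as_) ?(ltW tb)// -oc ?(ltW as_) ?(ltW tb)//.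
    apply: eq_Rintegral => y; rewrite inE/= in_itv/= => /andP[sy yt].
    by rewrite /g patchE mem_set//= in_itv/= (lt_le_trans as_ sy) (le_lt_trans yt tb).
  have [xm|mx] := leP x m; first by have := E x m ax xm mb; lra.
  by have := E m x am (ltW mx) xb; lra.
have [ua ub] := constant_extension ab cu cc.
have all x : a <= x -> x <= b -> f x - F x = f m - F m.
  rewrite le_eqVlt => /predU1P[<- //|ax]; rewrite le_eqVlt => /predU1P[-> //|xb].
  by apply: cc; rewrite in_itv/= ax.
move=> s t as_ st tb; rewrite -FD//.
have := all s as_ (le_trans st tb); have := all t (le_trans as_ st) tb; lra.
Qed.

End sobolev_regularity.

(** * The tangent angle *)

Section angle.
Context {R : realType}.
Local Notation mu := (@lebesgue_measure R).
Local Notation itg D f := (mu.-integrable D (EFin \o f)).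
Implicit Types (p q x y : R).

(* The half-angle formula has no pole at vertical directions, unlike [atan (q / p)]. *)
Definition dir_angle p q : R := 2 * atan (q / (Num.sqrt (p ^+ 2 + q ^+ 2) + p)).

(** Here [w] is the tangent of half the angle, and the square of the cosine of half the angle is (s
    + p) / (2 s); the rest is the double angle formulas. Since p >= 0, |q| <= s + p, so |w| <= 1 and
    the angle is at most pi/2 in absolute value. *)
Lemma dir_angle_cos_sin p q : 0 <= p -> 0 < Num.sqrt (p ^+ 2 + q ^+ 2) ->
  [/\ cos (dir_angle p q) = p / Num.sqrt (p ^+ 2 + q ^+ 2),
      sin (dir_angle p q) = q / Num.sqrt (p ^+ 2 + q ^+ 2) &
      - (pi / 2) <= dir_angle p q <= pi / 2].
Proof.
move=> p0; set s := Num.sqrt _ => s0.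
have s2 : s ^+ 2 = p ^+ 2 + q ^+ 2 by rewrite sqr_sqrtr// addr_ge0 ?sqr_ge0.
have sp : 0 < s + p by rewrite ltr_wpDr.
have s_n0 : s != 0 by rewrite gt_eqF.
have sp_n0 : s + p != 0 by rewrite gt_eqF.
set w := q / (s + p).
have w2 : 1 + w ^+ 2 = 2 * s / (s + p).
  have -> : 1 + w ^+ 2 = ((s + p) ^+ 2 + q ^+ 2) / (s + p) ^+ 2.
    by rewrite /w; field; lra.
  have -> : (s + p) ^+ 2 + q ^+ 2 = 2 * s * (s + p).
    by have -> : q ^+ 2 = s ^+ 2 - p ^+ 2; [rewrite s2; ring|ring].
  by field; lra.
have w2_gt0 : 0 < 1 + w ^+ 2 by rewrite w2 divr_gt0// mulr_gt0.
have c2 : cos (atan w) ^+ 2 = (s + p) / (2 * s).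
  rewrite cos_atan exprVn sqr_sqrtr; last exact: ltW.
  by rewrite w2 invf_div.
have cn0 : cos (atan w) != 0.
  by rewrite cos_atan invr_eq0 sqrtr_eq0 -ltNge.
have sE : sin (atan w) = w * cos (atan w).
  have E : sin (atan w) / cos (atan w) = w by exact: atanK.
  by rewrite -[X in X * _]E divfK.
rewrite /dir_angle -/s -/w mulrC mulr_natr; split.
- by rewrite cos_mulr2n c2; field; rewrite ?s_n0 ?sp_n0.
- by rewrite sin_mulr2n sE mulrCA -expr2 c2 /w; field; rewrite ?s_n0 ?sp_n0.
- have w1 : -1 <= w <= 1.
    have qs : `|q| <= s + p.
      apply: (@le_trans _ _ s); last lra.
      rewrite -(@ler_pXn2r _ 2)// ?nnegrE// ?(ltW s0)// real_normK ?num_real// s2.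
      by rewrite lerDr sqr_ge0.
    rewrite /w ler_pdivlMr// ler_pdivrMr// mulN1r mul1r -ler_norml//.
  have [h1 h2] := andP w1.
  have a1 : atan w <= pi / 4 by rewrite -atan1; exact: le_atan.
  have a2 : - (pi / 4) <= atan w by rewrite -atan1 -atanN; exact: le_atan.
  have E : (pi / 2 : R) = pi / 4 + pi / 4 by field.
  by rewrite mulr2n E opprD; apply/andP; split; apply: lerD.
Qed.

Lemma sin_lower_bound (e : R) : 0 < e ->
  exists2 d, 0 < d & forall x, `|x| < d -> `|x| <= (1 + e) * `|sin x|.
Proof.
move=> e0.
have c0 : (1 + e)^-1 < cos (0 : R) by rewrite cos0 invf_lt1; lra.
have n0 : \forall y \near (0 : R), (1 + e)^-1 < cos y.
  exact: (cvgr_gt _ (@continuous_cos R 0)).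
have [d /= d0 Hd] := (nbhs_ballP _ _).1 n0.
exists d => //.
suff pos x : 0 <= x -> x < d -> x <= (1 + e) * `|sin x|.
  move=> x; have [x0|x0] := leP 0 x.
    by rewrite (ger0_norm x0); exact: pos.
  by rewrite (ltr0_norm x0) => xd; have := pos (- x); rewrite sinN normrN; apply; lra.
move=> x0 xd.
have [c cI E] := @MVT_segment R sin cos 0 x x0 (fun y _ => is_derive_sin y)
  (in_continuous_within (fun y _ => @continuous_sin R y)).
move: E; rewrite sin0 !subr0 => ->.
have := cI; rewrite in_itv/= => /andP[c1 c2].
have : (1 + e)^-1 < cos c.
  by apply: Hd; rewrite /ball/= sub0r normrN ger0_norm//; exact: le_lt_trans xd.
rewrite -[(1 + e)^-1]mul1r ltr_pdivrMr; last lra.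
move=> H; have e1 : 0 < 1 + e by lra.
have cp : 0 < cos c by rewrite -(pmulr_lgt0 _ e1) (lt_trans ltr01 H).
rewrite normrM (ger0_norm x0) (gtr0_norm cp) mulrA ler_peMl//.
by rewrite mulrC ltW.
Qed.

Section angle_increment.
Variables (v1 v2 e1 e2 : R -> R) (e0 : R).
Hypotheses (e00 : 0 < e0) (pv1 : primitive 0 1 v1 e1) (pv2 : primitive 0 1 v2 e2)
  (v10 : forall t, t \in `]0, 1[ -> 0 <= v1 t)
  (spd_gt : forall t, t \in `]0, 1[ -> e0 < Num.sqrt (v1 t ^+ 2 + v2 t ^+ 2)).

Definition spd t := Num.sqrt (v1 t ^+ 2 + v2 t ^+ 2).
Definition angle t := dir_angle (v1 t) (v2 t).
(* [turning] is the absolute value of the derivative of [angle]. *)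
Definition turning t := `|v1 t * e2 t - v2 t * e1 t| / spd t ^+ 2.

Lemma spd_gt0 t : t \in `]0, 1[ -> 0 < spd t.
Proof. by move=> /spd_gt; exact: lt_trans. Qed.

Lemma angle_cos_sin t : t \in `]0, 1[ ->
  [/\ cos (angle t) = v1 t / spd t, sin (angle t) = v2 t / spd t &
      - (pi / 2) <= angle t <= pi / 2].
Proof. by move=> tI; apply: dir_angle_cos_sin; [exact: v10|exact: spd_gt0]. Qed.

Let cv1 := primitive_continuous pv1.
Let cv2 := primitive_continuous pv2.

Lemma spd_continuous : {in `]0, 1[, continuous spd}.
Proof.
move=> t tI; apply: (@continuous_comp _ _ _ (fun t => v1 t ^+ 2 + v2 t ^+ 2) Num.sqrt).
  apply: cvgD; rewrite expr2; under eq_fun do rewrite expr2.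
    by apply: cvgM; exact: cv1.
  by apply: cvgM; exact: cv2.
exact: sqrt_continuous.
Qed.

Lemma spdV_continuous : {in `]0, 1[, continuous (fun t => (spd t)^-1)}.
Proof.
move=> t tI; apply: cvgV; last exact: spd_continuous.
by rewrite gt_eqF// spd_gt0.
Qed.

Lemma angle_continuous : {in `]0, 1[, continuous angle}.
Proof.
move=> t tI; apply: cvgM; first exact: cvg_cst.
apply: (@continuous_comp _ _ _ (fun t => v2 t / (spd t + v1 t)) atan).
  apply: cvgM; first exact: cv2.
  apply: cvgV; first by rewrite gt_eqF// ltr_wpDr ?spd_gt0// v10.
  by apply: cvgD; [exact: spd_continuous|exact: cv1].
exact: continuous_atan.
Qed.

Lemma turning_ge0 t : 0 <= turning t.
Proof. by rewrite mulr_ge0// invr_ge0 sqr_ge0. Qed.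

Lemma turning_locally_int : locally_int 0 1 turning.
Proof.
move=> s t s0 t1.
have i12 : itg `[s, t] (fun x => v1 x * e2 x - v2 x * e1 x).
  apply: itgB => //; apply: itg_contM.
  - by move=> x /(itvcc_oo s0 t1); exact: cv1.
  - exact: pv2.1.
  - by move=> x /(itvcc_oo s0 t1); exact: cv2.
  - exact: pv1.1.
have cV : {in `[s, t], continuous (fun x => (spd x)^-1 * (spd x)^-1)}.
  by move=> x /(itvcc_oo s0 t1) xI; apply: cvgM; exact: spdV_continuous.
have := @itg_contM _ s t _ (fun x => `|v1 x * e2 x - v2 x * e1 x|) cV (itg_abs _ i12).
move=> /(_ (measurable_itv _)); congr (integrable _ _ _); apply/funext => x /=.
by rewrite /turning mulrC expr2 invfM.
Qed.

(* The sine of a small increment of the angle is the cross product of the unit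
   tangents, which estimates the increment up to a factor arbitrarily close to 1. *)
Lemma angle_increment s t : 0 < s -> s <= t -> t < 1 ->
  `|angle t - angle s| <= \int[mu]_(x in `[s, t]) turning x.
Proof.
move=> s0 st t1.
have i1 p q : s <= p -> q <= t -> itg `[p, q] e1.
  by move=> sp qt; apply: pv1.1; [exact: lt_le_trans sp|exact: le_lt_trans t1].
have i2 p q : s <= p -> q <= t -> itg `[p, q] e2.
  by move=> sp qt; apply: pv2.1; [exact: lt_le_trans sp|exact: le_lt_trans t1].
have ik p q : s <= p -> q <= t -> itg `[p, q] turning.
  by move=> sp qt; apply: turning_locally_int; [exact: lt_le_trans sp|exact: le_lt_trans t1].
pose m x := `|e1 x| + `|e2 x|.
have im p q : s <= p -> q <= t -> itg `[p, q] m.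
  by move=> sp qt; apply: itgD => //; apply: itg_abs => //; [exact: i1|exact: i2].
have main e : 0 < e -> `|angle t - angle s| <=
    (1 + e) * \int[mu]_(x in `[s, t]) (turning x + e * m x).
  move=> e0'.
  have iQ p q : s <= p -> q <= t -> itg `[p, q] (fun x => turning x + e * m x).
    by move=> sp qt; apply: itgD => //; [exact: ik|apply: itgZ => //; exact: im].
  have := @local_increment_le R angle
    (fun x => (1 + e) * \int[mu]_(y in `[s, x]) (turning y + e * m y)) s t st.
  rewrite set_itv1 Rintegral_set1 mulr0 subr0; apply => x xst.
  have xI : x \in `]0, 1[ by apply: itvcc_oo s0 t1 _; rewrite in_itv.
  have [d1 d10 Hd1] := sin_lower_bound e0'.
  (* In [coef] the two errors are multiplied by factors bounded by [e0^-1] and 1, so tolerances of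
     [e / B] add up to exactly [e]. *)
  pose B := e0^-1 + 1; have B0 : 0 < B by rewrite ltr_wpDl// invr_ge0 ltW.
  have eB : 0 < e / B / 2 by rewrite !divr_gt0.
  have d12 : 0 < d1 / 2 by rewrite divr_gt0.
  pose A1 y := v1 y / spd y; pose A2 y := v2 y / spd y; pose V y := (spd y)^-1.
  have cV : {for x, continuous V} by exact: spdV_continuous.
  have cA1 : {for x, continuous A1} by apply: cvgM; [exact: cv1|exact: cV].
  have cA2 : {for x, continuous A2} by apply: cvgM; [exact: cv2|exact: cV].
  have /cvgrPdist_lt /(_ _ d12) n1 := angle_continuous xI.
  have /cvgrPdist_lt /(_ _ eB) n2 := cV.
  have /cvgrPdist_lt /(_ _ eB) n3 := cA1.
  have /cvgrPdist_lt /(_ _ eB) n4 := cA2.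
  have nn : \forall y \near x, (`|angle x - angle y| < d1 / 2 /\ `|V x - V y| < e / B / 2) /\
      (`|A1 x - A1 y| < e / B / 2 /\ `|A2 x - A2 y| < e / B / 2).
    exact: filterI (filterI n1 n2) (filterI n3 n4).
  have [d /= d0 Hd] := (nbhs_ballP _ _).1 nn.
  exists d => // p q sp px xq qt xp qx.
  have pq := le_trans px xq.
  have inpq y : y \in `[p, q] -> [/\ `|angle x - angle y| < d1 / 2,
      `|V x - V y| < e / B / 2, `|A1 x - A1 y| < e / B / 2 & `|A2 x - A2 y| < e / B / 2].
    rewrite in_itv/= => /andP[py yq].
    have xdy : ball x d y by rewrite /ball/= ltr_distl; apply/andP; split; lra.
    by have [[? ?] [? ?]] := Hd y xdy; split.
  have pI : p \in `[p, q] by rewrite in_itv/= lexx.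
  have qI : q \in `[p, q] by rewrite in_itv/= lexx pq.
  have in01 y : y \in `[p, q] -> y \in `]0, 1[.
    by apply: itvcc_oo; [exact: lt_le_trans sp|exact: le_lt_trans t1].
  have V_le y : y \in `[p, q] -> `|V y| <= e0^-1.
    move=> /in01 yI; rewrite /V gtr0_norm ?invr_gt0 ?spd_gt0//.
    by rewrite lef_pV2 ?posrE ?spd_gt0//; exact/ltW/spd_gt.
  have A1_le y : y \in `[p, q] -> `|A1 y| <= 1.
    by move=> /in01 /angle_cos_sin[E _ _]; rewrite /A1 -E ler_norml cos_geN1 cos_le1.
  have A2_le y : y \in `[p, q] -> `|A2 y| <= 1.
    by move=> /in01 /angle_cos_sin[_ E _]; rewrite /A2 -E ler_norml sin_geN1 sin_le1.
  have dist (u : R -> R) (z1 z2 d' : R) : `|u x - u z1| < d' / 2 -> `|u x - u z2| < d' / 2 ->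
      `|u z1 - u z2| <= d'.
    move=> h1 h2; have := ler_normD (u z1 - u x) (u x - u z2).
    by rewrite addrA subrK [`|u z1 - u x|]distrC; lra.
  have [tp Vp A1p A2p] := inpq _ pI; have [tq Vq A1q A2q] := inpq _ qI.
  have d1pq : `|angle q - angle p| < d1.
    have := ler_normD (angle q - angle x) (angle x - angle p).
    by rewrite addrA subrK [`|angle q - angle x|]distrC; lra.
  apply: (le_trans (Hd1 _ d1pq)).
  rewrite [leRHS](_ : _ = (1 + e) * \int[mu]_(y in `[p, q]) (turning y + e * m y)); last first.
    by rewrite -(Rintegral_itv_diff sp pq) ?mulrBr//; exact: iQ.
  rewrite ler_wpM2l//; first lra.
  (* The cross product with the tangent at [p] is unchanged when the velocity at [q] is replaced by
     its increment since [p], which is the integral of [e1] and [e2]. *)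
  have -> : sin (angle q - angle p) =
      \int[mu]_(y in `[p, q]) ((A1 p * V q) * e2 y - (A2 p * V q) * e1 y).
    have [c1 s1 _] := angle_cos_sin (in01 _ pI).
    have [c2 s2 _] := angle_cos_sin (in01 _ qI).
    have p0 := lt_le_trans s0 sp; have q1 := le_lt_trans qt t1.
    rewrite RintegralB//; last 2 first.
      - by apply: itgZ => //; exact: i2.
      - by apply: itgZ => //; exact: i1.
    rewrite !RintegralZl//; [|exact: i1|exact: i2].
    rewrite -(pv1.2 _ _ p0 pq q1) -(pv2.2 _ _ p0 pq q1).
    by rewrite sinB c1 s1 c2 s2 /A1 /A2 /V; ring.
  apply: le_Rintegral_norm.
  - apply: itgB => //; apply: itgZ => //; [exact: i2|exact: i1].
  - exact: iQ.
  move=> y yI; have [_ Vy A1y A2y] := inpq _ yI.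
  have coef (A : R -> R) : (forall z, z \in `[p, q] -> `|A z| <= 1) ->
      `|A x - A p| < e / B / 2 -> `|A x - A y| < e / B / 2 ->
      `|A p * V q - A y * V y| <= e.
    move=> Ale Ap Ay.
    have -> : A p * V q - A y * V y = (A p - A y) * V q + A y * (V q - V y) by ring.
    apply: (le_trans (ler_normD _ _)); rewrite !normrM.
    have eE : e / B * e0^-1 + 1 * (e / B) = e.
      by rewrite mul1r -[X in _ + X]mulr1 -mulrDr -/B divfK// gt_eqF.
    rewrite -[leRHS]eE.
    apply: lerD; apply: ler_pM => //; [exact: dist|exact: V_le|exact: Ale|exact: dist].
  have K1 := coef A1 A1_le A1p A1y; have K2 := coef A2 A2_le A2p A2y.
  have -> : turning y = `|A1 y * V y * e2 y - A2 y * V y * e1 y|.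
    rewrite /turning /A1 /A2 /V -[X in _ / X]gtr0_norm ?exprn_gt0 ?spd_gt0 ?in01//.
    rewrite -normfV -normrM; congr `|_|; field.
    by rewrite gt_eqF// spd_gt0// in01.
  have -> : A1 p * V q * e2 y - A2 p * V q * e1 y =
    (A1 y * V y * e2 y - A2 y * V y * e1 y) +
    ((A1 p * V q - A1 y * V y) * e2 y - (A2 p * V q - A2 y * V y) * e1 y) by ring.
  apply: (le_trans (ler_normD _ _)); rewrite lerD2l.
  apply: (le_trans (ler_normB _ _)); rewrite !normrM /m mulrDr addrC.
  by apply: lerD; rewrite ler_wpM2r.
have iks := ik _ _ (lexx s) (lexx t); have ims := im _ _ (lexx s) (lexx t).
set K := \int[mu]_(x in `[s, t]) turning x.
pose M := \int[mu]_(x in `[s, t]) m x.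
have K0 : 0 <= K by apply: Rintegral_ge0 => x _; exact: turning_ge0.
have M0 : 0 <= M by apply: Rintegral_ge0 => x _; rewrite addr_ge0.
have mainE e : 0 < e -> `|angle t - angle s| <= (1 + e) * (K + e * M).
  by move=> e0'; have := main e e0'; rewrite RintegralD//; [rewrite RintegralZl|exact: itgZ].
rewrite leNgt; apply/negP => KD; set D := `|_| in KD mainE.
(* For e <= 1 the bound (1 + e) (K + e M) is at most K + e (K + 2 M), which this choice keeps below
   [D]. *)
pose e := Num.min 1 ((D - K) / (2 * (K + 2 * M + 1))).
have den : 0 < 2 * (K + 2 * M + 1) by lra.
have e_gt0 : 0 < e by rewrite lt_min ltr01 divr_gt0// subr_gt0.
have e_le1 : e <= 1 by rewrite ge_min lexx.
have e_le : e * (2 * (K + 2 * M + 1)) <= D - K.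
  by rewrite -ler_pdivlMr// ge_min lexx orbT.
have := mainE e e_gt0.
have : e * (e * M) <= 1 * (e * M).
  by apply: ler_wpM2r => //; rewrite mulr_ge0// ltW.
nra.
Qed.

End angle_increment.
End angle.

(** * Change of variables by the abscissa *)

Section monotone_inverse.
Context {R : realType}.
Local Notation mu := (@lebesgue_measure R).
Local Notation itg D f := (mu.-integrable D (EFin \o f)).

Lemma measurable_monotone_in (I : set R) (h : R -> R) : is_interval I ->
  (forall x y, I x -> I y -> x <= y -> h x <= h y) -> measurable_fun I h.
Proof.
move=> II hm; apply: (measurability (@RGenCInfty.G R)) => [|/= _ [_] [r] -> <-].
  exact: RGenCInfty.measurableE.
apply: is_interval_measurable => s t /= [Is]; rewrite !in_itv/= !andbT => rs [It rt].
move=> u /andP[su ut]; have Iu : I u by apply: (II s t) => //; rewrite su.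
by split => //; rewrite in_itv/= andbT (le_trans rs)// hm.
Qed.

Variables (a b : R) (X f : R -> R).
Hypotheses (ab : a < b) (cX : {within `[a, b], continuous X})
  (dX : forall x, x \in `]a, b[ -> is_derive x 1 X (f x))
  (cf : {in `]a, b[, continuous f}) (f0 : forall x, x \in `]a, b[ -> 0 < f x).
Local Notation tau := (inv_on a b X).

Lemma increasing_of_derive s t : a <= s -> s < t -> t <= b -> X s < X t.
Proof.
move=> as_ st tb.
have itvcc_oo : `[s, t] `<=` `[a, b] by apply: subset_itv; rewrite bnd_simp.
have sub' x : x \in `]s, t[ -> x \in `]a, b[.
  by rewrite !in_itv/= => /andP[sx xt]; rewrite (le_lt_trans as_ sx) (lt_le_trans xt tb).
have [c cI E] := MVT st (fun x xI => dX (sub' x xI)) (continuous_subspaceW itvcc_oo cX).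
by rewrite -subr_gt0 E mulr_gt0 ?subr_gt0// f0// sub'.
Qed.

Let mono s t : a <= s -> s <= b -> a <= t -> t <= b -> X s <= X t -> s <= t.
Proof.
move=> as_ sb hat tb Xst; rewrite leNgt; apply/negP => ts.
by have := increasing_of_derive hat ts sb; rewrite ltNge Xst.
Qed.

Let mono_oo s t : s \in `]a, b[ -> t \in `]a, b[ -> X s <= X t -> s <= t.
Proof. by rewrite !in_itv/= => /andP[/ltW ? /ltW ?] /andP[/ltW ? /ltW ?]; exact: mono. Qed.

Lemma inv_on_left t : t \in `]a, b[ -> tau (X t) = t.
Proof.
move=> tI; rewrite /inv_on; apply: pinvKV; last by rewrite inE.
move=> x y; rewrite !inE/= => xI yI E.
by apply/le_anti/andP; split; apply: mono_oo => //; rewrite E.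
Qed.

Lemma inv_on_right x : x \in `]X a, X b[ -> (tau x \in `]a, b[) /\ X (tau x) = x.
Proof.
rewrite in_itv/= => /andP[ax xb].
have [|c cI E] := IVT (ltW ab) cX (v := x).
  have XX := lt_trans ax xb.
  by rewrite ge_min le_max (ltW ax) (ltW xb) orbT.
have cI' : c \in `]a, b[.
  move: cI; rewrite !in_itv/= !le_eqVlt => /andP[/predU1P[ac|->] /predU1P[cb|->]] //.
  - by move: ax; rewrite -E ac ltxx.
  - by move: ax; rewrite -E ac ltxx.
  - by move: xb; rewrite -E cb ltxx.
by rewrite -E inv_on_left.
Qed.

Lemma image_itv t : t \in `]a, b[ -> X t \in `]X a, X b[.
Proof.
rewrite !in_itv/= => /andP[hat tb].
by rewrite (increasing_of_derive (lexx a) hat (ltW tb)) (increasing_of_derive (ltW hat) tb (lexx b)).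
Qed.

Lemma measurable_inv_on : measurable_fun `]X a, X b[ tau.
Proof.
apply: measurable_monotone_in; first exact: interval_is_interval.
move=> x y /= /inv_on_right[xI xE] /inv_on_right[yI yE] xy.
by apply: mono_oo => //; rewrite xE yE.
Qed.

Lemma derive_subst_primitive : primitive a b X f.
Proof.
have dE x : x \in `]a, b[ -> derive1 X x = f x.
  by move=> /dX[_ <-]; rewrite derive1E.
have cd : {in `]a, b[, continuous (derive1 X)}.
  move=> x xI; rewrite /prop_for /continuous_at dE//.
  have E : \forall y \near x, f y = derive1 X y.
    by have := near_in_itvoo xI; apply: filterS => y /dE.
  by apply: cvg_trans (cf xI); apply: near_eq_cvg; apply: filterS E => y ->.
have [_ H] := derive_primitive (fun x xI => @ex_derive _ _ _ _ _ _ _ (dX xI)) cd.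
split; first exact: continuous_locally_int.
move=> s t as_ st tb; rewrite H//; apply: eq_Rintegral => x /[!inE] xI.
by apply: dE; exact: (itvcc_oo as_ tb).
Qed.

Lemma integral_inv_on c d (h : R -> R) : a < c -> c <= d -> d < b ->
  measurable_fun `]a, b[ h -> (forall t, 0 <= h t) ->
  (\int[mu]_(x in `[X c, X d]) (h (tau x))%:E =
   \int[mu]_(t in `[c, d]) (h t * f t)%:E)%E.
Proof.
move=> ac cd db mh h0.
pose phi := (h \o tau) \_ `]X a, X b[.
have mht : measurable_fun `]X a, X b[ (h \o tau).
  apply: (measurable_comp (F := `]a, b[)) => //; last exact: measurable_inv_on.
  by move=> _ [x xI <-]; have [] := inv_on_right xI.
have mphi : measurable_fun setT phi.
  by apply/(measurable_restrictT _ _).1.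
have phi0 z : 0 <= phi z by rewrite /phi patchE; case: ifP => //= _; exact: h0.
have pX := derive_subst_primitive.
have cX' : {in `[c, d], continuous X}.
  by move=> x /(itvcc_oo ac db); exact: (primitive_continuous pX).
have f0' x : x \in `[c, d] -> 0 <= f x by move=> /(itvcc_oo ac db) /f0 /ltW.
have Ff s t : c <= s -> s <= t -> t <= d -> X t - X s = \int[mu]_(x in `[s, t]) f x.
  by move=> cs st td; rewrite pX.2//; [exact: lt_le_trans cs|exact: le_lt_trans db].
have := integral_subst cd cX' f0' (pX.1 _ _ ac db) Ff mphi phi0.
have ad := lt_le_trans ac cd; have cb := le_lt_trans cd db.
have Xac : X a < X c by exact: increasing_of_derive (lexx a) ac (ltW cb).
have Xdb : X d < X b by exact: increasing_of_derive (ltW ad) db (lexx b).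
have inI x : x \in `[X c, X d] -> x \in `]X a, X b[.
  rewrite !in_itv/= => /andP[h1 h2].
  by rewrite (lt_le_trans Xac h1) (le_lt_trans h2 Xdb).
have mp D : measurable D -> measurable_fun D (EFin \o phi).
  by move=> mD; apply/measurable_EFinP; exact: measurable_funTS.
move=> E.
transitivity (\int[mu]_(x in `[X c, X d]) (phi x)%:E)%E.
  by apply: eq_integral => x /[!inE] xI; rewrite /phi patchE mem_set//; exact: inI.
transitivity (\int[mu]_(x in `]X c, X d[) (phi x)%:E)%E.
  rewrite [RHS]integral_itv_obnd_cbnd; last exact: mp.
  by rewrite [RHS]integral_itv_bndo_bndc; last exact: mp.
rewrite E; apply: eq_integral => t /[!inE] tI.
have tI' := itvcc_oo ac db tI.
rewrite /phi patchE mem_set/=; last exact: image_itv.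
by rewrite inv_on_left.
Qed.

Lemma Rintegral_inv_on c d (h : R -> R) : a < c -> c <= d -> d < b ->
  {in `]a, b[, continuous h} ->
  itg `[X c, X d] (h \o tau) /\
  \int[mu]_(x in `[X c, X d]) h (tau x) = \int[mu]_(t in `[c, d]) (h t * f t).
Proof.
move=> ac cd db ch.
have ad := lt_le_trans ac cd; have cb := le_lt_trans cd db.
have Xac : X a < X c by exact: increasing_of_derive (lexx a) ac (ltW cb).
have Xdb : X d < X b by exact: increasing_of_derive (ltW ad) db (lexx b).
have Xcd : X c <= X d.
  move: cd; rewrite le_eqVlt => /predU1P[-> //|cd']; apply: ltW.
  exact: increasing_of_derive (ltW ac) cd' (ltW db).
have mh : measurable_fun `]a, b[ h.
  apply: open_continuous_measurable_fun; first exact: interval_open.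
  by move=> x; rewrite inE; exact: ch.
have ch' : {in `[c, d], continuous h} by move=> x /(itvcc_oo ac db); exact: ch.
have [M M0 hM] := in_continuous_bounded ch'.
(* [integral_inv_on] asks for a nonnegative function; [h + M] is one on [[c, d]], and the constant
   [M] contributes the same amount to both sides. *)
pose h' t := Num.max 0 (h t + M).
have mh' : measurable_fun `]a, b[ h'.
  by apply: measurable_maxr => //; apply: measurable_funD.
have h'0 t : 0 <= h' t by rewrite /h' le_max lexx.
have h'E t : t \in `[c, d] -> h' t = h t + M.
  move=> /hM; rewrite ler_norml => /andP[h1 _]; rewrite /h' max_r//; lra.
have E := integral_inv_on ac cd db mh' h'0.
have inI x : x \in `[X c, X d] -> tau x \in `[c, d].
  rewrite in_itv/= => /andP[h1 h2].
  have xI : x \in `]X a, X b[.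
    by rewrite in_itv/= (lt_le_trans Xac h1) (le_lt_trans h2 Xdb).
  have [tI XE] := inv_on_right xI.
  have cI : c \in `]a, b[ by rewrite in_itv/= ac.
  have dI : d \in `]a, b[ by rewrite in_itv/= ad.
  by rewrite in_itv/=; apply/andP; split; apply: mono_oo => //; rewrite XE.
have pX := derive_subst_primitive.
have fi : itg `[c, d] f by exact: pX.1.
have hfi : itg `[c, d] (fun t => h t * f t) by exact: itg_contM.
have h'fi : itg `[c, d] (fun t => h' t * f t).
  apply: (@itg_bndM _ _ _ _ (2 * M)) => //.
    by apply: measurable_funS mh' => //; move=> x /(itvcc_oo ac db).
  move=> t tI; rewrite h'E//; have := hM t tI.
  by rewrite ler_norml => /andP[h1 h2]; rewrite ger0_norm; lra.
have mht : measurable_fun `[X c, X d] (h \o tau).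
  apply: (measurable_comp (F := `]a, b[)) => //.
    by move=> _ [x /inI xI <-]; exact: itvcc_oo ac db xI.
  apply: (measurable_funS _ _ measurable_inv_on) => // x; rewrite /= !in_itv/= => /andP[h1 h2].
  by rewrite (lt_le_trans Xac h1) (le_lt_trans h2 Xdb).
have hti : itg `[X c, X d] (h \o tau).
  apply: (@itg_le _ _ _ (cst M)) => //; last exact: itg_cst.
  by move=> x /inI /hM.
split=> //.
have F1 : \int[mu]_(x in `[X c, X d]) h' (tau x) =
    \int[mu]_(x in `[X c, X d]) h (tau x) + M * (X d - X c).
  rewrite -(Rintegral_itv_cst M Xcd) -RintegralD//; last exact: itg_cst.
  by apply: eq_Rintegral => x /[!inE] /inI /h'E.
have F2 : \int[mu]_(t in `[c, d]) (h' t * f t) =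
    \int[mu]_(t in `[c, d]) (h t * f t) + M * (X d - X c).
  rewrite (pX.2 c d)// -RintegralZl// -RintegralD//; last exact: itgZ.
  by apply: eq_Rintegral => t /[!inE] /h'E ->; rewrite mulrDl.
have : \int[mu]_(x in `[X c, X d]) h' (tau x) = \int[mu]_(t in `[c, d]) (h' t * f t).
  by rewrite /Rintegral E.
by rewrite F1 F2; lra.
Qed.

Lemma inv_on_itv x1 x2 : X a < x1 -> x1 <= x2 -> x2 < X b ->
  [/\ a < tau x1, tau x1 <= tau x2, tau x2 < b, X (tau x1) = x1 & X (tau x2) = x2].
Proof.
move=> h1 h2 h3.
have [] := @inv_on_right x1; first by rewrite in_itv/= h1 (le_lt_trans h2).
move=> I1 E1.
have [] := @inv_on_right x2; first by rewrite in_itv/= h3 (lt_le_trans h1).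
move=> I2 E2.
have tt : tau x1 <= tau x2 by apply: mono_oo => //; rewrite E1 E2.
by move: I1 I2; rewrite !in_itv/= => /andP[? _] /andP[_ ?]; split.
Qed.

Lemma graph_primitive (Y q : R -> R) : {in `]a, b[, continuous q} ->
  primitive a b Y q ->
  primitive (X a) (X b) (Y \o tau) (fun x => q (tau x) / f (tau x)).
Proof.
move=> cq pY.
have ch : {in `]a, b[, continuous (fun t => q t / f t)}.
  move=> t tI; apply: cvgM; first exact: cq.
  by apply: cvgV; [rewrite gt_eqF// f0|exact: cf].
split.
  move=> x1 x2 h1 h3; have [h2|h2] := leP x1 x2; last first.
    by rewrite set_itv_ge ?bnd_simp -?ltNge//; exact: integrable_set0.
  have [at1 tt bt E1 E2] := inv_on_itv h1 h2 h3.
  by have [] := Rintegral_inv_on at1 tt bt ch; rewrite E1 E2.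
move=> x1 x2 h1 h2 h3.
have [at1 tt bt E1 E2] := inv_on_itv h1 h2 h3.
have [_] := Rintegral_inv_on at1 tt bt ch; rewrite E1 E2 => ->.
rewrite /= pY.2//; apply: eq_Rintegral => t /[!inE] tI.
by rewrite divfK// gt_eqF// f0// (itvcc_oo at1 bt).
Qed.

End monotone_inverse.

(** * The curve with a given decreasing angle *)

Section indefinite_integral.
Context {R : realType}.
Local Notation mu := (@lebesgue_measure R).
Local Notation itg D f := (mu.-integrable D (EFin \o f)).
Variable u : R -> R.
Hypotheses (iu : itg `[0, 1] u) (cu : {in `]0, 1[, continuous u}).
Let F (t : R) : R := \int[mu]_(x in `[0, t]) u x.

Lemma indefinite_continuous : {within `[0, 1], continuous F}.
Proof. exact: (parameterized_integral_continuous ler01 iu). Qed.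

Lemma indefinite_primitive : primitive 0 1 F u.
Proof.
split; first exact: continuous_locally_int.
move=> s t s0 st t1; apply: Rintegral_itv_diff => //; first exact: ltW.
by apply: itg_itvS iu => //; exact: ltW.
Qed.

Lemma indefinite_is_derive (t : R) : t \in `]0, 1[ -> is_derive t 1 F (u t).
Proof. by move=> tI; apply: (primitive_is_derive indefinite_primitive tI); exact: cu. Qed.

Lemma indefinite_derive1 (t : R) : t \in `]0, 1[ -> derive1 F t = u t.
Proof. by move=> /indefinite_is_derive[_ <-]; rewrite derive1E. Qed.

Lemma indefinite_sobolev (h : R -> R) : primitive 0 1 u h ->
  Wkp 1 1%E 0 1 F /\ Wkp_loc 2 1%E 0 1 F.
Proof.
move=> pu.
have pF := indefinite_primitive.
have cF := primitive_continuous pF.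
have sub : (`]0, 1[%classic : set R) `<=` `[0, 1] by exact: subset_itv_oo_cc.
have iF : itg `[0, 1] F.
  apply: continuous_compact_integrable; first exact: segment_compact.
  exact: indefinite_continuous.
have wF := weak_derivative_of_primitive pF.
split.
  split; first by apply/Lp1P => //; exact: itgS iF.
  by exists u => //; split=> //; apply/Lp1P => //; exact: itgS iu.
split; first by apply/Lp_loc1P; exact: continuous_locally_int.
exists u => //; split; first by apply/Lp_loc1P; exact: continuous_locally_int.
exists h; first exact: weak_derivative_of_primitive.
by split=> //; apply/Lp_loc1P; exact: pu.1.
Qed.

End indefinite_integral.

(* A decreasing tangent angle [vt] over ]0, 1[ for a curve of constant speed [L];
   [g] is the density of [- vt]. *)
Record angle_profile {R : realType} (vt g : R -> R) (L : R) : Prop := AngleProfile {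
  profile_length_gt0 : 0 < L ;
  profile_bnd : forall t, - (pi / 2) <= vt t <= pi / 2 ;
  profile_noninc : forall s t, s <= t -> vt t <= vt s ;
  profile_density_ge0 : forall t, 0 <= g t ;
  profile_density_int : (@lebesgue_measure R).-integrable `]0, 1[ (EFin \o g) ;
  profile_chain_rule : forall (phi : R -> R) (s t : R), 0 < s -> s <= t -> t < 1 ->
     measurable_fun setT phi -> (forall z, 0 <= phi z) ->
     (\int[(@lebesgue_measure R)]_(x in `[s, t]) (phi (vt x) * g x)%:E =
      \int[(@lebesgue_measure R)]_(z in `]vt t, vt s[) (phi z)%:E)%E ;
  profile_cos : \int[(@lebesgue_measure R)]_(t in `]0, 1[) (cos (vt t) * L) = 1 ;
  profile_sin : \int[(@lebesgue_measure R)]_(t in `]0, 1[) (sin (vt t) * L) = 0 ;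
  profile_L2 : forall c d : R, 0 < c -> c <= d -> d < 1 ->
     vt c < pi / 2 -> - (pi / 2) < vt d ->
     (\int[(@lebesgue_measure R)]_(t in `[c, d]) (g t ^+ 2)%:E < +oo)%E }.

Section curve_of_angle.
Context {R : realType}.
Local Notation mu := (@lebesgue_measure R).
Local Notation itg D f := (mu.-integrable D (EFin \o f)).
Variables (vt g : R -> R) (L : R).
Hypothesis profile : angle_profile vt g L.
Let L0 := profile_length_gt0 profile.
Let vb := profile_bnd profile.
Let vmono := profile_noninc profile.
Let g0 := profile_density_ge0 profile.
Let ig := profile_density_int profile.
Let chain := profile_chain_rule profile.
Let cos_int := profile_cos profile.
Let sin_int := profile_sin profile.

Definition cos_curve t := cos (vt t) * L.
Definition sin_curve t := sin (vt t) * L.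

Definition curve (t : R) : R * R :=
  (\int[mu]_(x in `[0, t]) cos_curve x, \int[mu]_(x in `[0, t]) sin_curve x).

Let igl : locally_int 0 1 g.
Proof.
by move=> s t s0 t1; apply: itgS ig => // x /= /(itvcc_oo s0 t1).
Qed.

Lemma vt_increment (Phi phi : R -> R) (s t : R) : 0 < s -> s <= t -> t < 1 ->
  (forall z : R, is_derive z 1 Phi (phi z)) -> continuous phi -> (forall z, 0 <= phi z) ->
  Phi (vt s) - Phi (vt t) = \int[mu]_(x in `[s, t]) (phi (vt x) * g x).
Proof.
move=> s0 st t1 dPhi cphi phi0.
have mphi : measurable_fun setT phi by exact: continuous_measurable_fun.
have dE : derive1 Phi = phi by apply/funext => z; rewrite derive1E; have [_ ->] := dPhi z.
have := @derive_primitive R (vt t - 1) (vt s + 1) Phi.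
rewrite dE => /(_ (fun x _ => @ex_derive _ _ _ _ _ _ _ (dPhi x)) (fun x _ => cphi x)) pPhi.
have vts := vmono st.
rewrite pPhi.2//; [|lra|lra].
rewrite [RHS]/Rintegral chain//.
rewrite integral_itv_obnd_cbnd; last first.
  by apply/measurable_EFinP; exact: measurable_funTS.
rewrite integral_itv_bndo_bndc//.
by apply/measurable_EFinP; exact: measurable_funTS.
Qed.

Lemma primitive_vt : primitive 0 1 vt (fun x => - g x).
Proof.
split=> [s t s0 t1|s t s0 st t1]; first by apply: itgN => //; exact: igl.
have c1 : continuous (cst 1 : R -> R) by move=> z; exact: cvg_cst.
have := @vt_increment id (cst 1) s t s0 st t1 (fun z : R => is_derive_id z 1)
  c1 (fun _ => ler01).
have -> : \int[mu]_(x in `[s, t]) (cst 1 (vt x) * g x) = \int[mu]_(x in `[s, t]) g x.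
  by apply: eq_Rintegral => x _; rewrite /= mul1r.
move=> /= E; rewrite (_ : \int[mu]_(x in `[s, t]) - g x = (-1) * \int[mu]_(x in `[s, t]) g x).
  by rewrite -E; ring.
rewrite -RintegralZl//; last exact: igl.
by apply: eq_Rintegral => x _; rewrite mulN1r.
Qed.

Lemma vt_continuous : {in `]0, 1[, continuous vt}.
Proof. exact: primitive_continuous primitive_vt. Qed.

Let cont_comp (h : R -> R) : continuous h -> {in `]0, 1[, continuous (h \o vt)}.
Proof.
by move=> ch x xI; apply: continuous_comp; [exact: vt_continuous|exact: ch].
Qed.

Let primitive_comp (Phi phi : R -> R) :
  (forall z : R, is_derive z 1 Phi (phi z)) -> continuous phi -> (forall z : R, -1 <= phi z) ->
  primitive 0 1 (fun x => Phi (vt x)) (fun x => - (phi (vt x) * g x)).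
Proof.
move=> dPhi cphi phi1.
have i1 s t : 0 < s -> t < 1 -> itg `[s, t] (fun x => phi (vt x) * g x).
  move=> s0 t1; apply: itg_contM; last exact: igl.
  by move=> x /(itvcc_oo s0 t1) xI; exact: (cont_comp cphi).
split=> [s t s0 t1|s t s0 st t1]; first by apply: itgN => //; exact: i1.
(* The chain rule accepts only nonnegative functions; adding the identity to [Phi] replaces
   [phi >= -1] by [phi + 1], and the identity part is [primitive_vt]. *)
have H := @vt_increment (fun z => Phi z + z) (fun z => phi z + 1) s t s0 st t1.
have : Phi (vt s) + vt s - (Phi (vt t) + vt t) = \int[mu]_(x in `[s, t]) ((phi (vt x) + 1) * g x).
  apply: H.
  - by move=> z; apply: cvgD; [exact: cphi|exact: cvg_cst].
  - by move=> z; have := phi1 z; lra.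
have -> : \int[mu]_(x in `[s, t]) ((phi (vt x) + 1) * g x) =
    \int[mu]_(x in `[s, t]) (phi (vt x) * g x) + \int[mu]_(x in `[s, t]) g x.
  rewrite -RintegralD//; [|exact: i1|exact: igl].
  by apply: eq_Rintegral => x _; rewrite mulrDl mul1r.
have E (h : R -> R) : itg `[s, t] h ->
    \int[mu]_(x in `[s, t]) (- h x) = - \int[mu]_(x in `[s, t]) h x.
  move=> ih; rewrite -[RHS]mulN1r -RintegralZl//.
  by apply: eq_Rintegral => x _; rewrite mulN1r.
have := primitive_vt.2 s t s0 st t1; rewrite E; last exact: igl.
rewrite (E (fun x => phi (vt x) * g x)); last exact: i1.
lra.
Qed.

Lemma primitive_cos_curve : primitive 0 1 cos_curve (fun x => sin (vt x) * g x * L).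
Proof.
have [i1 H] : primitive 0 1 (fun x => cos (vt x)) (fun x => - (- sin (vt x) * g x)).
  apply: (@primitive_comp cos (fun z => - sin z)) => z.
    by apply: cvgN; exact: continuous_sin.
  by rewrite lerN2; exact: sin_le1.
split=> [s t s0 t1|s t s0 st t1].
  have := itgZ L (measurable_itv `[s, t]) (i1 _ _ s0 t1).
  by congr (integrable _ _ _); apply/funext => x /=; congr EFin; ring.
rewrite /cos_curve -mulrBl H// mulrC -RintegralZl//; last exact: i1.
by apply: eq_Rintegral => x _; ring.
Qed.

Lemma primitive_sin_curve : primitive 0 1 sin_curve (fun x => - (cos (vt x) * g x * L)).
Proof.
have [i1 H] : primitive 0 1 (fun x => sin (vt x)) (fun x => - (cos (vt x) * g x)).
  apply: (@primitive_comp sin cos) => z.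
    exact: continuous_cos.
  exact: cos_geN1.
split=> [s t s0 t1|s t s0 st t1].
  have := itgZ L (measurable_itv `[s, t]) (i1 _ _ s0 t1).
  by congr (integrable _ _ _); apply/funext => x /=; congr EFin; ring.
rewrite /sin_curve -mulrBl H// mulrC -RintegralZl//; last exact: i1.
by apply: eq_Rintegral => x _; ring.
Qed.

Let mvt (D : set R) : measurable D -> measurable_fun D vt.
Proof. by move=> mD; apply: nonincreasing_measurable => // x y xy; exact: vmono. Qed.

Lemma cos_curve_int : itg `[0, 1] cos_curve.
Proof.
apply: (@itg_bndM _ _ _ (cst L) 1) => //; last exact: itg_cst.
  apply: (@measurableT_comp _ _ _ _ _ _ (cos : R -> R) _ vt); last exact: mvt.
  by apply: continuous_measurable_fun; exact: continuous_cos.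
by move=> x _; rewrite ler_norml cos_geN1 cos_le1.
Qed.

Lemma sin_curve_int : itg `[0, 1] sin_curve.
Proof.
apply: (@itg_bndM _ _ _ (cst L) 1) => //; last exact: itg_cst.
  apply: (@measurableT_comp _ _ _ _ _ _ (sin : R -> R) _ vt); last exact: mvt.
  by apply: continuous_measurable_fun; exact: continuous_sin.
by move=> x _; rewrite ler_norml sin_geN1 sin_le1.
Qed.

Lemma cos_curve_cont : {in `]0, 1[, continuous cos_curve}.
Proof. exact: primitive_continuous primitive_cos_curve. Qed.

Lemma sin_curve_cont : {in `]0, 1[, continuous sin_curve}.
Proof. exact: primitive_continuous primitive_sin_curve. Qed.

Lemma curve_d1 t : t \in `]0, 1[ -> d1 curve t = cos_curve t.
Proof. exact: (indefinite_derive1 cos_curve_int cos_curve_cont). Qed.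

Lemma curve_d2 t : t \in `]0, 1[ -> d2 curve t = sin_curve t.
Proof. exact: (indefinite_derive1 sin_curve_int sin_curve_cont). Qed.

Lemma curve_speed t : t \in `]0, 1[ -> speed curve t = L.
Proof.
move=> tI; rewrite /speed curve_d1// curve_d2// /cos_curve /sin_curve !exprMn -mulrDl.
by rewrite cos2Dsin2 mul1r sqrtr_sqr gtr0_norm.
Qed.

Lemma cos_vt_ge0 t : 0 <= cos (vt t).
Proof. exact: cos_ge0_pihalf. Qed.

Lemma curve0 : curve 0 = (0, 0).
Proof. by rewrite /curve !set_itv1 !Rintegral_set1. Qed.

Let closed_unit (u : R -> R) : itg `[0, 1] u ->
  \int[mu]_(x in `[0, 1]) u x = \int[mu]_(x in `]0, 1[) u x.
Proof.
move=> iu; rewrite -Rintegral_itv_obnd_cbnd; last first.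
  by apply: itgS iu => //; exact: subset_itv_oc_cc.
by rewrite -Rintegral_itv_bndo_bndc//; apply: itgS iu => //; exact: subset_itv_oo_cc.
Qed.

Lemma curve1 : curve 1 = (1, 0).
Proof.
rewrite /curve (closed_unit cos_curve_int) (closed_unit sin_curve_int).
by rewrite [X in (X, _)]cos_int [X in (_, X)]sin_int.
Qed.

End curve_of_angle.

Section primitive_supplements.
Context {R : realType}.
Local Notation mu := (@lebesgue_measure R).
Local Notation itg D f := (mu.-integrable D (EFin \o f)).
Implicit Types (a b : R) (f g h : R -> R).

(** [wderiv] is an arbitrary choice; uniqueness up to a null set lets an explicit derivative replace
    it under integrals. *)
Lemma wderiv_primitive a b f h : primitive a b f h ->
  locally_int a b (wderiv a b f) /\
  {ae mu, forall x, x \in `]a, b[ -> wderiv a b f x = h x}.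
Proof.
move=> pf; have [iw ww] := wderivP pf.1 (weak_derivative_of_primitive pf).
split=> //.
have cf := primitive_continuous pf.
have [F pF fF] := weak_derivative_primitive (continuous_locally_int cf) iw ww.
apply: (@primitive_unique _ _ _ f) => //.
apply: (eq_primitive _ pF) => x xI; apply/esym.
exact: (continuous_ae_eq cf (primitive_continuous pF) fF).
Qed.

Lemma Lp2_continuous c d f : {in `[c, d], continuous f} -> Lp 2%:E `[c, d] f.
Proof.
move=> cf; apply/Lp2P => //; split; first exact: in_continuous_measurable.
have cf2 : {in `[c, d], continuous (fun x => f x * f x)}.
  by move=> x xI; apply: cvgM; exact: cf.
have /integrableP[_] := itg_cont cf2; apply: le_lt_trans.
apply: ge0_le_integral => //=.
- by move=> x _; rewrite lee_fin sqr_ge0.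
- by apply/measurable_EFinP; apply: measurable_funX; exact: in_continuous_measurable.
- apply/measurable_EFinP; apply: measurableT_comp => //.
  exact: in_continuous_measurable.
- by move=> x _; rewrite lee_fin expr2 ler_norm.
Qed.

End primitive_supplements.

(** * Change of variable for a derivative that is only locally square-integrable *)

Section substitution.
Context {R : realType}.
Local Notation mu := (@lebesgue_measure R).
Local Notation itg D f := (mu.-integrable D (EFin \o f)).
Variables (a b : R) (X f : R -> R).
Hypotheses (ab : a < b) (cX : {within `[a, b], continuous X})
  (dX : forall x, x \in `]a, b[ -> is_derive x 1 X (f x))
  (cf : {in `]a, b[, continuous f}) (f0 : forall x, x \in `]a, b[ -> 0 < f x).
Local Notation tau := (inv_on a b X).
Variables (T k : R -> R).
Hypotheses (k0 : forall t, 0 <= k t) (pT : primitive a b T (fun t => - k t))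
  (kL2 : forall c d, a < c -> c <= d -> d < b ->
     (\int[mu]_(t in `[c, d]) (k t ^+ 2)%:E < +oo)%E).

(** The absolute value makes [h] nonnegative on the whole line, as [integral_inv_on] demands; on
    []a, b[] it changes nothing. *)
Let h t := k t / `|f t|.

Let h0 t : 0 <= h t.
Proof. by rewrite divr_ge0. Qed.

Let fV : {in `]a, b[, continuous (fun t => (f t)^-1)}.
Proof. by move=> t tI; apply: cvgV; [rewrite gt_eqF// f0|exact: cf]. Qed.

Let mk : measurable_fun `]a, b[ k.
Proof.
have := locally_int_measurable pT.1 => /(measurableT_comp (@oppr_measurable R setT)).
by congr (measurable_fun _ _); apply/funext => t /=; rewrite opprK.
Qed.

Let mf : measurable_fun `]a, b[ f.
Proof. exact: locally_int_measurable (continuous_locally_int cf). Qed.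

Let mh : measurable_fun `]a, b[ h.
Proof.
apply: (@eq_measurable_fun _ _ _ _ _ (fun t => k t * (f t)^-1)).
  by move=> t /[!inE] tI; rewrite /h gtr0_norm// f0.
apply: measurable_funM => //.
exact: locally_int_measurable (continuous_locally_int fV).
Qed.

Let hf t : t \in `]a, b[ -> h t = k t / f t.
Proof. by move=> tI; rewrite /h gtr0_norm// f0. Qed.

Let hL2 x1 x2 : X a < x1 -> x1 <= x2 -> x2 < X b ->
  (\int[mu]_(x in `[x1, x2]) (h (tau x) ^+ 2)%:E < +oo)%E.
Proof.
move=> h1 h2 h3; have [ac cd db Ec Ed] := inv_on_itv ab cX dX f0 h1 h2 h3.
rewrite -Ec -Ed (@integral_inv_on _ _ _ X f ab cX dX cf f0 _ _ (fun t => h t ^+ 2))//; last 2 first.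
- exact: measurable_funX.
- by move=> t; rewrite sqr_ge0.
have [M M0 fM] := in_continuous_bounded (fun t tI => fV (itvcc_oo ac db tI)).
have mcd (u : R -> R) : measurable_fun `]a, b[ u -> measurable_fun `[tau x1, tau x2] u.
  by apply: measurable_funS => // t /= /(itvcc_oo ac db).
apply: (@le_lt_trans _ _ (\int[mu]_(t in `[tau x1, tau x2]) (M%:E * (k t ^+ 2)%:E))%E).
  apply: ge0_le_integral => //=.
  - by move=> t /(itvcc_oo ac db) tI; rewrite lee_fin mulr_ge0 ?sqr_ge0// ltW// f0.
  - apply/measurable_EFinP; apply: measurable_funM; last exact: mcd.
    by apply: measurable_funX; exact: mcd.
  - by apply/measurable_EFinP; apply: measurable_funM => //; apply: measurable_funX; exact: mcd.
  move=> t tI; have tI' := itvcc_oo ac db tI; have ft := f0 tI'.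
  rewrite -EFinM lee_fin hf//.
  have -> : (k t / f t) ^+ 2 * f t = (f t)^-1 * k t ^+ 2 by field; rewrite gt_eqF.
  by rewrite ler_wpM2r ?sqr_ge0// (le_trans _ (fM _ tI))// ler_norm.
rewrite ge0_integralZl//.
- by apply: lte_mul_pinfty; [rewrite lee_fin ltW|by []|exact: kL2].
- by apply/measurable_EFinP; apply: measurable_funX; exact: mcd.
- by move=> t _; rewrite lee_fin sqr_ge0.
- by rewrite lee_fin ltW.
Qed.

Let mtau (u : R -> R) : measurable_fun `]a, b[ u -> measurable_fun `]X a, X b[ (u \o tau).
Proof.
move=> mu_; apply: (measurable_comp (F := `]a, b[)) => //.
  by move=> _ [x xI <-]; have [] := inv_on_right ab cX dX f0 xI.
exact: measurable_inv_on ab cX dX f0.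
Qed.

Let wE x : x \in `]X a, X b[ -> h (tau x) = k (tau x) / f (tau x).
Proof. by move=> /(inv_on_right ab cX dX f0)[tI _]; rewrite hf. Qed.

Lemma inverse_density_L2 : Lp_loc 2%:E (X a) (X b) (fun x => - (k (tau x) / f (tau x))).
Proof.
move=> x1 x2 h1 h3; apply/Lp2P => //; split.
  apply: (@eq_measurable_fun _ _ _ _ _ (fun x => - h (tau x))).
    by move=> x /[!inE] /(itvcc_oo h1 h3) xI; rewrite wE.
  apply: measurableT_comp; first exact: oppr_measurable.
  by apply: measurable_funS (mtau mh) => // x /= /(itvcc_oo h1 h3).
have [h2|h2] := leP x1 x2; last by rewrite set_itv_ge ?integral_set0// bnd_simp -ltNge.
apply: le_lt_trans (hL2 h1 h2 h3); rewrite le_eqVlt; apply/orP; left; apply/eqP.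
by apply: eq_integral => x /[!inE] /(itvcc_oo h1 h3) xI; rewrite sqrrN wE.
Qed.

(** [k] need not be continuous, so [graph_primitive] does not apply; the sign of [k] lets
    [integral_inv_on] do the change of variable instead. *)
Lemma inverse_primitive :
  primitive (X a) (X b) (T \o tau) (fun x => - (k (tau x) / f (tau x))).
Proof.
have E x1 x2 : X a < x1 -> x1 <= x2 -> x2 < X b ->
    (\int[mu]_(x in `[x1, x2]) (h (tau x))%:E =
     \int[mu]_(t in `[tau x1, tau x2]) (k t)%:E)%E.
  move=> h1 h2 h3; have [ac cd db Ec Ed] := inv_on_itv ab cX dX f0 h1 h2 h3.
  rewrite -{1}Ec -{1}Ed integral_inv_on//.
  apply: eq_integral => t /[!inE] tI; rewrite hf ?divfK ?gt_eqF ?f0//; exact: (itvcc_oo ac db).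
have ik s t : a < s -> t < b -> itg `[s, t] k.
  move=> as_ tb; have := itgN (measurable_itv _) (pT.1 _ _ as_ tb).
  by congr (integrable _ _ _); apply/funext => x /=; rewrite opprK.
have ih x1 x2 : X a < x1 -> x2 < X b -> itg `[x1, x2] (h \o tau).
  move=> h1 h3; apply/integrableP; split.
    apply/measurable_EFinP.
    by apply: measurable_funS (mtau mh) => // x /= /(itvcc_oo h1 h3).
  have [h2|h2] := leP x1 x2; last by rewrite set_itv_ge ?integral_set0// bnd_simp -ltNge.
  have [ac cd db Ec Ed] := inv_on_itv ab cX dX f0 h1 h2 h3.
  under eq_integral do rewrite /= ger0_norm ?h0//.
  rewrite E//; have /integrableP[_] := ik _ _ ac db.
  by under eq_integral do rewrite /= ger0_norm ?k0//.
split=> [x1 x2 h1 h3|x1 x2 h1 h2 h3].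
  have := itgN (measurable_itv `[x1, x2]) (ih _ _ h1 h3).
  apply: (@eq_integrable _ _ _ mu _ (measurable_itv `[x1, x2])).
  by move=> x /[!inE] /(itvcc_oo h1 h3) xI; rewrite /= wE.
have [ac cd db Ec Ed] := inv_on_itv ab cX dX f0 h1 h2 h3.
rewrite /= pT.2//.
transitivity (- \int[mu]_(t in `[tau x1, tau x2]) k t).
  rewrite -mulN1r -RintegralZl//; last exact: ik.
  by apply: eq_Rintegral => t _; rewrite mulN1r.
transitivity (- \int[mu]_(x in `[x1, x2]) h (tau x)); first by rewrite /Rintegral E.
rewrite -mulN1r -RintegralZl//; last exact: ih.
by apply: eq_Rintegral => x /[!inE] /(itvcc_oo h1 h3) xI; rewrite mulN1r wE.
Qed.

End substitution.

Section curve_of_angle_pseudograph.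
Context {R : realType}.
Local Notation mu := (@lebesgue_measure R).
Local Notation itg D f := (mu.-integrable D (EFin \o f)).

Lemma primitive_subitv (a b a' b' : R) (f h : R -> R) : a <= a' -> b' <= b ->
  primitive a b f h -> primitive a' b' f h.
Proof.
move=> aa bb [ih H]; split=> [s t as_ tb|s t as_ st tb].
  by apply: ih; [exact: le_lt_trans as_|exact: lt_le_trans bb].
by apply: H => //; [exact: le_lt_trans as_|exact: lt_le_trans bb].
Qed.

Lemma primitive_tan :
  primitive (- (pi / 2)) (pi / 2) (@tan R) (fun z => (cos z)^-2).
Proof.
have cosN0 (z : R) : z \in `](- (pi / 2)), (pi / 2)[ -> cos z != 0.
  by rewrite in_itv/= => /cos_gt0_pihalf/lt0r_neq0.
have dE (z : R) : z \in `](- (pi / 2)), (pi / 2)[ -> derive1 tan z = (cos z)^-2.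
  by move=> /cosN0/is_derive_tan[_ <-]; rewrite derive1E.
have cV : {in `](- (pi / 2)), (pi / 2)[, continuous (fun z : R => (cos z)^-2)}.
  move=> z zI; apply: cvgV; first by rewrite expf_neq0// cosN0.
  rewrite expr2; under eq_fun do rewrite expr2.
  by apply: cvgM; exact: continuous_cos.
have ctd : {in `](- (pi / 2)), (pi / 2)[, continuous (derive1 (@tan R))}.
  move=> z zI; rewrite /prop_for /continuous_at dE//.
  have E : \forall y \near z, (cos y)^-2 = derive1 (@tan R) y.
    by have := near_in_itvoo zI; apply: filterS => y /dE.
  by apply: cvg_trans (cV z zI); apply: near_eq_cvg; apply: filterS E => y ->.
have [_ H] := derive_primitive (fun z zI => derivable_tan (cosN0 z zI)) ctd.
split; first exact: continuous_locally_int.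
move=> s t as_ st tb; rewrite H//; apply: eq_Rintegral => z /[!inE]/= zI.
apply: dE; move: zI; rewrite !in_itv/= => /andP[sz zt].
by rewrite (lt_le_trans as_ sz) (le_lt_trans zt tb).
Qed.

Variables (vt g : R -> R) (L : R).
Hypothesis profile : angle_profile vt g L.
Let L0 := profile_length_gt0 profile.
Let vb := profile_bnd profile.
Let vmono := profile_noninc profile.
Let g0 := profile_density_ge0 profile.
Let ig := profile_density_int profile.
Let chain := profile_chain_rule profile.
Local Notation curve := (curve vt L).
Local Notation cos_curve := (cos_curve vt L).
Local Notation sin_curve := (sin_curve vt L).
Let icos := cos_curve_int profile.
Let isin := sin_curve_int profile.
Let ccos := cos_curve_cont profile.
Let csin := sin_curve_cont profile.

Lemma cos_curve_ge0 t : 0 <= cos_curve t.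
Proof. by rewrite /cos_curve mulr_ge0 ?(cos_vt_ge0 profile)// ltW. Qed.

Lemma vt_interior t : 0 < cos_curve t -> vt t \in `](- (pi / 2)), (pi / 2)[.
Proof.
rewrite /cos_curve pmulr_lgt0// => c0; have /andP[v1 v2] := vb t.
rewrite in_itv/= !lt_neqAle v1 v2 !andbT; apply/andP; split; apply/eqP => E.
  by move: c0; rewrite -E cosN cos_pihalf ltxx.
by move: c0; rewrite E cos_pihalf ltxx.
Qed.

Section graph.
Variables (a b : R).
Hypotheses (a0 : 0 <= a) (ab : a < b) (b1 : b <= 1)
  (cos0 : forall t, t \in `]a, b[ -> 0 < cos_curve t).

Let sub1 t : t \in `]a, b[ -> t \in `]0, 1[.
Proof. exact: itvoo_widen. Qed.

Let cosV_cont : {in `]a, b[, continuous (fun t => (cos (vt t))^-2)}.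
Proof.
move=> t tI; apply: cvgV.
  by rewrite expf_neq0// gt_eqF//; have := cos0 tI; rewrite /cos_curve pmulr_lgt0.
rewrite expr2; under eq_fun do rewrite expr2.
have cc : {for t, continuous (fun t => cos (vt t))}.
  by apply: continuous_comp; [exact: vt_continuous profile _ (sub1 tI)|exact: continuous_cos].
by apply: cvgM; exact: cc.
Qed.

Let k t := (cos (vt t))^-2 * g t.

Let primitive_tan_vt : primitive a b (fun t => tan (vt t)) (fun t => - k t).
Proof.
have ik s t : a < s -> t < b -> itg `[s, t] k.
  move=> as_ tb; apply: itg_contM.
    by move=> x /(itvcc_oo as_ tb); exact: cosV_cont.
  have s0 := le_lt_trans a0 as_; have t1 := lt_le_trans tb b1.
  apply: itgS ig => // x /=; rewrite !in_itv/= => /andP[sx xt].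
  by rewrite (lt_le_trans s0 sx) (le_lt_trans xt t1).
split=> [s t as_ tb|s t as_ st tb]; first by apply: itgN => //; exact: ik.
have [pt Ht] := primitive_tan.
(* The chain rule needs a function on the whole line. The cut-off is invisible, since the angle
   stays inside the open interval wherever the cosine is positive. *)
pose phi := (fun z : R => (cos z)^-2) \_ `](- (pi / 2)), (pi / 2)[.
have mphi : measurable_fun setT phi.
  apply/(measurable_restrictT _ _).1 => //.
  exact: locally_int_measurable pt.
have phi0 z : 0 <= phi z.
  by rewrite /phi patchE; case: ifP => //= _; rewrite invr_ge0 sqr_ge0.
have vI x : s <= x -> x <= t -> vt x \in `](- (pi / 2)), (pi / 2)[.
  by move=> sx xt; apply/vt_interior/cos0; rewrite in_itv/= (lt_le_trans as_ sx) (le_lt_trans xt tb).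
have E := chain (le_lt_trans a0 as_) st (lt_le_trans tb b1) mphi phi0.
have vts := vmono st.
have /andP[vt1 vt2] : - (pi / 2) < vt t < pi / 2 by have := vI t st (lexx t); rewrite in_itv.
have /andP[vs1 vs2] : - (pi / 2) < vt s < pi / 2 by have := vI s (lexx s) st; rewrite in_itv.
have E1 : \int[mu]_(x in `[s, t]) k x = tan (vt s) - tan (vt t).
  rewrite Ht// /Rintegral; congr fine.
  transitivity (\int[mu]_(x in `[s, t]) (phi (vt x) * g x)%:E)%E.
    apply: eq_integral => x /[!inE]/=; rewrite in_itv/= => /andP[sx xt].
    by rewrite /phi patchE mem_set//=; exact: vI.
  rewrite E; have mD (D : set R) : measurable D -> measurable_fun D (EFin \o phi).
    by move=> mD; apply/measurable_EFinP; exact: measurable_funTS.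
  rewrite integral_itv_obnd_cbnd; last exact: mD.
  rewrite integral_itv_bndo_bndc; last exact: mD.
  apply: eq_integral => z /[!inE]/=; rewrite in_itv/= => /andP[sz zt].
  by rewrite /phi patchE mem_set//= in_itv/= (lt_le_trans vt1 sz) (le_lt_trans zt vs2).
rewrite -(opprB (tan (vt s))) -E1 -mulN1r -RintegralZl//; last exact: ik.
by apply: eq_Rintegral => x _; rewrite mulN1r.
Qed.

Let kL2 c d : a < c -> c <= d -> d < b -> (\int[mu]_(t in `[c, d]) (k t ^+ 2)%:E < +oo)%E.
Proof.
move=> ac cd db.
have [M M0 fM] := in_continuous_bounded (fun t tI => cosV_cont (itvcc_oo ac db tI)).
have vI x : c <= x -> x <= d -> vt x \in `](- (pi / 2)), (pi / 2)[.
  by move=> sx xt; apply/vt_interior/cos0; rewrite in_itv/= (lt_le_trans ac sx) (le_lt_trans xt db).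
have mg : measurable_fun `[c, d] g.
  apply: measurable_funS (itg_measurable ig) => // t /= /(itvcc_oo ac db) /sub1 //.
have mc : measurable_fun `[c, d] (fun t => (cos (vt t))^-2).
  by apply: in_continuous_measurable => t /(itvcc_oo ac db); exact: cosV_cont.
apply: (@le_lt_trans _ _ (\int[mu]_(t in `[c, d]) ((M ^+ 2)%:E * (g t ^+ 2)%:E))%E).
  apply: ge0_le_integral => //=.
  - by move=> t _; rewrite lee_fin sqr_ge0.
  - by apply/measurable_EFinP; apply: measurable_funX; exact: measurable_funM.
  - by apply/measurable_EFinP; apply: measurable_funM => //; exact: measurable_funX.
  move=> t tI; rewrite -EFinM lee_fin /k exprMn ler_wpM2r ?sqr_ge0//.
  by rewrite -[leLHS]ger0_norm ?sqr_ge0// normrX lerXn2r ?nnegrE ?(ltW M0)// fM.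
rewrite ge0_integralZl//.
- apply: lte_mul_pinfty; [by rewrite lee_fin sqr_ge0|by []|].
  apply: (profile_L2 profile) => //.
  + exact: le_lt_trans ac.
  + exact: lt_le_trans b1.
  + by have := vI c (lexx c) cd; rewrite in_itv/= => /andP[].
  + by have := vI d cd (lexx d); rewrite in_itv/= => /andP[].
- by apply/measurable_EFinP; exact: measurable_funX.
- by move=> t _; rewrite lee_fin sqr_ge0.
- by rewrite lee_fin sqr_ge0.
Qed.

(** The slope [sin_curve / cos_curve] of the graph is the tangent of the angle, so its derivative
    comes from [inverse_primitive] with the density of [tan (vt t)]. Square integrability is
    inherited from [profile_L2], the cosine being bounded away from zero on compact subintervals. *)
Lemma curve_graph_W22 :
  Wkp_loc 2 2%:E (coord1 curve a) (coord1 curve b) (graph_on a b curve).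
Proof.
have cX : {within `[a, b], continuous (coord1 curve)}.
  apply: (continuous_subspaceW _ (indefinite_continuous icos)).
  by apply: subset_itv; rewrite bnd_simp.
have dX t (tI : t \in `]a, b[) : is_derive t 1 (coord1 curve) (cos_curve t).
  exact: indefinite_is_derive icos ccos _ (sub1 tI).
have cf : {in `]a, b[, continuous cos_curve} by move=> t /sub1; exact: ccos.
have cq : {in `]a, b[, continuous sin_curve} by move=> t /sub1; exact: csin.
have pY : primitive a b (coord2 curve) sin_curve.
  exact: primitive_subitv a0 b1 (indefinite_primitive isin csin).
have k0 t : 0 <= k t by rewrite mulr_ge0// invr_ge0 sqr_ge0.
have pu := graph_primitive ab cX dX cf cos0 cq pY.
have pU := inverse_primitive ab cX dX cf cos0 k0 primitive_tan_vt.
have W2 := inverse_density_L2 ab cX dX cf cos0 primitive_tan_vt kL2.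
have UE : (fun x => sin_curve (inv_on a b (coord1 curve) x) /
                    cos_curve (inv_on a b (coord1 curve) x)) =
    (fun t => tan (vt t)) \o inv_on a b (coord1 curve).
  by apply/funext => x /=; rewrite /sin_curve /cos_curve -mulf_div divff ?mulr1// gt_eqF.
rewrite UE in pu.
have L2c (h h' : R -> R) : primitive (coord1 curve a) (coord1 curve b) h h' ->
    Lp_loc 2%:E (coord1 curve a) (coord1 curve b) h.
  move=> ph c d ac db; apply: Lp2_continuous => x; rewrite in_itv/= => /andP[cx xd].
  apply: (primitive_continuous ph).
  by rewrite in_itv/= (lt_le_trans ac cx) (le_lt_trans xd db).
split; first exact: L2c pu.
exists ((fun t => tan (vt t)) \o inv_on a b (coord1 curve)).
  exact: weak_derivative_of_primitive pu.
split; first exact: L2c pU.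
eexists; first exact: weak_derivative_of_primitive pU.
by split.
Qed.

End graph.

Lemma curve_pseudograph : pseudograph curve.
Proof.
split.
- move=> x.
  have c1 := indefinite_continuous icos (x := x).
  have c2 := indefinite_continuous isin (x := x).
  exact: (cvg_pair c1 c2).
- split; [exact: (indefinite_sobolev icos ccos (primitive_cos_curve profile)).1|].
  exact: (indefinite_sobolev isin csin (primitive_sin_curve profile)).1.
- split; [exact: (indefinite_sobolev icos ccos (primitive_cos_curve profile)).2|].
  exact: (indefinite_sobolev isin csin (primitive_sin_curve profile)).2.
- exists (L / 2); first by rewrite divr_gt0.
  by move=> t tI; rewrite (curve_speed profile tI); have := L0; lra.
- by move=> t tI; rewrite (curve_d1 profile tI) cos_curve_ge0.
- move=> a b a0 ab b1 H; apply: curve_graph_W22 => // t tI.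
  rewrite -(curve_d1 profile); first exact: H.
  move: tI; rewrite !in_itv/= => /andP[ta tb].
  by rewrite (le_lt_trans a0 ta) (lt_le_trans tb b1).
Qed.

Lemma curve_of_angle_length : curve_length curve = L%:E.
Proof.
rewrite /curve_length; transitivity (\int[mu]_(t in `]0%R, 1%R[) L%:E)%E.
  by apply: eq_integral => t /[!inE] /(curve_speed profile) ->.
rewrite integral_cst//= (_ : mu _ = 1%E) ?mule1//.
by rewrite [LHS](@lebesgue_measure_itv R `]0%R, 1%R[)/= lte_fin ltr01 sube0.
Qed.

(** At constant speed [L] the normal component of the second derivative is - g L, and (g L)^2 / L^3
    = g^2 / L. *)
Lemma curve_of_angle_elastic :
  elastic curve = (\int[mu]_(t in `]0%R, 1%R[) (g t ^+ 2 / L)%:E)%E.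
Proof.
have E1 x : x \in `]0, 1[ -> cos_curve x = d1 curve x by move=> /(curve_d1 profile).
have E2 x : x \in `]0, 1[ -> sin_curve x = d2 curve x by move=> /(curve_d2 profile).
have [i1 ae1] := wderiv_primitive (eq_primitive E1 (primitive_cos_curve profile)).
have [i2 ae2] := wderiv_primitive (eq_primitive E2 (primitive_sin_curve profile)).
rewrite -/(dd1 curve) in i1 ae1; rewrite -/(dd2 curve) in i2 ae2.
have L0' : L != 0 by rewrite gt_eqF.
transitivity (\int[mu]_(t in `]0%R, 1%R[)
   ((- sin (vt t) * dd1 curve t + cos (vt t) * dd2 curve t) ^+ 2 / L ^+ 3)%:E)%E.
  apply: eq_integral => t /[!inE]/= tI.
  rewrite /normal /= (curve_d1 profile tI) (curve_d2 profile tI) (curve_speed profile tI).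
  rewrite /cos_curve /sin_curve; congr (EFin ((_ + _) ^+ 2 / _)).
    by rewrite mulNr mulfK// mulrC.
  by rewrite mulfK// mulrC.
have mc (u : R -> R) : continuous u ->
    measurable_fun (`]0%R, 1%R[%classic : set R) (fun t => u (vt t)).
  move=> cu; apply: (@measurableT_comp _ _ _ _ _ _ u _ vt).
    exact: continuous_measurable_fun.
  by apply: nonincreasing_measurable => // x y xy; exact: vmono.
have mcos := mc _ (@continuous_cos R).
have msin := mc _ (fun z => cvgN (@continuous_sin R z)).
have mw1 := locally_int_measurable i1; have mw2 := locally_int_measurable i2.
have mm : measurable_fun (`]0%R, 1%R[%classic : set R)
    (fun t => - sin (vt t) * dd1 curve t + cos (vt t) * dd2 curve t).
  apply: measurable_funD; apply: measurable_funM.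
  - exact: msin.
  - exact: mw1.
  - exact: mcos.
  - exact: mw2.
apply: ae_eq_integral => //.
- apply/measurable_EFinP; apply: measurable_funM => //; apply: measurable_funX.
   exact: mm.
- apply/measurable_EFinP; apply: measurable_funM => //; apply: measurable_funX.
  exact: itg_measurable ig.
have aeF := ae_filter_ringOfSetsType mu.
apply: filterS2 ae1 ae2 => t e1 e2 tI; congr EFin; rewrite e1// e2//.
have cs : sin (vt t) ^+ 2 = 1 - cos (vt t) ^+ 2 by rewrite -(cos2Dsin2 (vt t)); ring.
have -> : - sin (vt t) * (sin (vt t) * g t * L) + cos (vt t) * - (cos (vt t) * g t * L) =
    - (sin (vt t) ^+ 2 + cos (vt t) ^+ 2) * (g t * L) by ring.
by rewrite cs subrK; field.
Qed.

End curve_of_angle_pseudograph.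

(** * Concavity and comparison *)

Section cap.
Context {R : realType}.
Local Notation mu := (@lebesgue_measure R).
Local Notation itg D f := (mu.-integrable D (EFin \o f)).
Variables (vt g : R -> R) (L : R).
Hypothesis profile : angle_profile vt g L.
Let L0 := profile_length_gt0 profile.
Let vb := profile_bnd profile.
Let vmono := profile_noninc profile.
Local Notation curve := (curve vt L).
Local Notation cos_curve := (cos_curve vt L).
Local Notation sin_curve := (sin_curve vt L).
Local Notation X := (coord1 curve).
Local Notation Y := (coord2 curve).
Let icos := cos_curve_int profile.
Let isin := sin_curve_int profile.

Let X0 : X 0 = 0. Proof. by rewrite /coord1 curve0. Qed.
Let Y0 : Y 0 = 0. Proof. by rewrite /coord2 curve0. Qed.
Let X1 : X 1 = 1. Proof. by rewrite /coord1 (curve1 profile). Qed.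
Let Y1 : Y 1 = 0. Proof. by rewrite /coord2 (curve1 profile). Qed.

Let i01 (h : R -> R) (s t : R) : 0 <= s -> t <= 1 -> itg `[0, 1] h -> itg `[s, t] h.
Proof. by move=> s0 t1; exact: itg_itvS. Qed.

Let Xdiff (s t : R) : 0 <= s -> s <= t -> t <= 1 ->
  X t - X s = \int[mu]_(x in `[s, t]) cos_curve x.
Proof. by move=> s0 st t1; apply: Rintegral_itv_diff => //; exact: i01. Qed.

Let Ydiff (s t : R) : 0 <= s -> s <= t -> t <= 1 ->
  Y t - Y s = \int[mu]_(x in `[s, t]) sin_curve x.
Proof. by move=> s0 st t1; apply: Rintegral_itv_diff => //; exact: i01. Qed.

(** Signed distance from [w] to the line of angle [p] through the origin: the cross product of (cos
    p, sin p) with [w]. *)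
Definition tangent_height (p : R) (w : R * R) : R := w.2 * cos p - w.1 * sin p.

Lemma tangent_height_diff p (s t : R) : 0 <= s -> s <= t -> t <= 1 ->
  tangent_height p (curve t) - tangent_height p (curve s) =
  \int[mu]_(x in `[s, t]) (sin (vt x - p) * L).
Proof.
move=> s0 st t1.
have -> : \int[mu]_(x in `[s, t]) (sin (vt x - p) * L) =
    \int[mu]_(x in `[s, t]) (cos p * sin_curve x - sin p * cos_curve x).
  by apply: eq_Rintegral => x _; rewrite sinB /sin_curve /cos_curve; ring.
rewrite RintegralB//; last 2 first.
- by apply: itgZ => //; exact: i01.
- by apply: itgZ => //; exact: i01.
rewrite RintegralZl//; last exact: i01.
rewrite RintegralZl//; last exact: i01.
by rewrite -Xdiff// -Ydiff// /tangent_height /coord1 /coord2; ring.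
Qed.

Let bnd x t : - pi <= vt x - vt t <= pi.
Proof. by have /andP[] := vb x; have /andP[] := vb t; lra. Qed.

(** The height over the direction [vt t] changes at rate sin (vt x - vt t) L. This is nonnegative
    before [t] and nonpositive after it, because the angle decreases and its total variation is at
    most pi. *)
Lemma tangent_height_max (s t : R) : 0 <= s <= 1 -> 0 <= t <= 1 ->
  tangent_height (vt t) (curve s) <= tangent_height (vt t) (curve t).
Proof.
move=> /andP[s0 s1] /andP[t0 t1]; rewrite -subr_ge0.
have [st|ts] := leP s t.
  rewrite tangent_height_diff//; apply: Rintegral_ge0 => x /=; rewrite in_itv/= => /andP[_ xt].
  apply: mulr_ge0; last exact: ltW.
  by apply: sin_ge0_pi; have /andP[_ ->] := bnd x t; rewrite subr_ge0 vmono.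
rewrite -opprB tangent_height_diff// ?(ltW ts)// -mulN1r -RintegralZl//; last first.
  have -> : EFin \o (fun x => sin (vt x - vt t) * L) =
      EFin \o (fun x => cos (vt t) * sin_curve x - sin (vt t) * cos_curve x).
    by apply/funext => x /=; congr EFin; rewrite sinB /sin_curve /cos_curve; ring.
  by apply: itgB => //; apply: itgZ => //; exact: i01.
apply: Rintegral_ge0 => x /=; rewrite in_itv/= => /andP[tx _].
rewrite mulN1r -mulNr -sinN opprB; apply: mulr_ge0; last exact: ltW.
by apply: sin_ge0_pi; have /andP[_ ->] := bnd t x; rewrite subr_ge0 vmono.
Qed.

Lemma curve_X_mono (s t : R) : 0 <= s -> s <= t -> t <= 1 -> X s <= X t.
Proof.
move=> s0 st t1; rewrite -subr_ge0 Xdiff//; apply: Rintegral_ge0 => x _.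
exact: (cos_curve_ge0 profile).
Qed.

Lemma curve_X_lip (s t : R) : 0 <= s -> s <= t -> t <= 1 -> X t - X s <= L * (t - s).
Proof.
move=> s0 st t1; rewrite Xdiff// -Rintegral_itv_cst//; apply: le_Rintegral => //.
- exact: i01.
- exact: itg_cst.
- by move=> x _; rewrite /cos_curve ler_piMl ?(ltW L0)// cos_le1.
Qed.

Lemma curve_Y_lip (s t : R) : 0 <= s -> s <= t -> t <= 1 -> `|Y t - Y s| <= L * (t - s).
Proof.
move=> s0 st t1; rewrite Ydiff// -Rintegral_itv_cst//; apply: le_Rintegral_norm => //.
- exact: i01.
- exact: itg_cst.
- move=> x _; rewrite /sin_curve normrM (gtr0_norm L0) ler_piMl ?(ltW L0)//.
  by rewrite ler_norml sin_geN1 sin_le1.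
Qed.

(* Once the angle is vertical it stays so on one side, and the curve is then at
   abscissa 0 or 1. *)
Lemma cos_vt_eq0 (t : R) : 0 <= t <= 1 -> cos (vt t) = 0 ->
  (vt t = pi / 2 /\ X t = 0 /\ 0 <= Y t) \/ (vt t = - (pi / 2) /\ X t = 1 /\ 0 <= Y t).
Proof.
move=> /andP[t0 t1] ct.
have v2 : vt t = pi / 2 \/ vt t = - (pi / 2).
  have /andP[h1 h2] := vb t.
  move: h1 h2; rewrite !le_eqVlt => /predU1P[->|h1]; first by right.
  move=> /predU1P[->|h2]; first by left.
  by have := @cos_gt0_pihalf _ (vt t); rewrite h1 h2 ct ltxx => /(_ isT).
case: v2 => vE; [left|right]; (split; first exact: vE).
  have vx x : x \in `[0, t] -> vt x = pi / 2.
    rewrite in_itv/= => /andP[_ /vmono]; rewrite vE => h.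
    by apply/le_anti; rewrite h andbT; have /andP[] := vb x.
  split.
    have := Xdiff (lexx 0) t0 t1; rewrite X0 subr0 => ->.
    rewrite -[RHS](mul0r (t - 0)) -Rintegral_itv_cst//; apply: eq_Rintegral => x /[!inE] xI.
    by rewrite /cos_curve vx// cos_pihalf mul0r.
  have := Ydiff (lexx 0) t0 t1; rewrite Y0 subr0 => ->; apply: Rintegral_ge0 => x xI.
  by rewrite /sin_curve vx// sin_pihalf mul1r ltW.
have vx x : x \in `[t, 1] -> vt x = - (pi / 2).
  rewrite in_itv/= => /andP[/vmono + _]; rewrite vE => h.
  by apply/le_anti; rewrite h; have /andP[] := vb x.
split.
  apply/esym/eqP; rewrite -subr_eq0; apply/eqP.
  have := Xdiff t0 t1 (lexx 1); rewrite X1 => ->.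
  rewrite -[RHS](mul0r (1 - t)) -Rintegral_itv_cst//; apply: eq_Rintegral => x /[!inE] xI.
  by rewrite /cos_curve vx// cosN cos_pihalf mul0r.
have := Ydiff t0 t1 (lexx 1); rewrite Y1 sub0r => /eqP; rewrite eqr_oppLR => /eqP ->.
rewrite -mulN1r -RintegralZl//; last exact: i01.
apply: Rintegral_ge0 => x xI.
by rewrite /sin_curve vx// sinN sin_pihalf !mulN1r opprK ltW.
Qed.

Lemma curve_X_itv (t : R) : 0 <= t <= 1 -> 0 <= X t <= 1.
Proof.
by move=> /andP[t0 t1]; rewrite -{1}X0 -X1 !curve_X_mono.
Qed.

(** A nonvertical tangent supports the curve, hence passes above the end point of the curve with the
    same abscissa; vertical ones are settled by [cos_vt_eq0]. *)
Lemma curve_ends_ge0 (t : R) : 0 <= t <= 1 -> X t = 0 \/ X t = 1 -> 0 <= Y t.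
Proof.
move=> tI XE; have /orP[/eqP/(cos_vt_eq0 tI)|c0] := orbN (cos (vt t) == 0).
  by case=> -[_ [_]].
have {}c0 : 0 < cos (vt t) by rewrite lt_def c0 (cos_vt_ge0 profile).
rewrite -(pmulr_lge0 _ c0); case: XE => E.
  have := @tangent_height_max 0 t; rewrite lexx ler01 => /(_ isT tI).
  by rewrite /tangent_height -/(X t) -/(Y t) -/(X 0) -/(Y 0) X0 Y0 E; lra.
have := @tangent_height_max 1 t; rewrite lexx ler01 => /(_ isT tI).
by rewrite /tangent_height -/(X t) -/(Y t) -/(X 1) -/(Y 1) X1 Y1 E; lra.
Qed.

(** [b1] is the last time at abscissa 0 and [b2] the first at abscissa 1, both attained because the
    abscissa is Lipschitz. A vertical tangent strictly between them would, by [cos_vt_eq0],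
    contradict one of these choices. *)
Lemma cap_shaped_exists : exists b1 b2, cap_shaped b1 b2 curve.
Proof.
pose E1 : set R := [set t | 0 <= t <= 1 /\ X t = 0].
pose E2 : set R := [set t | 0 <= t <= 1 /\ X t = 1].
have E10 : E1 0 by rewrite /E1 /= lexx ler01.
have E21 : E2 1 by rewrite /E2 /= lexx ler01.
have ub1 : ubound E1 1 by move=> t [/andP[]].
have lb2 : lbound E2 0 by move=> t [/andP[]].
have s1 : has_sup E1 by split; [exists 0|exists 1].
have s2 : has_inf E2 by split; [exists 1|exists 0].
pose b1 := sup E1; pose b2 := inf E2.
have b10 : 0 <= b1 by apply: ub_le_sup s1.2 _ E10.
have b11 : b1 <= 1 by apply: ge_sup => //; exists 0.
have b20 : 0 <= b2 by apply: lb_le_inf => //; exists 1.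
have b21 : b2 <= 1 by apply: ge_inf s2.2 _ E21.
have Xb1 : X b1 = 0.
  apply/eqP; rewrite eq_le -{2}X0 curve_X_mono// andbT leNgt; apply/negP => p.
  have [t [/andP[t0 t1] tE] tb] := sup_adherent (divr_gt0 p L0) s1.
  have tb1 : t <= b1 by apply: ub_le_sup s1.2 _ _; split=> //; rewrite t0.
  have := curve_X_lip t0 tb1 b11; rewrite tE subr0.
  have : L * (b1 - t) < X b1.
    by rewrite mulrC -ltr_pdivlMr//; move: tb; rewrite -/b1; lra.
  by move=> h1 h2; have := lt_le_trans h1 h2; rewrite ltxx.
have Xb2 : X b2 = 1.
  apply/eqP; rewrite eq_le -{1}X1 curve_X_mono//= leNgt; apply/negP => p.
  have p' : 0 < 1 - X b2 by rewrite subr_gt0.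
  have [t [/andP[t0 t1] tE] tb] := inf_adherent (divr_gt0 p' L0) s2.
  have tb2 : b2 <= t by apply: ge_inf s2.2 _ _; split=> //; rewrite t0.
  have := curve_X_lip b20 tb2 t1; rewrite tE.
  have : L * (t - b2) < 1 - X b2.
    by rewrite mulrC -ltr_pdivlMr//; move: tb; rewrite -/b2; lra.
  by move=> h1 h2; have := lt_le_trans h1 h2; rewrite ltxx.
have b12 : b1 < b2.
  rewrite ltNge; apply/negP => h; have := curve_X_mono b20 h b11.
  by rewrite Xb1 Xb2 ler10.
exists b1, b2; split=> //; split=> t; rewrite in_itv/= => /andP[h1 h2].
- have t1 := le_trans h2 b11.
  by apply/le_anti; rewrite -{2}X0 curve_X_mono// andbT -Xb1 curve_X_mono.
- have t0 := le_trans b20 h1.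
  by apply/le_anti; rewrite -{1}X1 curve_X_mono//= -Xb2 curve_X_mono.
have t0 := le_lt_trans b10 h1; have t1 := lt_le_trans h2 b21.
rewrite (curve_d1 profile) ?in_itv/= ?t0//.
rewrite lt_def (cos_curve_ge0 profile) andbT; apply/eqP => c0.
have {}c0 : cos (vt t) = 0.
  by move: c0; rewrite /cos_curve => /eqP; rewrite mulf_eq0 (gt_eqF L0) orbF => /eqP.
have tI : 0 <= t <= 1 by rewrite !ltW.
have [[_ [E _]]|[_ [E _]]] := cos_vt_eq0 tI c0.
- by have := @ub_le_sup _ _ s1.2 t (conj tI E); rewrite -/b1 leNgt h1.
- by have := @ge_inf _ _ s2.2 t (conj tI E); rewrite -/b2 leNgt h2.
Qed.

End cap.

Lemma le_of_linear_bound {R : realFieldType} (y c M e : R) : 0 < M -> 0 < e ->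
  (forall d, 0 < d -> d < e -> y <= c + M * d) -> y <= c.
Proof.
move=> M0 e0 H; rewrite leNgt; apply/negP => p.
pose d := Num.min (e / 2) ((y - c) / M / 2).
have d0 : 0 < d by rewrite lt_min !divr_gt0// subr_gt0.
have d1 : d <= e / 2 by rewrite ge_min lexx.
have d2 : d <= (y - c) / M / 2 by rewrite ge_min lexx orbT.
have de : d < e by lra.
have := H d d0 de.
have : M * d <= M * ((y - c) / M / 2) by rewrite ler_pM2l.
have -> : M * ((y - c) / M / 2) = (y - c) / 2 by field; rewrite gt_eqF.
lra.
Qed.

Lemma cos_antitone {R : realType} (x y : R) : 0 <= x -> x <= y -> y <= pi / 2 ->
  cos y <= cos x.
Proof.
move=> x0 xy yp; have p0 := pi_ge0 R; rewrite leNgt; apply/negP.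
by rewrite ltr_cos ?in_itv/=; [lra|apply/andP; split; lra|apply/andP; split; lra].
Qed.

Section cap_graph.
Context {R : realType}.
Local Notation mu := (@lebesgue_measure R).
Local Notation itg D f := (mu.-integrable D (EFin \o f)).
Variables (vt g : R -> R) (L : R).
Hypothesis profile : angle_profile vt g L.
Let L0 := profile_length_gt0 profile.
Let vb := profile_bnd profile.
Let vmono := profile_noninc profile.
Local Notation curve := (curve vt L).
Local Notation cos_curve := (cos_curve vt L).
Local Notation X := (coord1 curve).
Local Notation Y := (coord2 curve).
Variables (b1 b2 : R).
Hypothesis cap : cap_shaped b1 b2 curve.
Local Notation u := (graph_reparam b1 b2 curve).

Let b12 : b1 < b2. Proof. by have [[]] := cap. Qed.
Let b10 : 0 <= b1. Proof. by have [[]] := cap. Qed.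
Let b21 : b2 <= 1. Proof. by have [[]] := cap. Qed.

Let tangent_heightE (p t : R) : tangent_height p (curve t) = Y t * cos p - X t * sin p.
Proof. by []. Qed.

Let sub (t : R) : t \in `]b1, b2[ -> t \in `]0, 1[.
Proof. exact: itvoo_widen. Qed.

Let Xb1 : X b1 = 0.
Proof. by have [_ [H _ _]] := cap; apply: H; rewrite in_itv/= b10 lexx. Qed.

Let Xb2 : X b2 = 1.
Proof. by have [_ [_ H _]] := cap; apply: H; rewrite in_itv/= b21 lexx. Qed.

Let cos0 (t : R) : t \in `]b1, b2[ -> 0 < cos_curve t.
Proof.
by move=> tI; rewrite -(curve_d1 profile (sub tI)); have [_ [_ _]] := cap; exact.
Qed.

Let cos0' (t : R) : t \in `]b1, b2[ -> 0 < cos (vt t).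
Proof. by move=> /cos0; rewrite /cos_curve pmulr_lgt0. Qed.

Let cX : {within `[b1, b2], continuous X}.
Proof.
apply: (continuous_subspaceW _ (indefinite_continuous (cos_curve_int profile))).
by apply: subset_itv; rewrite bnd_simp.
Qed.

Let dX (t : R) : t \in `]b1, b2[ -> is_derive t 1 X (cos_curve t).
Proof.
by move=> /sub; exact: (indefinite_is_derive (cos_curve_int profile) (cos_curve_cont profile)).
Qed.

Let cc (t : R) : t \in `]b1, b2[ -> 0 <= t <= 1.
Proof. by move=> /sub; rewrite in_itv/= => /andP[/ltW -> /ltW ->]. Qed.

Lemma graph_reparam_param (x : R) : x \in `]0, 1[ ->
  exists2 t, t \in `]b1, b2[ & X t = x /\ u x = Y t.
Proof.
move=> xI; have := inv_on_right b12 cX dX cos0 (x := x); rewrite Xb1 Xb2 => /(_ xI)[tI tE].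
exists (inv_on b1 b2 X x) => //; split=> //.
by move: xI; rewrite in_itv/= /graph_reparam => /andP[/gt_eqF -> /lt_eqF ->].
Qed.

Lemma graph_reparam_closed (x : R) : x \in `[0, 1] ->
  exists2 t, 0 <= t <= 1 & X t = x /\ u x = Y t.
Proof.
rewrite in_itv/= => /andP[x0 x1].
have [->|xn0] := eqVneq x 0.
  exists b1; first by rewrite b10 (le_trans (ltW b12)).
  by rewrite /graph_reparam eqxx.
have [->|xn1] := eqVneq x 1.
  exists b2; first by rewrite b21 andbT (le_trans b10 (ltW b12)).
  by rewrite /graph_reparam eqxx oner_eq0.
have [|t tI E] := @graph_reparam_param x; last by exists t => //; exact: cc.
by rewrite in_itv/= !lt_neqAle eq_sym xn0 xn1 x0.
Qed.

Lemma graph_reparam_coord1 (t : R) : t \in `]b1, b2[ -> u (X t) = Y t.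
Proof.
move=> tI; have := image_itv cX dX cos0 tI; rewrite Xb1 Xb2 => /[dup] XI.
move=> /graph_reparam_param[s sI [E ->]].
by congr Y; rewrite -(inv_on_left cX dX cos0 sI) E (inv_on_left cX dX cos0 tI).
Qed.

(* The tangent at each interior point is a supporting line. *)
Lemma graph_reparam_concave : concave_on `[0, 1] u.
Proof.
move=> p x y /[!inE]/= xI yI; set z := conv p x y.
have p0 : 0 <= p%:num by [].
have p1 : p%:num <= 1 by [].
have zE : z = p%:num * x + (1 - p%:num) * y by rewrite /z [LHS]convRE.
have -> : conv p (- u x : R^o) (- u y) = p%:num * - u x + (1 - p%:num) * - u y.
  by rewrite [LHS]convRE.
move: p0 p1 zE; move: (p%:num) => q q0 q1 zE.
move: (xI) (yI); rewrite !in_itv/= => /andP[x0 x1] /andP[y0 y1].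
have z0 : 0 <= z by rewrite zE addr_ge0// mulr_ge0// subr_ge0.
have z1 : z <= 1.
  have h1 : q * x <= q by rewrite ler_piMr.
  have h2 : (1 - q) * y <= 1 - q by rewrite ler_piMr// subr_ge0.
  by rewrite zE; lra.
(* The tangent may be vertical over 0 and 1, so no supporting line is used there; each of [x], [y]
   that carries a nonzero weight must then equal [z]. *)
have ends : z = 0 \/ z = 1 -> - u z <= q * - u x + (1 - q) * - u y.
  move=> zz; suff [h1 h2] : q * u x = q * u z /\ (1 - q) * u y = (1 - q) * u z by lra.
  have [h1 h2] : q * (x - z) = 0 /\ (1 - q) * (y - z) = 0.
    have h3 : q * (x - z) + (1 - q) * (y - z) = 0 by rewrite {1 2}zE; ring.
    have q1' : 0 <= 1 - q by rewrite subr_ge0.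
    case: zz => zz; rewrite zz in h3 *.
      have h1 : 0 <= q * (x - 0) by rewrite subr0 mulr_ge0.
      have h2 : 0 <= (1 - q) * (y - 0) by rewrite subr0 mulr_ge0.
      by split; lra.
    have h1 : q * (x - 1) <= 0 by rewrite mulr_ge0_le0// subr_le0.
    have h2 : (1 - q) * (y - 1) <= 0 by rewrite mulr_ge0_le0// subr_le0.
    by split; lra.
  by split; [move/eqP: h1|move/eqP: h2]; rewrite mulf_eq0 => /orP[/eqP ->|];
    rewrite ?mul0r// subr_eq0 => /eqP ->.
have [zz|zn0] := eqVneq z 0; first by apply: ends; left.
have [zz|zn1] := eqVneq z 1; first by apply: ends; right.
have zI : z \in `]0, 1[ by rewrite in_itv/= !lt_neqAle eq_sym zn0 zn1 z0.
have [t tI [tE ->]] := graph_reparam_param zI.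
have [sx sxI [sxE ->]] := graph_reparam_closed xI.
have [sy syI [syE ->]] := graph_reparam_closed yI.
have hx := tangent_height_max profile sxI (cc tI).
have hy := tangent_height_max profile syI (cc tI).
have c0 := cos0' tI.
move: hx hy; rewrite !tangent_heightE sxE syE tE.
move: (Y sx) (Y sy) (Y t) (cos (vt t)) (sin (vt t)) c0 => ax ay az c s c0 hx hy.
suff : (q * ax + (1 - q) * ay) * c <= az * c by rewrite ler_pM2r//; lra.
have q1' : 0 <= 1 - q by rewrite subr_ge0.
have h1 := ler_wpM2l q0 hx; have h2 := ler_wpM2l q1' hy.
rewrite zE in h1 h2; lra.
Qed.

(* The tangent may be vertical at the end points of the cap, which are therefore
   approached from interior points. *)
Lemma le_graph_left (y : R) :
  (forall t, t \in `]b1, b2[ -> y * cos (vt t) <= tangent_height (vt t) (curve t)) -> y <= Y b1.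
Proof.
move=> H; pose t1 := (b1 + b2) / 2.
have [bt1 t1b] : b1 < t1 /\ t1 < b2 by have := b12; rewrite /t1; split; lra.
have t1I : t1 \in `]b1, b2[ by rewrite in_itv/= bt1.
(* If the tangent at [t] descends, its angle lies between that at [t1] and 0, so [K] bounds its
   steepness; a rising tangent already gives the bound [y <= Y t]. The Lipschitz bounds on both
   coordinates then yield the constant [(1 + K) * L]. *)
have c1 := cos0' t1I; pose K := (cos (vt t1))^-1.
have K0 : 0 <= K by rewrite invr_ge0 ltW.
have KL : 0 < (1 + K) * L by rewrite mulr_gt0// ltr_wpDr.
apply: (@le_of_linear_bound _ _ _ ((1 + K) * L) (t1 - b1)) => //.
  by rewrite subr_gt0.
move=> d d0 dt; pose t := b1 + d.
have bt : b1 < t by rewrite ltrDl.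
have tt1 : t < t1 by rewrite /t -ltrBrDl.
have tI : t \in `]b1, b2[ by rewrite in_itv/= bt (lt_trans tt1).
have ct := cos0' tI; have := H t tI; rewrite tangent_heightE => Ht.
have /andP[t0 t1'] := cc tI.
have tb : t - b1 = d by rewrite /t; ring.
have hX := curve_X_lip profile b10 (ltW bt) t1'; rewrite Xb1 subr0 tb in hX.
have hY := le_trans (ler_norm _) (curve_Y_lip profile b10 (ltW bt) t1'); rewrite tb in hY.
have X0 : 0 <= X t by have /andP[] := curve_X_itv profile (cc tI).
suff : y <= Y t + X t * K by have := ler_wpM2r K0 hX; lra.
have [s0|s0] := leP 0 (sin (vt t)).
  have : y * cos (vt t) <= Y t * cos (vt t).
    by rewrite (le_trans Ht)// gerBl mulr_ge0.
  rewrite ler_pM2r// => h; rewrite (le_trans h)// lerDl.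
  by rewrite mulr_ge0.
have cc1 : cos (vt t1) <= cos (vt t).
  rewrite -[leRHS]cosN -[leLHS]cosN; apply: cos_antitone.
  - rewrite oppr_ge0 leNgt; apply/negP => v0; move: s0; rewrite ltNge sin_ge0_pi//.
    by have /andP[_ h] := vb t; rewrite (ltW v0) (le_trans h)//; have := pi_ge0 R; lra.
  - by rewrite lerN2 vmono// ltW.
  - by have /andP[h _] := vb t1; rewrite lerNl.
rewrite -(ler_pM2r ct) (le_trans Ht)// mulrDl lerD2l -mulrN -mulrA ler_wpM2l//.
have h : - sin (vt t) <= 1 by rewrite lerNl; exact: sin_geN1.
by rewrite (le_trans h)// /K mulrC ler_pdivlMr// mul1r.
Qed.

(** Mirror image of [le_graph_left]: now the rising tangents are those controlled by [K], and the
    term [sin (vt t)] comes from the abscissa 1. *)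
Lemma le_graph_right (y : R) :
  (forall t, t \in `]b1, b2[ -> y * cos (vt t) - sin (vt t) <= tangent_height (vt t) (curve t)) ->
  y <= Y b2.
Proof.
move=> H; pose t1 := (b1 + b2) / 2.
have [bt1 t1b] : b1 < t1 /\ t1 < b2 by have := b12; rewrite /t1; split; lra.
have t1I : t1 \in `]b1, b2[ by rewrite in_itv/= bt1.
have c1 := cos0' t1I; pose K := (cos (vt t1))^-1.
have K0 : 0 <= K by rewrite invr_ge0 ltW.
have KL : 0 < (1 + K) * L by rewrite mulr_gt0// ltr_wpDr.
apply: (@le_of_linear_bound _ _ _ ((1 + K) * L) (b2 - t1)) => //.
  by rewrite subr_gt0.
move=> d d0 dt; pose t := b2 - d.
have bt : t < b2 by rewrite /t gtrBl.
have tt1 : t1 < t by rewrite /t ltrBrDl -ltrBrDr.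
have tI : t \in `]b1, b2[ by rewrite in_itv/= bt (lt_trans bt1).
have ct := cos0' tI; have := H t tI; rewrite tangent_heightE => Ht.
have /andP[t0 t1'] := cc tI.
have tb : b2 - t = d by rewrite /t; ring.
have hX := curve_X_lip profile t0 (ltW bt) b21; rewrite Xb2 tb in hX.
have := curve_Y_lip profile t0 (ltW bt) b21; rewrite distrC tb => /(le_trans (ler_norm _)) hY.
have X0 : 0 <= 1 - X t by rewrite subr_ge0; have /andP[] := curve_X_itv profile (cc tI).
suff : y <= Y t + (1 - X t) * K by have := ler_wpM2r K0 hX; lra.
have [s0|s0] := leP (sin (vt t)) 0.
  have : y * cos (vt t) <= Y t * cos (vt t).
    by have := mulr_ge0_le0 X0 s0; lra.
  rewrite ler_pM2r// => h; rewrite (le_trans h)// lerDl.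
  by rewrite mulr_ge0.
have cc1 : cos (vt t1) <= cos (vt t).
  apply: cos_antitone.
  - rewrite leNgt; apply/negP => v0; move: s0; rewrite ltNge -[sin _]opprK -sinN oppr_le0.
    rewrite sin_ge0_pi// oppr_ge0 (ltW v0).
    by have /andP[h _] := vb t; rewrite lerNl (le_trans _ h)//; have := pi_ge0 R; lra.
  - by rewrite vmono// ltW.
  - by have /andP[] := vb t1.
rewrite -(ler_pM2r ct).
have h : (1 - X t) * sin (vt t) <= (1 - X t) * K * cos (vt t).
  rewrite -mulrA ler_wpM2l// (le_trans (sin_le1 _))// /K mulrC ler_pdivlMr// mul1r//.
by lra.
Qed.

End cap_graph.

(** * The new curve lies above the old one and above the obstacle *)

Section above.
Context {R : realType}.
Local Notation mu := (@lebesgue_measure R).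
Local Notation itg D f := (mu.-integrable D (EFin \o f)).
Variables (vt g : R -> R) (L : R).
Hypothesis profile : angle_profile vt g L.
Let L0 := profile_length_gt0 profile.
Let vb := profile_bnd profile.
Let vmono := profile_noninc profile.
Local Notation curve := (curve vt L).
Local Notation X := (coord1 curve).
Local Notation Y := (coord2 curve).
Variables (psi : R -> R) (gamma0 : R -> R * R).
Hypotheses (psi0 : psi 0 < 0) (psi1 : psi 1 < 0) (gamma0_P : Ppsi psi gamma0)
  (X0_itv : forall t, t \in `[0, 1] -> 0 <= coord1 gamma0 t <= 1)
  (dominated : forall p t, - (pi / 2) <= p <= pi / 2 -> t \in `[0, 1] ->
    tangent_height p (gamma0 t) <=
    \int[mu]_(x in `]0, 1[) (Num.max 0 (sin (vt x - p)) * L)).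

(** Since [vt] decreases, sin (vt x - vt t) is nonnegative before [t] and nonpositive after, so the
    positive part cuts the integral exactly at [t]. *)
Lemma tangent_height_integral (t : R) : 0 <= t <= 1 ->
  \int[mu]_(x in `]0, 1[) (Num.max 0 (sin (vt x - vt t)) * L) =
  tangent_height (vt t) (curve t).
Proof.
move=> /andP[t0 t1]; pose h x := Num.max 0 (sin (vt x - vt t)) * L.
have ih : itg `[0, 1] h.
  apply: (@itg_bndM _ _ _ (cst L) 1) => //; last exact: itg_cst.
    have cm : continuous (fun z => Num.max 0 (sin (z - vt t))).
      move=> z; apply: (@continuous_max _ _ (cst 0) (fun z => sin (z - vt t))); first exact: cvg_cst.
      apply: (@continuous_comp _ _ _ (fun z => z - vt t) sin); last exact: continuous_sin.
      by apply: cvgB; [exact: cvg_id|exact: cvg_cst].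
    apply: (@measurableT_comp _ _ _ _ _ _ _ _ vt (continuous_measurable_fun cm)).
    by apply: nonincreasing_measurable => // x y xy; exact: vmono.
  move=> x _; have m0 : 0 <= Num.max 0 (sin (vt x - vt t)) by rewrite le_max lexx.
  by rewrite (ger0_norm m0) ge_max ler01 sin_le1.
have bnd x y : - pi <= vt x - vt y <= pi.
  by have /andP[] := vb x; have /andP[] := vb y; lra.
have -> : \int[mu]_(x in `]0, 1[) h x = \int[mu]_(x in `[0, 1]) h x.
  rewrite -Rintegral_itv_obnd_cbnd; last first.
    by apply: itgS ih => //; exact: subset_itv_oc_cc.
  by rewrite -Rintegral_itv_bndo_bndc//; apply: itgS ih => //; exact: subset_itv_oo_cc.
rewrite (Rintegral_itv_split t0 t1 ih).
have -> : \int[mu]_(x in `[t, 1]) h x = 0.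
  rewrite -[RHS](mul0r (1 - t)) -Rintegral_itv_cst//; apply: eq_Rintegral => x /[!inE]/=.
  rewrite in_itv/= => /andP[tx _]; rewrite /h max_l ?mul0r//.
  rewrite -oppr_ge0 -sinN opprB; apply: sin_ge0_pi.
  by have /andP[_ ->] := bnd t x; rewrite subr_ge0 vmono.
have -> : \int[mu]_(x in `[0, t]) h x = \int[mu]_(x in `[0, t]) (sin (vt x - vt t) * L).
  apply: eq_Rintegral => x /[!inE]/=; rewrite in_itv/= => /andP[_ xt].
  rewrite /h max_r//; apply: sin_ge0_pi.
  by have /andP[_ ->] := bnd x t; rewrite subr_ge0 vmono.
rewrite addr0 -(tangent_height_diff profile) //.
by rewrite [X in _ - X](_ : _ = 0) ?subr0// /tangent_height curve0 /= !mul0r subr0.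
Qed.

Variables (b1 b2 : R).
Hypothesis cap : cap_shaped b1 b2 curve.
Local Notation u := (graph_reparam b1 b2 curve).

Let in01 (t : R) : t \in `]b1, b2[ -> 0 <= t <= 1.
Proof.
have [[b10 _ b21] _] := cap; rewrite in_itv/= => /andP[h1 h2].
by rewrite (le_trans b10 (ltW h1)) (le_trans (ltW h2) b21).
Qed.

Let height_le (t s : R) : 0 <= t <= 1 -> s \in `[0, 1] ->
  tangent_height (vt t) (gamma0 s) <= tangent_height (vt t) (curve t).
Proof. by move=> tI sI; rewrite -tangent_height_integral//; exact: dominated. Qed.

Lemma graph_reparam_above : lies_above u gamma0.
Proof.
move=> s sI; have /andP[x0 x1] := X0_itv sI.
have tE p : tangent_height p (gamma0 s) = coord2 gamma0 s * cos p - coord1 gamma0 s * sin p.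
  by [].
have [E|xn0] := eqVneq (coord1 gamma0 s) 0.
  rewrite E /graph_reparam eqxx; apply: (le_graph_left profile cap) => t tI.
  by have := height_le (in01 tI) sI; rewrite tE E mul0r subr0.
have [E|xn1] := eqVneq (coord1 gamma0 s) 1.
  rewrite E /graph_reparam oner_eq0 eqxx; apply: (le_graph_right profile cap) => t tI.
  by have := height_le (in01 tI) sI; rewrite tE E mul1r.
have xI : coord1 gamma0 s \in `]0, 1[ by rewrite in_itv/= !lt_neqAle eq_sym xn0 xn1 x0.
have [t tI [XE ->]] := graph_reparam_param profile cap xI.
have := height_le (in01 tI) sI; rewrite tE -XE.
have -> : tangent_height (vt t) (curve t) = Y t * cos (vt t) - X t * sin (vt t) by [].
rewrite lerD2r ler_pM2r//.
have [_ [_ _ /(_ t tI)]] := cap; rewrite (curve_d1 profile) /cos_curve ?pmulr_lgt0//.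
have [[b10 _ b21] _] := cap; move: tI; rewrite !in_itv/= => /andP[h1 h2].
by rewrite (le_lt_trans b10 h1) (lt_le_trans h2 b21).
Qed.

(** For the obstacle, the intermediate value theorem provides a point of [gamma0] with the same
    abscissa, which lies above [psi] and below the cap. This would fail on vertical pieces over 0
    and 1, where the obstacle is negative and the curve is not. *)
Lemma curve_Bset : Bset psi gamma0 curve.
Proof.
have [pg0 g00 g01 obs0] := gamma0_P.
split; last by exists b1, b2; split=> //; exact: graph_reparam_above.
split.
- exact: curve_pseudograph profile.
- exact: curve0.
- exact: curve1 profile.
move=> t; rewrite in_itv/= => tI.
have [XE|X0] := eqVneq (X t) 0.
  by rewrite XE (le_trans (ltW psi0))// (curve_ends_ge0 profile tI)//; left.
have [XE|X1] := eqVneq (X t) 1.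
  by rewrite XE (le_trans (ltW psi1))// (curve_ends_ge0 profile tI)//; right.
have /andP[t0 t1] := tI.
have [[b10 _ b21] [Xl Xr _]] := cap.
have tb : t \in `]b1, b2[.
  rewrite in_itv/= !ltNge; apply/andP; split; apply/negP => h.
    by move/eqP: X0; apply; apply: Xl; rewrite in_itv/= t0.
  by move/eqP: X1; apply; apply: Xr; rewrite in_itv/= h.
have c0 : {within `[0, 1], continuous (coord1 gamma0)}.
  move=> x; have H := pg_continuous pg0 (x := x).
  have F : fst @ nbhs (gamma0 x) --> (gamma0 x).1 by exact: cvg_fst.
  exact: (@cvg_comp _ _ _ gamma0 fst _ _ _ H F).
have [|s sI sE] := IVT ler01 c0 (v := X t).
  rewrite /coord1 g00 g01 /= min_l ?ler01// max_r ?ler01//.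
  exact: (curve_X_itv profile).
rewrite -(graph_reparam_coord1 profile cap tb) -sE.
exact: le_trans (obs0 s sI) (graph_reparam_above sI).
Qed.

End above.

(** * The tangent angle of a pseudograph *)

Section pseudograph_regularity.
Context {R : realType}.
Local Notation mu := (@lebesgue_measure R).
Local Notation itg D f := (mu.-integrable D (EFin \o f)).

(** The local W^{2,1} condition makes [f] of class C^1 inside, while the W^{1,1} condition makes the
    derivative integrable up to the ends; uniqueness identifies the two derivatives almost
    everywhere. *)
Lemma sobolev_coord_regular (f : R -> R) : {within `[0, 1], continuous f} ->
  Wkp 1 1%E 0 1 f -> Wkp_loc 2 1%E 0 1 f ->
  [/\ primitive 0 1 f (derive1 f), itg `]0, 1[ (derive1 f),
      primitive 0 1 (derive1 f) (wderiv 0 1 (derive1 f)) &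
      forall x, x \in `]0, 1[ -> derivable f x 1].
Proof.
move=> cf [_ [g wg [/Lp1P ig _]]] [_ [g' wg' [/Lp_loc1P lg' [h wh [/Lp_loc1P lh _]]]]].
have {cf} cf' : {in `]0, 1[, continuous f}.
  by have /(continuous_within_itvP _ ltr01)[] := cf.
have [cd df _ pd] := weak_derivative2_regular cf' lg' lh wg' wh.
have pf := derive_primitive df cd.
have {}ig : itg `]0, 1[ g by exact: ig.
have lg : locally_int 0 1 g.
  move=> s t s0 t1; apply: itgS ig => // x /=; rewrite !in_itv/= => /andP[sx xt].
  by rewrite (lt_le_trans s0 sx) (le_lt_trans xt t1).
have [F pF fF] := weak_derivative_primitive (continuous_locally_int cf') lg wg.
have pf' : primitive 0 1 f g.
  apply: (eq_primitive _ pF) => x xI; apply/esym.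
  exact: (continuous_ae_eq cf' (primitive_continuous pF) fF).
have [lw ae] := wderiv_primitive pd.
split=> //.
- apply: (integrable_ae_eq _ ig) => //; first exact: locally_int_measurable pf.1.
  exact: primitive_unique pf' pf.
- apply: (primitive_ae_eq lw _ pd).
  apply: filterS ae; first exact: (ae_filter_ringOfSetsType mu).
  by move=> x H /H ->.
Qed.

Lemma within_coord1 (A : set R) (gamma : R -> R * R) :
  {within A, continuous gamma} -> {within A, continuous (coord1 gamma)}.
Proof.
move=> cg x; have H := cg x.
have F : fst @ nbhs (gamma x) --> (gamma x).1 by exact: cvg_fst.
exact: (@cvg_comp _ _ _ gamma fst _ _ _ H F).
Qed.

Lemma within_coord2 (A : set R) (gamma : R -> R * R) :
  {within A, continuous gamma} -> {within A, continuous (coord2 gamma)}.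
Proof.
move=> cg x; have H := cg x.
have F : snd @ nbhs (gamma x) --> (gamma x).2 by exact: cvg_snd.
exact: (@cvg_comp _ _ _ gamma snd _ _ _ H F).
Qed.

Variable gamma : R -> R * R.
Hypotheses (pg : pseudograph gamma) (start : gamma 0 = (0, 0)) (stop : gamma 1 = (1, 0)).
Local Notation X := (coord1 gamma).
Local Notation Y := (coord2 gamma).
Local Notation v1 := (d1 gamma).
Local Notation v2 := (d2 gamma).
Local Notation e1 := (dd1 gamma).
Local Notation e2 := (dd2 gamma).
Local Notation sp := (spd v1 v2).
Local Notation th := (angle v1 v2).

Let reg1 := sobolev_coord_regular (within_coord1 (pg_continuous pg)) (pg_W11 pg).1 (pg_W21 pg).1.
Let reg2 := sobolev_coord_regular (within_coord2 (pg_continuous pg)) (pg_W11 pg).2 (pg_W21 pg).2.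

Lemma pg_primitive1 : primitive 0 1 X v1. Proof. by have [] := reg1. Qed.
Lemma pg_primitive2 : primitive 0 1 Y v2. Proof. by have [] := reg2. Qed.
Lemma pg_integrable1 : itg `]0, 1[ v1. Proof. by have [] := reg1. Qed.
Lemma pg_integrable2 : itg `]0, 1[ v2. Proof. by have [] := reg2. Qed.
Lemma pg_primitive_d1 : primitive 0 1 v1 e1. Proof. by have [] := reg1. Qed.
Lemma pg_primitive_d2 : primitive 0 1 v2 e2. Proof. by have [] := reg2. Qed.
Lemma pg_derivable1 (t : R) : t \in `]0, 1[ -> is_derive t 1 X (v1 t).
Proof.
by move=> tI; have [_ _ _ /(_ t tI)] := reg1; rewrite /d1 derive1E; exact: derivableP.
Qed.

Lemma pg_diff1 (s t : R) : 0 <= s -> s <= t -> t <= 1 ->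
  X t - X s = \int[mu]_(x in `]s, t[) v1 x.
Proof.
exact: (primitive_closed ltr01 (within_coord1 (pg_continuous pg)) pg_integrable1 pg_primitive1).
Qed.

Lemma pg_diff2 (s t : R) : 0 <= s -> s <= t -> t <= 1 ->
  Y t - Y s = \int[mu]_(x in `]s, t[) v2 x.
Proof.
exact: (primitive_closed ltr01 (within_coord2 (pg_continuous pg)) pg_integrable2 pg_primitive2).
Qed.

Lemma pg_X_itv (t : R) : t \in `[0, 1] -> 0 <= X t <= 1.
Proof.
rewrite in_itv/= => /andP[t0 t1].
have H s s' : 0 <= s -> s <= s' -> s' <= 1 -> X s <= X s'.
  move=> s0 ss s1; rewrite -subr_ge0 pg_diff1//; apply: Rintegral_ge0 => x /=.
  rewrite in_itv/= => /andP[sx xs]; apply: (pg_monotone pg).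
  by rewrite in_itv/= (le_lt_trans s0 sx) (lt_le_trans xs s1).
have := H 0 t (lexx 0) t0 t1; have := H t 1 t0 t1 (lexx 1).
by rewrite /coord1 start stop /= => -> ->.
Qed.

Lemma spd_measurable : measurable_fun (`]0, 1[%classic : set R) sp.
Proof.
have [e e0 H] := pg_immersed pg.
exact: (locally_int_measurable (continuous_locally_int
  (spd_continuous pg_primitive_d1 pg_primitive_d2))).
Qed.

Lemma spd_le (t : R) : sp t <= `|v1 t| + `|v2 t|.
Proof.
rewrite /spd -[leRHS]ger0_norm ?addr_ge0// -sqrtr_sqr ler_wsqrtr// sqrrD.
by rewrite !real_normK ?num_real// lerD2r lerDl mulrn_wge0// mulr_ge0.
Qed.

Lemma spd_ge1 (t : R) : `|v1 t| <= sp t.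
Proof. by rewrite /spd -sqrtr_sqr ler_wsqrtr// lerDl sqr_ge0. Qed.

Lemma spd_integrable : itg `]0, 1[ sp.
Proof.
apply: (@itg_le _ _ _ (fun t => `|v1 t| + `|v2 t|)) => //.
- exact: spd_measurable.
- by move=> t _; rewrite ger0_norm ?sqrtr_ge0//; exact: spd_le.
apply: itgD => //; apply: itg_abs => //; [exact: pg_integrable1|exact: pg_integrable2].
Qed.

Lemma pg_angle_cos_sin (t : R) : t \in `]0, 1[ ->
  [/\ 0 < sp t, cos (th t) = v1 t / sp t, sin (th t) = v2 t / sp t &
      - (pi / 2) <= th t <= pi / 2].
Proof.
have [e e0 H] := pg_immersed pg => tI.
have [] := angle_cos_sin e0 (pg_monotone pg) H tI.
by have := spd_gt0 e0 H tI.
Qed.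

Lemma pg_angle_continuous : {in `]0, 1[, continuous th}.
Proof.
have [e e0 H] := pg_immersed pg.
exact: (angle_continuous e0 pg_primitive_d1 pg_primitive_d2 (pg_monotone pg) H).
Qed.

Definition angle_map : weighted_map R :=
  @WeightedMap R `]0, 1[%classic th sp (measurable_itv _)
    (locally_int_measurable (continuous_locally_int pg_angle_continuous))
    spd_integrable (fun t _ => sqrtr_ge0 _).

Lemma pg_turning_int : locally_int 0 1 (turning v1 v2 e1 e2).
Proof.
have [e e0 H] := pg_immersed pg.
exact: (turning_locally_int e0 pg_primitive_d1 pg_primitive_d2 H).
Qed.

Lemma pg_angle_increment (s t : R) : 0 < s -> s <= t -> t < 1 ->
  `|th t - th s| <= \int[mu]_(x in `[s, t]) turning v1 v2 e1 e2 x.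
Proof.
have [e e0 H] := pg_immersed pg.
exact: (angle_increment e0 pg_primitive_d1 pg_primitive_d2 (pg_monotone pg) H).
Qed.

Lemma pg_elastic :
  elastic gamma = (\int[mu]_(t in `]0%R, 1%R[) (turning v1 v2 e1 e2 t ^+ 2 / sp t)%:E)%E.
Proof.
apply: eq_integral => t /[!inE]/= tI; have [s0 _ _ _] := pg_angle_cos_sin tI.
have sn : sp t != 0 by rewrite gt_eqF.
congr EFin; rewrite /normal /turning /= -[speed gamma t]/(sp t).
rewrite expr_div_n real_normK ?num_real//.
by field.
Qed.

Lemma image_measure_angleT :
  image_measure angle_map setT = curve_length gamma.
Proof. by rewrite /image_measure preimage_setT setIT. Qed.

Lemma curve_length_total : curve_length gamma = (total_weight angle_map)%:E.
Proof.
rewrite /total_weight image_measure_angleT fineK//.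
exact: (@integrable_fin_num _ _ _ mu _ (measurable_itv _) _ spd_integrable).
Qed.

(** The length is at least the horizontal displacement. In particular it is positive, which the
    rearrangement requires. *)
Lemma total_weight_ge1 : 1 <= total_weight angle_map.
Proof.
rewrite /total_weight image_measure_angleT.
have -> : 1 = \int[mu]_(x in `]0, 1[) v1 x.
  by rewrite -pg_diff1// /coord1 start stop /= subr0.
apply: (@le_Rintegral _ _ _ mu _ v1 sp (measurable_itv _) pg_integrable1 spd_integrable).
by move=> x _; exact: le_trans (ler_norm _) (spd_ge1 x).
Qed.

End pseudograph_regularity.

Section pseudograph_rearrangement.
Context {R : realType}.
Local Notation mu := (@lebesgue_measure R).
Local Notation itg D f := (mu.-integrable D (EFin \o f)).
Local Notation I01 := (`]0%R, 1%R[%classic : set R).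
Variable gamma : R -> R * R.
Hypotheses (pg : pseudograph gamma) (start : gamma 0 = (0, 0)) (stop : gamma 1 = (1, 0)).
Local Notation v1 := (d1 gamma).
Local Notation v2 := (d2 gamma).
Local Notation sp := (spd v1 v2).
Local Notation th := (angle v1 v2).
Local Notation w := (angle_map pg).
Local Notation N := (image_measure w).
Local Notation vt := (rearr w (pi / 2)).
Local Notation L := (total_weight w).

Lemma pihalf_ge0 : 0 <= pi / 2 :> R.
Proof. by rewrite divr_ge0 ?pi_ge0. Qed.

Lemma pg_angle_bnd (t : R) : t \in `]0, 1[ -> - (pi / 2) <= th t <= pi / 2.
Proof. by move=> /(pg_angle_cos_sin pg)[]. Qed.

Lemma pg_weight_gt0 : 0 < fine (N setT).
Proof. exact: (lt_le_trans ltr01 (total_weight_ge1 pg start stop)). Qed.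

Let c0 := pihalf_ge0.
Let thc := pg_angle_bnd.
Let wpos := pg_weight_gt0.
Let L0 : 0 < L := wpos.
Let wD : wm_dom w = I01 := erefl.
Let rearrb := rearr_bnd w c0.

Let mvt (D : set R) : measurable D -> measurable_fun D vt.
Proof. exact: (rearr_measurable c0 wpos). Qed.

Lemma rearr_moment (phi : R -> R) : measurable_fun setT phi -> (forall z, 0 <= phi z) ->
  (\int[mu]_(s in I01) (phi (vt s) * L)%:E = \int[mu]_(t in I01) (phi (th t) * sp t)%:E)%E.
Proof.
move=> mphi phi0.
have := @integral_rearr _ w _ wD c0 thc wpos phi setT measurableT mphi phi0.
rewrite preimage_setT setIT => <-.
have := @integral_image_measure _ w phi setT measurableT mphi phi0.
by rewrite preimage_setT setIT.
Qed.

Lemma rearr_moment_real (phi : R -> R) : measurable_fun setT phi -> (forall z, 0 <= phi z) ->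
  \int[mu]_(s in `]0, 1[) (phi (vt s) * L) = \int[mu]_(t in `]0, 1[) (phi (th t) * sp t).
Proof. by move=> mphi phi0; rewrite /Rintegral rearr_moment. Qed.

Lemma rearr_cos : \int[mu]_(s in `]0, 1[) (cos (vt s) * L) = 1.
Proof.
(* The moment formula takes nonnegative functions on the whole line; on the angles that occur the
   absolute value is harmless. *)
have mcos : measurable_fun setT (fun z : R => `|cos z|).
  by apply: measurableT_comp => //; exact: continuous_measurable_fun (@continuous_cos R).
have := @rearr_moment_real (fun z => `|cos z|) mcos (fun z => normr_ge0 _).
have -> : \int[mu]_(s in `]0, 1[) (`|cos (vt s)| * L) = \int[mu]_(s in `]0, 1[) (cos (vt s) * L).
  apply: eq_Rintegral => s _; rewrite ger0_norm//.
  exact: cos_ge0_pihalf (rearrb s).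
move=> ->.
transitivity (\int[mu]_(x in `]0, 1[) v1 x); last first.
  by rewrite -(pg_diff1 pg)// /coord1 start stop /= subr0.
apply: eq_Rintegral => t /[!inE]/= tI; have [s0 E _ b] := pg_angle_cos_sin pg tI.
by rewrite (ger0_norm (cos_ge0_pihalf b)) E divfK// gt_eqF.
Qed.

Let isp := spd_integrable pg.

Let itL (u : R -> R) : measurable_fun I01 u -> (forall s, `|u s| <= 1) ->
  itg I01 (fun s => u s * L).
Proof.
move=> mu_ u1; apply: (@itg_bndM _ _ _ (cst L) 1) => //.
by apply: itgS (itg_cst 0 1 L) => //; exact: subset_itv_oo_cc.
Qed.

Lemma rearr_sin : \int[mu]_(s in `]0, 1[) (sin (vt s) * L) = 0.
Proof.
(* The sine is shifted by 1 to become nonnegative; the constant contributes the same length to both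
   sides and cancels. *)
have msin : measurable_fun setT (fun z : R => 1 + sin z).
  by apply: measurable_funD => //; exact: continuous_measurable_fun (@continuous_sin R).
have sin0 z : 0 <= 1 + sin z :> R by have := sin_geN1 z; lra.
have H1 := @rearr_moment_real (cst 1) (measurable_cst _) (fun=> ler01).
have := rearr_moment_real msin sin0.
have msvt : measurable_fun I01 (fun s => sin (vt s)).
  apply: (@measurableT_comp _ _ _ _ _ _ (sin : R -> R) _ vt); last exact: mvt.
  exact: continuous_measurable_fun (@continuous_sin R).
have il : itg I01 (fun s => sin (vt s) * L).
  by apply: itL => // s; rewrite ler_norml sin_geN1 sin_le1.
have i1 : itg I01 (fun s => cst 1 (vt s) * L).
  by apply: itL => // s; rewrite normr1.
have -> : \int[mu]_(s in `]0, 1[) ((1 + sin (vt s)) * L) =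
    \int[mu]_(s in `]0, 1[) (cst 1 (vt s) * L) + \int[mu]_(s in `]0, 1[) (sin (vt s) * L).
  by rewrite -RintegralD//; apply: eq_Rintegral => s _; rewrite mulrDl.
have sE (t : R) : t \in `]0, 1[ -> sin (th t) * sp t = v2 t.
  by move=> tI; have [s0 _ -> _] := pg_angle_cos_sin pg tI; rewrite divfK// gt_eqF.
have -> : \int[mu]_(t in `]0, 1[) ((1 + sin (th t)) * sp t) =
    \int[mu]_(t in `]0, 1[) sp t + \int[mu]_(t in `]0, 1[) v2 t.
  rewrite -(RintegralD _ isp (pg_integrable2 pg))//; apply: eq_Rintegral => t /[!inE]/= tI.
  by rewrite mulrDl mul1r sE.
rewrite H1 -(pg_diff2 pg)// /coord2 start stop /= subr0.
have -> : \int[mu]_(t in `]0, 1[) (cst 1 (th t) * sp t) = \int[mu]_(t in `]0, 1[) sp t.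
  by apply: eq_Rintegral => t _; rewrite mul1r.
lra.
Qed.

Lemma tangent_height_le_rearr (p t : R) : - (pi / 2) <= p <= pi / 2 -> t \in `[0, 1] ->
  tangent_height p (gamma t) <= \int[mu]_(s in `]0, 1[) (Num.max 0 (sin (vt s - p)) * L).
Proof.
move=> pb; rewrite in_itv/= => /andP[t0 t1].
pose phi (z : R) := Num.max 0 (sin (z - p)).
have cphi : continuous phi.
  move=> z; apply: (@continuous_max _ _ (cst 0) (fun z => sin (z - p))); first exact: cvg_cst.
  apply: (@continuous_comp _ _ _ (fun z => z - p) sin); last exact: continuous_sin.
  by apply: cvgB; [exact: cvg_id|exact: cvg_cst].
have phi0 z : 0 <= phi z by rewrite /phi le_max lexx.
have phi1 z : phi z <= 1 by rewrite /phi ge_max ler01 sin_le1.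
rewrite [leRHS](rearr_moment_real (continuous_measurable_fun cphi) phi0).
have sub : (`]0%R, t[%classic : set R) `<=` I01 by apply: subset_itv; rewrite bnd_simp.
have iphi : itg I01 (fun x => phi (th x) * sp x).
  apply: (@itg_bndM _ _ _ sp 1) => //.
    apply: (@measurableT_comp _ _ _ _ _ _ phi _ th); first exact: continuous_measurable_fun.
    exact: (@measurable_wm_map _ w).
  by move=> x _; rewrite ger0_norm.
have i1 : itg (`]0%R, t[%classic : set R) v1 by apply: itgS (pg_integrable1 pg).
have i2 : itg (`]0%R, t[%classic : set R) v2 by apply: itgS (pg_integrable2 pg).
have -> : tangent_height p (gamma t) =
    \int[mu]_(x in `]0, t[) (cos p * v2 x - sin p * v1 x).
  rewrite RintegralB//; last 2 first.
  - exact: itgZ.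
  - exact: itgZ.
  rewrite !RintegralZl// -(pg_diff1 pg)// -(pg_diff2 pg)// /tangent_height /coord1 /coord2 start.
  by rewrite !subr0; ring.
apply: (@le_trans _ _ (\int[mu]_(x in `]0, t[) (phi (th x) * sp x))).
  apply: le_Rintegral => //.
  - by apply: itgB => //; exact: itgZ.
  - exact: itgS iphi.
  move=> x /sub /= xI; have [s0 E1 E2 _] := pg_angle_cos_sin pg xI.
  have -> : cos p * v2 x - sin p * v1 x = sin (th x - p) * sp x.
    by rewrite sinB E1 E2; field; rewrite gt_eqF.
  by rewrite ler_wpM2r ?(ltW s0)// /phi le_max lexx orbT.
rewrite /Rintegral fine_le//.
- exact: (@integrable_fin_num _ _ _ mu _ (measurable_itv _) _ (itgS _ _ sub iphi)).
- exact: (@integrable_fin_num _ _ _ mu _ (measurable_itv _) _ iphi).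
apply: ge0_subset_integral => //.
- exact: (measurable_int mu iphi).
- by move=> x _; rewrite lee_fin mulr_ge0// sqrtr_ge0.
Qed.

Variable r : R -> R.
Hypotheses (mr : measurable_fun setT r) (r0 : forall z, 0 <= r z)
  (rE : forall A : set R, measurable A ->
      mu (wm_range w `&` A) = (\int[N]_(z in A) (r z)%:E)%E).
Local Notation g := (rearr_deriv w (pi / 2) r).

Lemma rearr_deriv_sqr_integral (A : set R) : measurable A ->
  (\int[mu]_(s in I01 `&` vt @^-1` A) (r (vt s) ^+ 2 * L)%:E =
   \int[mu]_(z in wm_range w `&` A) (r z)%:E)%E.
Proof.
move=> mA; rewrite (@integral_rearr_deriv _ w _ r wD c0 thc wpos mr r0 rE)//.
by apply: eq_integral => s _; rewrite /rearr_deriv mulrA -expr2.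
Qed.

(** Angles outside the range cost nothing, even where [vt] is flat at an extreme value: [r] vanishes
    there up to an N-null set. *)
Lemma rearr_energy_range :
  (\int[mu]_(s in I01) (g s ^+ 2 / L)%:E =
   \int[mu]_(s in I01 `&` vt @^-1` (wm_range w)) (r (vt s) ^+ 2 * L)%:E)%E.
Proof.
have L0' := L0.
rewrite rearr_deriv_sqr_integral; last exact: measurable_wm_range.
have := rearr_deriv_sqr_integral measurableT.
rewrite preimage_setT !setIT setIid => <-.
by apply: eq_integral => s _; rewrite /rearr_deriv; congr EFin; field; rewrite gt_eqF.
Qed.

Lemma rearr_elastic_le : (\int[mu]_(s in I01) (g s ^+ 2 / L)%:E <= elastic gamma)%E.
Proof.
rewrite (pg_elastic pg).
pose k := turning v1 v2 (dd1 gamma) (dd2 gamma).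
pose e t := k t ^+ 2 / sp t.
have k0 t : 0 <= k t by exact: turning_ge0.
have s0 t : t \in `]0, 1[ -> 0 < sp t by move=> /(pg_angle_cos_sin pg)[].
have mk : measurable_fun I01 k by exact: locally_int_measurable (pg_turning_int pg).
have [ei e00 H] := pg_immersed pg.
have me : measurable_fun I01 e.
  apply: measurable_funM; first exact: measurable_funX.
  exact: (locally_int_measurable (continuous_locally_int
    (spdV_continuous e00 (pg_primitive_d1 pg) (pg_primitive_d2 pg) H))).
have e0 t : 0 <= e t by rewrite divr_ge0 ?sqr_ge0 ?sqrtr_ge0.
rewrite -[leRHS]/(\int[mu]_(t in I01) (e t)%:E)%E.
have [fin|] := ltP (\int[mu]_(t in I01) (e t)%:E)%E +oo%E; last first.
  by rewrite leye_eq => /eqP ->; rewrite leey.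
have ie : itg I01 e.
  apply/integrableP; split; first exact/measurable_EFinP.
  by under eq_integral do rewrite /= ger0_norm ?e0//.
(* From (k - sp)^2 >= 0 follows 2 k <= e + sp, so finite energy makes the turning integrable up to
   the end points. *)
have ik : itg I01 k.
  apply: (@itg_le _ _ _ (fun t => e t + sp t)) => //; last exact: itgD.
  move=> t /= tI; rewrite ger0_norm//; have st := s0 t tI.
  have : 0 <= (k t - sp t) ^+ 2 / sp t by rewrite divr_ge0 ?sqr_ge0// ltW.
  have -> : (k t - sp t) ^+ 2 / sp t = e t - 2 * k t + sp t.
    by rewrite /e; field; rewrite gt_eqF.
  by have := k0 t; have := e0 t; lra.
rewrite rearr_energy_range.
apply: (@rearr_energy_le _ w _ r wD c0 thc wpos mr r0 rE I01 th k sp e (wm_range w)) => //.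
- exact: (@measurable_wm_map _ w).
- by move=> x _; exact: sqrtr_ge0.
- by move=> x /= xI; rewrite /e divfK// gt_eqF// s0.
- exact: measurable_wm_range.
- move=> B mB.
  exact: (@range_le_integral _ w k wD (pg_angle_continuous pg) (pg_turning_int pg)
    (fun t _ => k0 t) (pg_angle_increment pg) B mB).
Qed.

End pseudograph_rearrangement.

Lemma atan_lipschitz {R : realType} (x y : R) : `|atan y - atan x| <= `|y - x|.
Proof.
have H (a b : R) : a < b -> `|atan b - atan a| <= `|b - a|.
  move=> ab; have ca : {within `[a, b], continuous (@atan R)}.
    by apply: continuous_subspaceT => z; exact: continuous_atan.
  have [z _ ->] := MVT ab (fun z _ => is_derive1_atan z) ca.
  rewrite normrM ler_piMl// ger0_norm ?invr_ge0 ?addr_ge0 ?sqr_ge0//.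
  by rewrite invf_le1 ?ltr_wpDr ?sqr_ge0// lerDl sqr_ge0.
by have [/H|/H|->] := ltgtP x y; [|rewrite distrC (distrC y)|rewrite !subrr].
Qed.

Lemma Lp_loc2_int {R : realType} (a b : R) (h : R -> R) :
  Lp_loc 2%:E a b h -> locally_int a b h.
Proof.
move=> H c d ac db; have /Lp2P[//|mh fin] := H c d ac db.
have i2 : (@lebesgue_measure R).-integrable `[c, d] (EFin \o (fun x => h x ^+ 2)).
  apply/integrableP; split; first by apply/measurable_EFinP; exact: measurable_funX.
  by under eq_integral do rewrite /= ger0_norm ?sqr_ge0//.
apply: (@itg_le _ _ _ (fun x => 1 + h x ^+ 2)) => //; last by apply: itgD => //; exact: itg_cst.
move=> x _; rewrite -[h x ^+ 2]real_normK ?num_real//.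
by have := sqr_ge0 (`|h x| - 1); have := sqr_ge0 (`|h x|); nra.
Qed.

(** * Local energy bound from the graph regularity of the old curve *)

Section local_energy.
Context {R : realType}.
Local Notation mu := (@lebesgue_measure R).
Local Notation itg D f := (mu.-integrable D (EFin \o f)).
Local Notation I01 := (`]0%R, 1%R[%classic : set R).
Variable gamma : R -> R * R.
Hypotheses (pg : pseudograph gamma) (start : gamma 0 = (0, 0)) (stop : gamma 1 = (1, 0)).
Local Notation X := (coord1 gamma).
Local Notation Y := (coord2 gamma).
Local Notation v1 := (d1 gamma).
Local Notation v2 := (d2 gamma).
Local Notation sp := (spd v1 v2).
Local Notation th := (angle v1 v2).
Local Notation w := (angle_map pg).
Local Notation N := (image_measure w).
Local Notation vt := (rearr w (pi / 2)).
Local Notation L := (total_weight w).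

Let c0 := pihalf_ge0 (R := R).
Let thc := pg_angle_bnd pg.
Let wpos := pg_weight_gt0 pg start stop.
Let L0 : 0 < L := wpos.
Let wD : wm_dom w = I01 := erefl.

Variable r : R -> R.
Hypotheses (mr : measurable_fun setT r) (r0 : forall z, 0 <= r z)
  (rE : forall A : set R, measurable A ->
      mu (wm_range w `&` A) = (\int[N]_(z in A) (r z)%:E)%E).
Local Notation g := (rearr_deriv w (pi / 2) r).

Section graph.
Variables (a b : R).
Hypotheses (a0 : 0 <= a) (ab : a < b) (b1 : b <= 1)
  (v0 : forall t, t \in `]a, b[ -> 0 < v1 t).
Local Notation tau := (inv_on a b X).

Let sub1 (t : R) : t \in `]a, b[ -> t \in `]0, 1[.
Proof. exact: itvoo_widen. Qed.

Let cX : {within `[a, b], continuous X}.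
Proof.
apply: (continuous_subspaceW _ (within_coord1 (pg_continuous pg))).
by apply: subset_itv; rewrite bnd_simp.
Qed.

Let dX (t : R) : t \in `]a, b[ -> is_derive t 1 X (v1 t).
Proof. by move=> /sub1; exact: pg_derivable1. Qed.

Let cv1 : {in `]a, b[, continuous v1}.
Proof. by move=> t /sub1; exact: (primitive_continuous (pg_primitive_d1 pg)). Qed.

Let cv2 : {in `]a, b[, continuous v2}.
Proof. by move=> t /sub1; exact: (primitive_continuous (pg_primitive_d2 pg)). Qed.

Let slope x := v2 (tau x) / v1 (tau x).

Lemma slope_angle (t : R) : t \in `]a, b[ -> atan (slope (X t)) = th t.
Proof.
move=> tI; rewrite /slope (inv_on_left cX dX v0 tI).
have [s0 E1 E2 /andP[h1 h2]] := pg_angle_cos_sin pg (sub1 tI).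
have c1 : 0 < cos (th t) by rewrite E1 divr_gt0// v0.
have -> : v2 t / v1 t = tan (th t).
  by rewrite /tan E1 E2; field; rewrite !gt_eqF ?v0.
apply: tanK; rewrite in_itv/= !lt_neqAle h1 h2 !andbT; apply/andP; split; apply/eqP => E.
  by move: c1; rewrite -E cosN cos_pihalf ltxx.
by move: c1; rewrite E cos_pihalf ltxx.
Qed.

Lemma slope_primitive : exists2 h, primitive (X a) (X b) slope h & Lp_loc 2%:E (X a) (X b) h.
Proof.
have pY := primitive_subitv a0 b1 (pg_primitive2 pg).
have pu := graph_primitive ab cX dX cv1 v0 cv2 pY.
(* Applied to the identity, [graph_primitive] exhibits [tau] as a primitive and so gives its
   continuity. *)
have pid : primitive a b id (cst 1).
  split=> [s t _ _|s t _ st _]; first exact: itg_cst.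
  by rewrite Rintegral_itv_cst// mul1r.
have ctau : {in `]X a, X b[, continuous tau}.
  apply: (primitive_continuous (graph_primitive ab cX dX cv1 v0 _ pid)) => t _.
  exact: cvg_cst.
have cs : {in `]X a, X b[, continuous slope}.
  move=> x xI; have [tI _] := inv_on_right ab cX dX v0 xI.
  apply: (@continuous_comp _ _ _ tau (fun t => v2 t / v1 t)); first exact: ctau.
  apply: cvgM; first exact: cv2.
  by apply: cvgV; [rewrite gt_eqF// v0|exact: cv1].
have [_ [g' wg [Lg [h wh [Lh _]]]]] := pg_graph pg a0 ab b1 v0.
have [cd df _ ph] := weak_derivative2_regular (primitive_continuous pu)
  (Lp_loc2_int Lg) (Lp_loc2_int Lh) wg wh.
exists h => //; apply: (eq_primitive _ ph) => x xI.
by have [_ H] := primitive_is_derive pu xI (cs x xI); rewrite derive1E; exact: H.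
Qed.

Variables (s t p q z2 z1 : R).
Hypotheses (sa : a < s) (st : s <= t) (tb : t < b) (pI : p \in `[s, t])
  (qI : q \in `[s, t]) (thp : th p <= z2) (thq : z1 <= th q).

Let subI (x : R) : x \in `[s, t] -> x \in `]a, b[.
Proof. exact: itvcc_oo. Qed.

(* [rearr_energy_le] for the angle as a function of the abscissa: there it is the
   arctangent of a slope with square-integrable derivative. *)
Lemma local_energy_finite :
  (\int[mu]_(x in I01 `&` vt @^-1` `]z2, z1[%classic) (r (vt x) ^+ 2 * L)%:E < +oo)%E.
Proof.
have [h ph Lh] := slope_primitive.
have mX := increasing_of_derive cX dX v0.
have Xs : X a < X s by apply: mX => //; exact: ltW (le_lt_trans st tb).
have Xt : X t < X b by apply: mX => //; exact: ltW (lt_le_trans sa st).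
have Xmono x y : x \in `[s, t] -> y \in `[s, t] -> x <= y -> X x <= X y.
  move=> /subI; rewrite in_itv/= => /andP[ax _] /subI; rewrite in_itv/= => /andP[_ yb].
  by rewrite le_eqVlt => /predU1P[->//|xy]; apply/ltW/mX => //; exact: ltW.
have sI : s \in `[s, t] by rewrite in_itv/= lexx.
have tI : t \in `[s, t] by rewrite in_itv/= lexx andbT.
have XI x : x \in `[s, t] -> X x \in `[X s, X t].
  by move=> xI; move: (xI); rewrite !in_itv/= => /andP[h1 h2]; rewrite !Xmono.
have subX x : x \in `[X s, X t] -> x \in `]X a, X b[ by exact: itvcc_oo.
have ih : itg `[X s, X t] h by apply: ph.1.
pose k x := `|h x|.
have ik : itg `[X s, X t] k by exact: itg_abs.
pose Th x := atan (slope x).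
have cTh : {in `[X s, X t], continuous Th}.
  move=> x /subX xI; apply: (@continuous_comp _ _ _ slope atan).
    exact: (primitive_continuous ph).
  exact: continuous_atan.
have Linc x y : X s <= x -> x <= y -> y <= X t ->
    `|Th y - Th x| <= \int[mu]_(z in `[x, y]) k z.
  move=> sx xy yt; apply: (le_trans (atan_lipschitz _ _)).
  rewrite ph.2//; [|exact: lt_le_trans sx|exact: le_lt_trans Xt].
  by apply: le_Rintegral_norm => //; [apply: itg_itvS ih|apply: itg_itvS ik].
have mh : measurable_fun `[X s, X t] h by exact: itg_measurable.
have mh2 : measurable_fun `[X s, X t] (fun x => h x ^+ 2) by exact: measurable_funX.
have /Lp2P[//|_ fin] := Lh _ _ Xs Xt.
apply: le_lt_trans fin.
have subr : (`]z2, z1[%classic : set R) `<=` wm_range w.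
  move=> z; rewrite /= in_itv/= => /andP[hz1 hz2]; exists p, q; split.
  - exact/sub1/subI.
  - exact/sub1/subI.
  - by rewrite (le_lt_trans thp hz1) (lt_le_trans hz2 thq).
have mTh : measurable_fun `[X s, X t] Th by exact: in_continuous_measurable.
apply: (@rearr_energy_le _ w _ r wD c0 thc wpos mr r0 rE (`[X s, X t]%classic : set R)
  Th k (cst 1) (fun x => h x ^+ 2) (`]z2, z1[%classic : set R)) => //.
- exact: itg_cst.
- by move=> x _; exact: normr_ge0.
- by move=> x _; rewrite sqr_ge0.
- by move=> x _; rewrite /k real_normK ?num_real// mulr1.
- move=> B mB.
  have [v [vD vm vw]] := integrable_itv_restrict cTh ik (fun x _ => normr_ge0 (h x)).
  have := @le_image_measure_crossing _ (X s) (X t) v vD _ _ (X p) (X q) z2 z1 B.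
  rewrite vm vw => /(_ cTh Linc (XI p pI) (XI q qI)).
  rewrite /Th !slope_angle; [|exact: subI|exact: subI].
  by move=> /(_ thp thq mB); rewrite /image_measure vD vm vw.
move=> B mB.
pose chi (y : R) := \1_B (th y) : R.
have mth : measurable_fun I01 th by exact: (@measurable_wm_map _ w).
have mchi : measurable_fun I01 chi.
  by apply: (@measurableT_comp _ _ _ _ _ _ (\1_B : R -> R) _ th) => //; exact: measurable_indic.
have mchi' : measurable_fun (`]a, b[%classic : set R) chi.
  by apply: measurable_funS mchi => // x /= /sub1.
have chi0 y : 0 <= chi y by rewrite /chi indicE.
have indE (C : set R) (u : R -> R) y : ((EFin \o u) \_ C) y = (\1_C y * u y)%:E.
  by rewrite patchE indicE; case: ifP => _; rewrite ?mul1r ?mul0r.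
have -> : (\int[mu]_(x in `[X s, X t] `&` Th @^-1` B) (cst 1 x)%:E =
    \int[mu]_(x in `[X s, X t]) (chi (tau x))%:E)%E.
  rewrite integral_mkcondr; apply: eq_integral => x /[!inE]/= /subX xI.
  rewrite (indE _ (cst 1)) mulr1; have [yI yE] := inv_on_right ab cX dX v0 xI.
  by rewrite /chi -slope_angle// yE !indicE.
rewrite (integral_inv_on ab cX dX cv1 v0 sa st tb mchi' chi0).
have -> : N B = (\int[mu]_(x in I01) (chi x * sp x)%:E)%E.
  rewrite /image_measure integral_mkcondr; apply: eq_integral => x _.
  by rewrite (indE _ sp) /chi !indicE.
have sub01 : (`[s, t]%classic : set R) `<=` I01 by move=> x /= /subI/sub1.
have msp : measurable_fun I01 sp by exact: spd_measurable.
(* dx = v1 dt is at most arc length, so the arc weighted by its abscissa has a distribution of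
   angles below N. *)
apply: (@le_trans _ _ (\int[mu]_(x in `[s, t]) (chi x * sp x)%:E)%E).
  apply: ge0_le_integral => //=.
  - by move=> x /subI xI; rewrite lee_fin mulr_ge0// ltW// v0.
  - apply/measurable_EFinP; apply: measurable_funM; first exact: measurable_funS mchi.
    by apply: in_continuous_measurable => x /subI; exact: cv1.
  - apply/measurable_EFinP; apply: measurable_funM; first exact: measurable_funS mchi.
    exact: measurable_funS msp.
  - by move=> x _; rewrite lee_fin ler_wpM2l// (le_trans (ler_norm _))// spd_ge1.
apply: ge0_subset_integral => //.
- by apply/measurable_EFinP; exact: measurable_funM.
- by move=> x _; rewrite lee_fin mulr_ge0// sqrtr_ge0.
Qed.

End graph.
End local_energy.

Lemma itv_closure_bnd {R : realType} (f : R -> R) (s t z2 z1 : R) : s < t ->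
  {for s, continuous f} -> {for t, continuous f} ->
  (forall x, x \in `]s, t[ -> z2 < f x < z1) ->
  (z2 <= f s <= z1) /\ (z2 <= f t <= z1).
Proof.
move=> st cs ct H.
have near (u : R) (P : R -> Prop) : s <= u <= t -> (\forall x \near u, P x) ->
    exists2 x, x \in `]s, t[ & P x.
  move=> /andP[su ut] /nbhs_ballP[e /= e0 He].
  pose d := Num.min (e / 2) ((t - s) / 2).
  have d0 : 0 < d by rewrite lt_min !divr_gt0// subr_gt0.
  have d1 : d <= e / 2 by rewrite ge_min lexx.
  have d2 : d <= (t - s) / 2 by rewrite ge_min lexx orbT.
  have [us|us] := leP u ((s + t) / 2).
    exists (u + d / 2); first by rewrite in_itv/=; apply/andP; lra.
    by apply: He; rewrite /ball/= ltr_norml; apply/andP; lra.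
  exists (u - d / 2); first by rewrite in_itv/=; apply/andP; lra.
  by apply: He; rewrite /ball/= ltr_norml; apply/andP; lra.
have main (u : R) : s <= u <= t -> {for u, continuous f} -> z2 <= f u <= z1.
  move=> uI cu; rewrite !leNgt; apply/andP; split; apply/negP => fu.
    have n1 : \forall x \near u, f x < z2 by exact: (cvgr_lt _ cu).
    have [x /H/andP[h _] h'] := near u _ uI n1.
    by have := lt_trans h h'; rewrite ltxx.
  have n1 : \forall x \near u, z1 < f x by exact: (cvgr_gt _ cu).
  have [x /H/andP[_ h] h'] := near u _ uI n1.
  by have := lt_trans h h'; rewrite ltxx.
by split; apply: main => //; rewrite lexx ltW.
Qed.

Lemma ends_of_diff {R : realFieldType} (z1 z2 x y : R) :
  z1 - z2 <= x - y -> x <= z1 -> z2 <= y -> y <= z2 /\ z1 <= x.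
Proof. by move=> h1 h2 h3; split; lra. Qed.

Lemma positive_neighborhood {R : realType} (f : R -> R) (s t : R) : 0 < s -> s <= t -> t < 1 ->
  {for s, continuous f} -> {for t, continuous f} ->
  (forall x, x \in `[s, t] -> 0 < f x) ->
  exists a b, [/\ 0 <= a, a < s, t < b, b <= 1 & forall x, x \in `]a, b[ -> 0 < f x].
Proof.
move=> s0 st t1 cs ct f0.
have sI : 0 < f s by apply: f0; rewrite in_itv/= lexx.
have tI : 0 < f t by apply: f0; rewrite in_itv/= lexx andbT.
have n1 : \forall x \near s, 0 < f x by exact: (cvgr_gt _ cs).
have n2 : \forall x \near t, 0 < f x by exact: (cvgr_gt _ ct).
have [d1 /= d10 H1] := (nbhs_ballP _ _).1 n1.
have [d2 /= d20 H2] := (nbhs_ballP _ _).1 n2.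
exists (Num.max 0 (s - d1)), (Num.min 1 (t + d2)); split.
- by rewrite le_max lexx.
- by rewrite gt_max s0 gtrBl.
- by rewrite lt_min t1 ltrDl.
- by rewrite ge_min lexx.
move=> x; rewrite in_itv/= gt_max lt_min => /andP[/andP[_ h1] /andP[_ h2]].
have [xs|sx] := ltP x s.
  by apply: H1; rewrite /ball/= ltr_norml; apply/andP; lra.
have [tx|xt] := ltP t x.
  by apply: H2; rewrite /ball/= ltr_norml; apply/andP; lra.
by apply: f0; rewrite in_itv/= sx.
Qed.

(** * The rearranged angle is an angle profile *)

Section profile.
Context {R : realType}.
Local Notation mu := (@lebesgue_measure R).
Local Notation itg D f := (mu.-integrable D (EFin \o f)).
Local Notation I01 := (`]0%R, 1%R[%classic : set R).
Variable gamma : R -> R * R.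
Hypotheses (pg : pseudograph gamma) (start : gamma 0 = (0, 0)) (stop : gamma 1 = (1, 0)).
Local Notation v1 := (d1 gamma).
Local Notation v2 := (d2 gamma).
Local Notation sp := (spd v1 v2).
Local Notation th := (angle v1 v2).
Local Notation w := (angle_map pg).
Local Notation N := (image_measure w).
Local Notation vt := (rearr w (pi / 2)).
Local Notation L := (total_weight w).

Let c0 := pihalf_ge0 (R := R).
Let thc := pg_angle_bnd pg.
Let wpos := pg_weight_gt0 pg start stop.
Let L0 : 0 < L := wpos.
Let wD : wm_dom w = I01 := erefl.
Let mono := rearr_noninc c0 wpos.

(* The level sets of the angle beyond its rearrangement at an interior time have
   positive weight, hence are nonempty. *)
Lemma angle_attains (A D : set R) : measurable A -> measurable D -> D `<=` I01 ->
  (0 < mu D)%E -> (forall s, D s -> A (vt s)) -> exists2 t, t \in `]0, 1[ & A (th t).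
Proof.
move=> mA mD DI D0 DA; apply: contrapT => H.
have N0 : N A = 0%E.
  by apply: (image_measure_eq0 wD) => t tI At; apply: H; exists t.
have := @image_measure_rearr _ w _ wD c0 thc wpos A mA.
rewrite N0 => E; move: D0; apply/negP; rewrite -leNgt.
have : (L%:E * mu D <= 0)%E.
  rewrite -E -integral_cst//; apply: ge0_subset_integral => //.
  - exact: (@measurable_wm_map _ (rearr_map c0 wpos) (measurable_itv _) _ mA).
  - by move=> x _; rewrite lee_fin ltW.
  - by move=> x Dx; split; [exact: DI|exact: DA].
by rewrite pmule_rle0.
Qed.

Variable r : R -> R.
Hypotheses (mr : measurable_fun setT r) (r0 : forall z, 0 <= r z)
  (rE : forall A : set R, measurable A ->
      mu (wm_range w `&` A) = (\int[N]_(z in A) (r z)%:E)%E).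
Local Notation g := (rearr_deriv w (pi / 2) r).

(** On an arc of [gamma0] that crosses from one level to the other, the angle stays in [[z2, z1]],
    away from the vertical. The arc therefore sits in a larger one that is a graph, to which
    [local_energy_finite] applies. *)
Let energy_strip (z2 z1 : R) : z2 < z1 -> z1 < pi / 2 -> - (pi / 2) < z2 ->
  (exists2 p, p \in `]0, 1[ & th p <= z2) -> (exists2 q, q \in `]0, 1[ & z1 <= th q) ->
  (\int[mu]_(x in I01 `&` vt @^-1` `]z2, z1[%classic) (r (vt x) ^+ 2 * L)%:E < +oo)%E.
Proof.
move=> z21 z1p z2p [p pI thp] [q qI thq].
have cth := pg_angle_continuous pg.
have subc (x y z : R) : x \in `]0, 1[ -> y \in `]0, 1[ -> z \in `[x, y] -> z \in `]0, 1[.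
  rewrite !in_itv/= => /andP[x0 _] /andP[_ y1] /andP[xz zy].
  by rewrite (lt_le_trans x0 xz) (le_lt_trans zy y1).
have cthN : {in `]0, 1[, continuous (fun x => - th x)}.
  by move=> x xI; apply: cvgN; exact: cth.
suff [s [t [s0 [st t1 Hst [p' [q' [pI' qI' hp hq]]]]]]] : exists s t,
    0 < s /\ [/\ s < t, t < 1, forall x, x \in `]s, t[ -> z2 < th x < z1 &
      exists p' q', [/\ p' \in `[s, t], q' \in `[s, t], th p' <= z2 & z1 <= th q']].
  have sI : s \in `]0, 1[ by rewrite in_itv/= s0 (lt_trans st t1).
  have tI : t \in `]0, 1[ by rewrite in_itv/= t1 (lt_trans s0 st).
  have [hs ht] := itv_closure_bnd st (cth _ sI) (cth _ tI) Hst.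
  have v0 x : x \in `[s, t] -> 0 < v1 x.
    move=> xI; have [sp0 E _ _] := pg_angle_cos_sin pg (subc _ _ _ sI tI xI).
    have /andP[h1 h2] : z2 <= th x <= z1.
      have [->//|xs] := eqVneq x s; have [->//|xt] := eqVneq x t.
      have /Hst/andP[/ltW -> /ltW ->] // : x \in `]s, t[.
      move: xI; rewrite !in_itv/= => /andP[sx tx].
      by rewrite lt_neqAle eq_sym xs sx lt_neqAle xt.
    have : 0 < cos (th x).
      by apply: cos_gt0_pihalf; rewrite (lt_le_trans z2p h1) (le_lt_trans h2 z1p).
    by rewrite E pmulr_lgt0// invr_gt0.
  have cv := primitive_continuous (pg_primitive_d1 pg).
  have [a [b [a0 sa tb b1 vab]]] := positive_neighborhood s0 (ltW st) t1 (cv _ sI) (cv _ tI) v0.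
  exact: (@local_energy_finite _ _ pg start stop r mr r0 rE a b a0
    (lt_trans sa (lt_trans st tb)) b1 vab s t p' q' z2 z1 sa (ltW st) tb pI' qI' hp hq).
have [pq|qp] := leP p q.
  have [s [t [ps st tq dst Hst]]] := crossing_interval pq
    (fun x xI => cth _ (subc _ _ _ pI qI xI)) z21 thp thq.
  have sI : s \in `]0, 1[ by apply: (subc p q) => //; rewrite in_itv/= ps (le_trans (ltW st) tq).
  have tI : t \in `]0, 1[ by apply: (subc p q) => //; rewrite in_itv/= tq (le_trans ps (ltW st)).
  have [/andP[hs1 hs2] /andP[ht1 ht2]] := itv_closure_bnd st (cth _ sI) (cth _ tI) Hst.
  exists s, t; split; first by move: sI; rewrite in_itv/= => /andP[].
  split => //; first by move: tI; rewrite in_itv/= => /andP[].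
  have [h1 h2] := ends_of_diff dst ht2 hs1.
  by exists s, t; split; rewrite ?in_itv/= ?lexx ?(ltW st).
have thp' : - z2 <= - th p by rewrite lerN2.
have thq' : - th q <= - z1 by rewrite lerN2.
have z12 : - z1 < - z2 by rewrite ltrN2.
have [s [t [qs st tp dst Hst]]] := crossing_interval (ltW qp)
  (fun x xI => cthN _ (subc _ _ _ qI pI xI)) z12 thq' thp'.
have sI : s \in `]0, 1[ by apply: (subc q p) => //; rewrite in_itv/= qs (le_trans (ltW st) tp).
have tI : t \in `]0, 1[ by apply: (subc q p) => //; rewrite in_itv/= tp (le_trans qs (ltW st)).
have {}Hst x : x \in `]s, t[ -> z2 < th x < z1.
  by move=> /Hst; rewrite !ltrN2 andbC.
have [/andP[hs1 hs2] /andP[ht1 ht2]] := itv_closure_bnd st (cth _ sI) (cth _ tI) Hst.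
exists s, t; split; first by move: sI; rewrite in_itv/= => /andP[].
split => //; first by move: tI; rewrite in_itv/= => /andP[].
have {}dst : z1 - z2 <= th s - th t by move: dst; rewrite !opprK ![- _ + _]addrC.
have [h1 h2] := ends_of_diff dst hs2 ht1.
by exists t, s; split; rewrite ?in_itv/= ?lexx ?(ltW st).
Qed.

(** The integral is at most [L] times that of [r] over the part of the range in [[vt d, vt c]]. End
    points are null, so [energy_strip] on the open interval suffices; [angle_attains] supplies the
    times at which [gamma0] reaches the levels [vt d] and [vt c]. *)
Lemma rearr_deriv_L2 (c d : R) : 0 < c -> c <= d -> d < 1 ->
  vt c < pi / 2 -> - (pi / 2) < vt d ->
  (\int[mu]_(t in `[c, d]) (g t ^+ 2)%:E < +oo)%E.
Proof.
move=> hc cd hd hvc hvd.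
have cI : c \in `]0, 1[ by rewrite in_itv/= hc (le_lt_trans cd hd).
have dI : d \in `]0, 1[ by rewrite in_itv/= hd (lt_le_trans hc cd).
have vdc : vt d <= vt c by exact: mono.
have mvt (D : set R) : measurable D -> measurable_fun D vt.
  exact: (rearr_measurable c0 wpos).
have oo_fin : (\int[mu]_(z in `]vt d, vt c[) (r z)%:E < +oo)%E.
  move: vdc; rewrite le_eqVlt => /predU1P[->|vlt].
    by rewrite set_itvoo0 integral_set0.
  have rr := @rearr_range _ w _ wD c0 thc wpos d c cI dI.
  rewrite -(setIidr rr) -(rearr_deriv_sqr_integral start stop mr r0 rE)//.
  apply: energy_strip => //.
    have [|||||t tI At] := @angle_attains `]-oo, vt d]%classic `[d, 1[%classic; last by exists t.
    - by [].
    - by [].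
    - by apply: subset_itvr; rewrite bnd_simp (lt_le_trans hc cd).
    - by rewrite [ltRHS](@lebesgue_measure_itv R `[d, 1[)/= lte_fin hd lte_fin subr_gt0.
    - by move=> s /=; rewrite !in_itv/= => /andP[ds _]; exact: mono.
  have [|||||t tI At] := @angle_attains `[vt c, +oo[%classic `]0, c]%classic.
  - by [].
  - by [].
  - by apply: subset_itvl; rewrite bnd_simp (le_lt_trans cd hd).
  - by rewrite [ltRHS](@lebesgue_measure_itv R `]0, c])/= lte_fin hc lte_fin subr_gt0.
  - by move=> s /=; rewrite !in_itv/= andbT => /andP[_ sc]; exact: mono.
  by exists t => //; move: At; rewrite /= in_itv/= andbT.
have cc_fin : (\int[mu]_(z in wm_range w `&` `[vt d, vt c]) (r z)%:E < +oo)%E.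
  have mrD (D : set R) : measurable D -> measurable_fun D (EFin \o r).
    by move=> mD; apply/measurable_EFinP; exact: measurable_funTS.
  apply: le_lt_trans oo_fin.
  rewrite integral_itv_obnd_cbnd; last exact: mrD.
  rewrite integral_itv_bndo_bndc; last exact: mrD.
  apply: ge0_subset_integral => //.
  - by apply: measurableI => //; exact: measurable_wm_range.
  - exact: mrD.
  - by move=> z _; rewrite lee_fin.
rewrite -(rearr_deriv_sqr_integral start stop mr r0 rE)// in cc_fin.
have mpre : measurable (I01 `&` vt @^-1` `[vt d, vt c]%classic) by exact: mvt.
have mrv (D : set R) : measurable D -> measurable_fun D (fun s => r (vt s)).
  by move=> mD; apply: measurableT_comp => //; exact: mvt.
have sub : (`[c, d]%classic : set R) `<=` I01 `&` vt @^-1` `[vt d, vt c]%classic.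
  move=> s /=; rewrite !in_itv/= => /andP[cs sd].
  by rewrite (lt_le_trans hc cs) (le_lt_trans sd hd) !mono.
have gE s : (g s ^+ 2)%:E = (L%:E * (r (vt s) ^+ 2 * L)%:E)%E.
  by rewrite -EFinM /rearr_deriv; congr EFin; ring.
under eq_integral do rewrite gE.
have mI (D : set R) : measurable D -> measurable_fun D (fun s => (r (vt s) ^+ 2 * L)%:E).
  move=> mD; apply/measurable_EFinP; apply: measurable_funM => //.
  by apply: measurable_funX; exact: mrv.
have I0 s : (0 <= (r (vt s) ^+ 2 * L)%:E)%E by rewrite lee_fin mulr_ge0 ?sqr_ge0// ltW.
rewrite ge0_integralZl//; [|exact: mI|by rewrite lee_fin ltW].
apply: lte_mul_pinfty => //; first by rewrite lee_fin ltW.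
apply: le_lt_trans cc_fin; apply: ge0_subset_integral => //.
exact: mI.
Qed.

Lemma rearr_profile : angle_profile vt g L.
Proof.
split.
- exact: L0.
- exact: rearr_bnd.
- by move=> s t; exact: mono.
- by move=> t; exact: (@rearr_deriv_ge0 _ w _ r wpos r0 t).
- exact: (@integrable_rearr_deriv _ w _ r wD c0 thc wpos mr r0 rE).
- by move=> phi s t s0 st t1 mphi phi0; exact: (@chain_rule_rearr _ w _ r wD c0 thc wpos mr r0 rE).
- exact: rearr_cos.
- exact: rearr_sin.
- exact: rearr_deriv_L2.
Qed.

End profile.

Theorem theorem1p3 (R : realType) (psi : R -> R) (gamma0 : R -> R * R)
    (psi_admissible : admissible_obstacle psi) (gamma0_P : Ppsi psi gamma0) :
  exists gamma : R -> R * R,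
    [/\ Bset psi gamma0 gamma,
        forall b1 b2 : R, cap_shaped b1 b2 gamma ->
          concave_on `[0, 1] (graph_reparam b1 b2 gamma),
        (elastic gamma <= elastic gamma0)%E,
        (curve_length gamma <= curve_length gamma0)%E &
        forall eps : R, 0 <= eps ->
          (penalized eps gamma <= penalized eps gamma0)%E].
Proof.
have [_ [psi0 psi1] _ _] := psi_admissible.
have [pg start stop _] := gamma0_P.
have w0 t (tI : t \in `]0, 1[) : 0 < spd (d1 gamma0) (d2 gamma0) t.
  by have [] := pg_angle_cos_sin pg tI.
(* The turning is only locally integrable here, since the energy of [gamma0] may be infinite; the
   density exists all the same. *)
have [r [mr r0 rE]] := @rearr_density_exists _ (angle_map pg) (pi / 2)
  (turning (d1 gamma0) (d2 gamma0) (dd1 gamma0) (dd2 gamma0)) erefl (pg_angle_bnd pg)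
  (pg_angle_continuous pg) w0 (pg_turning_int pg) (fun t _ => turning_ge0 _ _ _ _ t)
  (pg_angle_increment pg).
have profile := rearr_profile start stop mr r0 rE.
have [b1 [b2 cap]] := cap_shaped_exists profile.
exists (curve (rearr (angle_map pg) (pi / 2)) (total_weight (angle_map pg))).
have EE : (elastic (curve (rearr (angle_map pg) (pi / 2)) (total_weight (angle_map pg)))
    <= elastic gamma0)%E.
  by rewrite (curve_of_angle_elastic profile); exact: rearr_elastic_le.
have LE : (curve_length (curve (rearr (angle_map pg) (pi / 2)) (total_weight (angle_map pg)))
    <= curve_length gamma0)%E.
  by rewrite (curve_of_angle_length profile) (curve_length_total pg).
split.
- apply: (curve_Bset profile psi0 psi1 gamma0_P _ _ cap).
    by move=> t; exact: pg_X_itv.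
  by move=> p t; exact: tangent_height_le_rearr.
- by move=> b1' b2' cap'; exact: (graph_reparam_concave profile cap').
- exact: EE.
- exact: LE.
- move=> eps eps0; apply: leeD; first exact: EE.
  by apply: lee_wpmul2l; [rewrite lee_fin|exact: LE].
Qed.
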